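(* There is a constant $C=C(n,\Lambda)>0$ such that the following holds. Let $a^{ij}$ be measurable with $(a^{ij}(x))$ symmetric and $0<\lambda I\le(a^{ij}(x))\le\Lambda I$ for a.e. $x\in B_1$, and let $w\ge0$ be a strong solution of $a^{ij}D_{ij}w=\chi_{\{w>0\}}$ in $B_1$. If $B_r(x_0)\subset B_1$ and $x_0\in\overline{\Omega}$, where $\Omega=\{w>0\}$, then $$\sup_{x\in B_r(x_0)}w(x)\ge C r^2 .$$
   Context: $B_r(x)\subset\mathbb R^n$ is the open ball of radius $r$ centered at $x$, $B_1=B_1(0)$. Repeated indices are summed, and $\chi_D$ is the characteristic function of $D$. A strong solution is a continuous function $w\in W^{2,p}_{loc}(B_1)$ with $p\ge n$ satisfying the equation almost everywhere. No regularity of the $a^{ij}$ beyond ellipticity is assumed. *)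

(* Defs.v *)
From HB Require Import structures.
From mathcomp Require Import all_boot all_order all_algebra.
From mathcomp Require Import all_classical all_reals all_analysis.
Set Implicit Arguments.
Unset Strict Implicit.
Unset Printing Implicit Defensive.
Import Order.TTheory GRing.Theory Num.Theory.
Import numFieldNormedType.Exports.
Local Open Scope classical_set_scope.
Local Open Scope ring_scope.

(* The norm of 'rV[R]_n in the library is the sup norm, so Euclidean balls are
   defined here. The topology is the same. *)
Definition enorm (R : realType) (n : nat) (v : 'rV[R]_n) : R :=
  Num.sqrt (\sum_i v 0 i ^+ 2).

Definition eball (R : realType) (n : nat) (x : 'rV[R]_n) (r : R)
  : set 'rV[R]_n := [set y | enorm (y - x) < r].

(* Lebesgue measure on R^(n+1): Caratheodory's construction from coverings by
   half-open boxes. Its sigma-algebra is that of all Lebesgue measurable sets.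
   The dimension is kept positive because a box of R^0 has volume 1, so that
   coverings by infinitely many boxes would not give measure 0 to set0. *)
Definition box (R : realType) (n : nat) (ab : 'rV[R]_n * 'rV[R]_n)
  : set 'rV[R]_n := [set x | forall i, ab.1 0 i < x 0 i <= ab.2 0 i].

Definition box_volume (R : realType) (n : nat) (ab : 'rV[R]_n * 'rV[R]_n) : R :=
  \prod_i Num.max 0 (ab.2 0 i - ab.1 0 i).

Definition lebesgue_outer (R : realType) (n : nat) (A : set 'rV[R]_n.+1)
  : \bar R :=
  ereal_inf [set (\sum_(k <oo) (box_volume (F k))%:E)%E
    | F in [set F : nat -> 'rV[R]_n.+1 * 'rV[R]_n.+1
                | A `<=` \bigcup_k box (F k)]].

Section lebesgue_outer_lemmas.
Variables (R : realType) (n : nat).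
Local Notation V := 'rV[R]_n.+1.
Local Notation mu := (@lebesgue_outer R n).
Local Open Scope ereal_scope.

Lemma box_volume_ge0 (ab : V * V) : (0 <= box_volume ab)%R.
Proof. by apply: prodr_ge0 => i _; rewrite le_max lexx. Qed.

Let volE_ge0 (ab : V * V) : 0 <= (box_volume ab)%:E.
Proof. by rewrite lee_fin box_volume_ge0. Qed.

Lemma lebesgue_outer_ge0 A : 0 <= mu A.
Proof.
by apply: le_ereal_inf_tmp => x [F _ <-{x}]; apply: nneseries_ge0 => k _ _.
Qed.

Lemma lebesgue_outer0 : mu set0 = 0.
Proof.
apply/eqP; rewrite eq_le lebesgue_outer_ge0 andbT.
apply: ereal_inf_lbound; exists (fun=> (0%R, 0%R)) => //=.
rewrite eseries0// => k _ _; congr EFin.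
by rewrite /box_volume big_ord_recl /= mxE subrr maxxx mul0r.
Qed.

Lemma le_lebesgue_outer : {homo mu : A B / A `<=` B >-> A <= B}.
Proof.
move=> A B AB; apply/ereal_inf_le_tmp => x [F BF] <-{x}.
by exists F => //; apply: subset_trans AB BF.
Qed.

Lemma lebesgue_outer_sigma_subadditive : sigma_subadditive mu.
Proof.
move=> A; have [[i ioo]|] := pselect (exists i, mu (A i) = +oo).
  rewrite (eseries_pinfty _ _ ioo) ?leey// => k _.
  by rewrite -ltNye (lt_le_trans _ (lebesgue_outer_ge0 _)).
rewrite -forallNE => Aoo.
suff add2e (e : {posnum R}) :
    mu (\bigcup_n A n) <= \sum_(i <oo) mu (A i) + e%:num%:E.
  by apply/lee_addgt0Pr => _/posnumP[].
rewrite (le_trans _ (epsilon_trick _ _ _))//; last first.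
  by move=> k; exact: lebesgue_outer_ge0.
pose P k (F : nat -> V * V) := A k `<=` \bigcup_j box (F j) /\
  \sum_(j <oo) (box_volume (F j))%:E <= mu (A k) + (e%:num / (2 ^ k.+1)%:R)%:E.
have [G PG] : {G : nat -> nat -> V * V & forall k, P k (G k)}.
  apply: (@choice _ _ P) => k; rewrite /P /lebesgue_outer.
  set S := (X in ereal_inf X); move infS : (ereal_inf S) => iS.
  case: iS infS => [r Sr|Soo|Soo].
  - have en1 : (0 < e%:num / (2 ^ k.+1)%:R)%R by [].
    have /(lb_ereal_inf_adherent en1) : ereal_inf S \is a fin_num by rewrite Sr.
    move=> [x [F AF volFx] xS].
    by exists F; split => //; rewrite volFx -Sr; exact/ltW.
  - by have := Aoo k; rewrite /lebesgue_outer Soo.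
  - suff : lbound S 0 by move/le_ereal_inf_tmp; rewrite Soo.
    by move=> /= _ [F AF <-]; exact: nneseries_ge0.
pose vG (x : nat * nat) := (box_volume (G x.1 x.2))%:E.
have vG_ge0 x : 0 <= vG x by exact: volE_ge0.
apply: (@le_trans _ _ (\esum_(i in setT) vG i)).
  apply: ereal_inf_lbound => /=.
  have /card_esym/ppcard_eqP[f] := card_nat2.
  exists (fun k => G (f k).1 (f k).2).
    move=> t [i _] /((PG i).1 _)[j _ ?]; exists (f^-1%FUN (i, j)) => //=.
    by rewrite invK ?inE.
  rewrite -(esum_pred_image vG _ xpredT) ?[fun=> _]set_true//.
  by rewrite image_eq.
rewrite (_ : esum _ _ =
    \sum_(i <oo) \sum_(j <oo) (box_volume (G i j))%:E); last first.
  pose J : nat -> set (nat * nat) := fun i => [set (i, j) | j in setT].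
  rewrite (_ : setT = \bigcup_k J k); last first.
    by rewrite predeqE => -[a b]; split => // _; exists a => //; exists b.
  rewrite esum_bigcupT /=; last 2 first.
    - apply/trivIsetP => i j _ _ ij.
      rewrite predeqE => -[k m] /=; split => //= -[] [_] _ [<-{k} _].
      by move=> [m' _] [] /esym/eqP; rewrite (negbTE ij).
    - by move=> /= [k m]; exact: vG_ge0.
  rewrite -(image_id [set: nat]) -fun_true esum_pred_image//; last first.
    by move=> k _; exact: esum_ge0.
  apply: eq_eseriesr => /= j _.
  rewrite -(esum_pred_image vG (pair j) predT)//=; last first.
    by move=> ? ? _ _; exact: (@can_inj _ _ _ snd).
  by congr esum; rewrite predeqE => -[a b]; split; move=> [i _ <-]; exists i.
apply: lee_lim.
- by apply: is_cvg_nneseries => k *; apply: nneseries_ge0.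
- apply: is_cvg_nneseries => k *; apply: adde_ge0 => //.
  exact: lebesgue_outer_ge0.
- by near=> k; apply: lee_sum => i _; exact: (PG i).2.
Unshelve. all: by end_near. Qed.

End lebesgue_outer_lemmas.

HB.instance Definition _ (R : realType) (n : nat) :=
  isOuterMeasure.Build R 'rV[R]_n.+1 (@lebesgue_outer R n)
    (@lebesgue_outer0 R n) (@lebesgue_outer_ge0 R n) (@le_lebesgue_outer R n)
    (@lebesgue_outer_sigma_subadditive R n).

Definition lebesgue_outer_measure (R : realType) (n : nat)
  : {outer_measure set 'rV[R]_n.+1 -> \bar R} := @lebesgue_outer R n.

(* R^(n+1) with the sigma-algebra of Lebesgue measurable sets; it is convertible
   to 'rV[R]_n.+1, which carries the topology. *)
Notation lebesgue_space R n := (caratheodory_type (lebesgue_outer_measure R n)).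

Definition lebesgueRn (R : realType) (n : nat)
  : {measure set (lebesgue_space R n) -> \bar R} :=
  (lebesgue_outer_measure R n : set (lebesgue_space R n) -> \bar R).

(* partials [:: i_1; ...; i_k] f is D_(i_1) (... (D_(i_k) f)). *)
Definition partials (R : realType) (n : nat) (s : seq 'I_n.+1)
  (f : 'rV[R]_n.+1 -> R) : 'rV[R]_n.+1 -> R :=
  foldr (fun i g => 'D_(delta_mx 0 i) g) f s.

Definition smooth (R : realType) (n : nat) (f : 'rV[R]_n.+1 -> R) : Prop :=
  forall (s : seq 'I_n.+1) (x : 'rV[R]_n.+1), differentiable (partials s f) x.

Definition test_function (R : realType) (n : nat) (U : set 'rV[R]_n.+1)
  (phi : 'rV[R]_n.+1 -> R) : Prop :=
  [/\ smooth phi, compact (closure [set x | phi x != 0])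
    & closure [set x | phi x != 0] `<=` U].

Definition Lp_loc (R : realType) (n : nat) (p : \bar R)
  (U : set 'rV[R]_n.+1) (f : 'rV[R]_n.+1 -> R) : Prop :=
  forall K : set 'rV[R]_n.+1, compact K -> K `<=` U ->
    (f \_ K : lebesgue_space R n -> R) \in Lfun (lebesgueRn R n) p.

(* v is the weak derivative D_(i_1) ... D_(i_k) u in U, for s = [:: i_1; ...; i_k] *)
Definition weak_partials (R : realType) (n : nat) (U : set 'rV[R]_n.+1)
  (s : seq 'I_n.+1) (u v : 'rV[R]_n.+1 -> R) : Prop :=
  [/\ Lp_loc 1%E U u, Lp_loc 1%E U v &
    forall phi, test_function U phi ->
      \int[lebesgueRn R n]_(x in U) (u x * partials s phi x) =
      (-1) ^+ size s * \int[lebesgueRn R n]_(x in U) (v x * phi x)].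

(* W^{k,p}_loc(U) *)
Definition Wkp_loc (R : realType) (n : nat) (k : nat) (p : \bar R)
  (U : set 'rV[R]_n.+1) (u : 'rV[R]_n.+1 -> R) : Prop :=
  forall s : seq 'I_n.+1, (size s <= k)%N ->
    exists2 v, weak_partials U s u v & Lp_loc p U v.

(* The values of w outside U are irrelevant. D i j is a representative of the
   weak derivative D_ij w, which is unique up to a null set. *)
Definition strong_solution (R : realType) (n : nat) (p : \bar R)
  (U : set 'rV[R]_n.+1) (a : 'rV[R]_n.+1 -> 'M[R]_n.+1)
  (w f : 'rV[R]_n.+1 -> R) : Prop :=
  [/\ {within U, continuous w}, Wkp_loc 2 p U w &
    exists2 D : 'I_n.+1 -> 'I_n.+1 -> 'rV[R]_n.+1 -> R,
      (forall i j, weak_partials U [:: i; j] w (D i j)) &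
      {ae lebesgueRn R n, forall x, U x ->
        \sum_i \sum_j a x i j * D i j x = f x}].

(* l I <= A <= L I as quadratic forms *)
Definition mx_between (R : realType) (n : nat) (l L : R) (A : 'M[R]_n) : Prop :=
  forall xi : 'rV[R]_n,
    l * enorm xi ^+ 2 <= \sum_i \sum_j A i j * xi 0 i * xi 0 j
      <= L * enorm xi ^+ 2.

(* Main.v *)
Require Import Defs.
From mathcomp Require Import all_boot all_order all_algebra.
From mathcomp Require Import all_classical all_reals all_analysis.
From mathcomp Require Import measurable_realfun ess_sup_inf.
From mathcomp Require Import ring lra.
Import Order.TTheory GRing.Theory Num.Theory.
Import numFieldNormedType.Exports.

(** Write [d] for the dimension. Let [x1] be a point of [Omega] close to [x0] and
    let [v x = w x - kap * |x - x1|^2] with [kap = 1 / (2 * d * Lambda)]. As the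
    trace of [a] is at most [d * Lambda], the equation gives
    [a^ij D_ij w = 1 >= 2 * kap * tr a] in [Omega], that is, [a^ij D_ij v >= 0].
    Since [v x1 = w x1 > 0], a maximum principle shows that [v] stays positive up
    to the boundary of a cube around [x1] of size comparable to [r]: at the part
    of the boundary of [Omega] inside the cube [v] is nonpositive. Hence
    [w >= kap * |x - x1|^2] somewhere on the boundary of the cube
    ([quadratic_growth]), and this is a multiple of [r ^+ 2].

    The maximum principle [max_principle], for strong subsolutions and merely
    measurable coefficients, is that of Aleksandrov, Bakelman and Pucci, and here
    is proved by discretising its classical proof. If the values of [v] on the
    boundary of a compact set [A] stayed below its maximum over [A], then every
    mollification of [v] at a fine scale, tilted by an arbitrary small slope [p],
    would attain its maximum over [A] in the interior ([contact_exists]).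
    There the Hessian of the mollification of [w] lies below [2 * kap * 1]
    ([contact_test]). Space is divided into cells of the size of the mollification
    scale. The weak Hessian [D w] is close in [L^d] to functions that are constant
    on each cell ([grid_oscillation], from the density of Lipschitz functions).
    In a cell with a contact point, ellipticity and the equation bound the distance
    of the mollified Hessian from [2 * kap * 1] by the oscillation of [D w] in the
    cell ([cell_hessian_bound]). The gradient of the mollified [v] therefore hardly
    varies in the cell, and the slopes attained there fill a cube whose volume is
    at most a constant times the [d]-th power of the [L^d] norm of the oscillation
    ([cell_slope_volume]). The constant is independent of the scale. Summing over
    the cells, the slopes attained fill a volume that tends to 0 with the scale
    ([slope_volume]), although they include a fixed cube of small slopes.

    Lebesgue measure enters through its value on boxes ([mu_box]) and its
    invariance under translations ([integral_shift]): mollification is the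
    integral of [w] against a translated cutoff, and its derivatives fall on the
    cutoff. That weak derivatives are unique ([weak_partials_unique]), which is
    needed to know that [D w] is in [L^d], rests on the same comparison of a
    function with its averages on the cells of a grid ([weak_zero]). *)

Set Implicit Arguments.
Unset Strict Implicit.
Unset Printing Implicit Defensive.
Local Open Scope classical_set_scope.
Local Open Scope ring_scope.

(** * Open sets are Caratheodory measurable *)

Section box_measure.
Variables (R : realType) (n : nat).
Local Notation V := 'rV[R]_n.+1.
Local Notation T := (lebesgue_space R n).

Definition set_coord (v : V) (i : 'I_n.+1) (c : R) : V :=
  \row_j (if j == i then c else v 0 j).

Lemma box_volume_split (ab : V * V) i c :
  box_volume (ab.1, set_coord ab.2 i (Num.min (ab.2 0 i) c)) +
  box_volume (set_coord ab.1 i (Num.max (ab.1 0 i) c), ab.2) = box_volume ab.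
Proof.
rewrite /box_volume (bigD1 i) //= [X in _ + X](bigD1 i) //= [RHS](bigD1 i) //=.
rewrite !mxE eqxx.
rewrite (eq_bigr (fun j => Num.max 0 (ab.2 0 j - ab.1 0 j))); last first.
  by move=> j /negPf ji; rewrite mxE ji.
rewrite [X in _ + _ * X](eq_bigr (fun j => Num.max 0 (ab.2 0 j - ab.1 0 j))).
  rewrite -mulrDl; congr (_ * _).
  move: (ab.2 0 i) (ab.1 0 i) => b a.
  by case: (leP b c) => ?; case: (leP a c) => ?; repeat case: leP => ?; lra.
by move=> j /negPf ji; rewrite mxE ji.
Qed.

(** The half-space cuts every box of a covering into two boxes whose volumes
    add up to the volume of the whole box. *)
Lemma measurable_halfspace (i : 'I_n.+1) (c : R) :
  measurable ([set x : V | x 0 i <= c] : set T).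
Proof.
apply: le_caratheodory_measurable => X.
apply: le_ereal_inf_tmp => _ [F XF <-].
have -> : (\sum_(k <oo) (box_volume (F k))%:E =
  \sum_(k <oo) (box_volume ((F k).1, set_coord (F k).2 i
     (Num.min ((F k).2 0 i) c)))%:E +
  \sum_(k <oo) (box_volume (set_coord (F k).1 i
     (Num.max ((F k).1 0 i) c), (F k).2))%:E)%E.
  rewrite -nneseriesD; last 2 first.
  - by move=> *; rewrite lee_fin box_volume_ge0.
  - by move=> *; rewrite lee_fin box_volume_ge0.
  by apply: eq_eseriesr => k _; rewrite -EFinD box_volume_split.
apply: leeD; apply: ereal_inf_lbound => /=.
- exists (fun k => ((F k).1, set_coord (F k).2 i (Num.min ((F k).2 0 i) c))) => //.
  move=> x [/XF [k _ kx] /= xc]; exists k => //= j /=; rewrite mxE.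
  have := kx j; case: eqP => [->|//] /andP[-> h] /=.
  by rewrite le_min h xc.
- exists (fun k => (set_coord (F k).1 i (Num.max ((F k).1 0 i) c), (F k).2)) => //.
  move=> x [/XF [k _ kx] /= /negP xc]; exists k => //= j /=; rewrite mxE.
  have := kx j; case: eqP => [->|//] /andP[h ->] /=.
  by rewrite andbT gt_max h ltNge.
Qed.

Lemma measurable_box (ab : V * V) : measurable (box ab : set T).
Proof.
rewrite (_ : box ab = \big[setI/setT]_(i < n.+1)
   ([set x : V | ab.1 0 i < x 0 i] `&` [set x : V | x 0 i <= ab.2 0 i])).
  apply: (@bigsetI_measurable _ T) => i _; apply: measurableI; last exact: measurable_halfspace.
  rewrite (_ : [set x | _] = ~` [set x : V | x 0 i <= ab.1 0 i]).
    by apply: measurableC; exact: measurable_halfspace.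
  by apply/seteqP; split => x /=; rewrite ltNge => /negP.
rewrite -bigcap_seq; apply/seteqP; split => x /=.
  by move=> bx i _ /=; have /andP[] := bx i.
by move=> bx i; have /= [] := bx i (mem_index_enum _) => -> ->.
Qed.

Lemma norm_rV_leP (x : V) (c : R) : reflect (forall i, `|x 0 i| <= c) (`|x| <= c).
Proof.
apply: (iffP idP) => [xc i|xc].
  apply: le_trans xc; rewrite [leRHS]mx_normrE.
  exact: (le_bigmax _ (fun ij : 'I_1 * 'I_n.+1 => `|x ij.1 ij.2|) (0, i)).
rewrite [leLHS]mx_normrE; apply/bigmax_leP; split => [|[i j] _] /=.
  exact: le_trans (normr_ge0 _) (xc 0).
by rewrite ord1.
Qed.

Lemma coord_norm_le (z : V) i : `|z 0 i| <= `|z|.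
Proof. by have /norm_rV_leP := lexx `|z|. Qed.

Lemma norm_rV_ltP (x : V) (c : R) : reflect (forall i, `|x 0 i| < c) (`|x| < c).
Proof.
apply: (iffP idP) => [xc i|xc].
  apply: le_lt_trans xc; rewrite [leRHS]mx_normrE.
  exact: (le_bigmax _ (fun ij : 'I_1 * 'I_n.+1 => `|x ij.1 ij.2|) (0, i)).
rewrite [ltLHS]mx_normrE; apply/bigmax_ltP; split => [|[i j] _] /=.
  exact: le_lt_trans (normr_ge0 _) (xc 0).
by rewrite ord1.
Qed.

Lemma open_measurable_Rn (U : set V) : open U -> measurable (U : set T).
Proof.
move=> oU.
(* The boxes with a rational centre that lie in U form a countable cover. *)
pose c (qm : 'rV[rat]_n.+1 * nat) : V * V :=
  (\row_i (ratr (qm.1 0 i) - qm.2.+1%:R^-1), \row_i (ratr (qm.1 0 i) + qm.2.+1%:R^-1)).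
pose F (qm : 'rV[rat]_n.+1 * nat) : set T :=
  if `[< box (c qm) `<=` U >] then box (c qm) else set0.
rewrite (_ : (U : set T) = \bigcup_qm F qm).
  apply: countable_bigcupT_measurable => // qm; rewrite /F.
  by case: ifP => // _; exact: measurable_box.
apply/seteqP; split => [x Ux|x [qm _]]; last first.
  by rewrite /F; case: ifPn => // /asboolP h /h.
have /nbhs_ballP [e /= e0 xe] : nbhs x U by exact: open_nbhs_nbhs.
have [m me] : exists m : nat, m.+1%:R^-1 *+ 2 < e.
  exists (Num.truncn (2 / e)).
  rewrite -[X in X < _]mulr_natl ltr_pdivrMr ?ltr0n// -ltr_pdivrMl// mulrC.
  by rewrite truncnS_gt.
have qE i : exists q : rat, x 0 i - m.+1%:R^-1 < ratr q < x 0 i + m.+1%:R^-1.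
  have /rat_in_itvoo[q] : x 0 i - m.+1%:R^-1 < x 0 i + m.+1%:R^-1.
    by rewrite ltrD2l gtrN.
  by rewrite in_itv /= => h; exists q.
pose q i := projT1 (cid (qE i)).
have qP i : x 0 i - m.+1%:R^-1 < ratr (q i) < x 0 i + m.+1%:R^-1.
  by rewrite /q; case: cid.
exists (\row_i q i, m) => //.
rewrite /F; case: asboolP => [_|[]] /=.
  move=> i /=; rewrite !mxE; have := qP i.
  by move: (m.+1%:R^-1 : R) => z; case/andP => ? ?; apply/andP; split; lra.
move=> y /= yq; apply: xe; rewrite mx_norm_ball /ball_ /=.
apply/norm_rV_ltP => i; rewrite !mxE.
have := yq i; rewrite /= !mxE; have := qP i.
by move: me; rewrite mulr2n ltr_norml; move: (m.+1%:R^-1 : R) => z; lra.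
Qed.

Lemma closed_measurable_Rn (A : set V) : closed A -> measurable (A : set T).
Proof.
move=> cA; rewrite -[A]setCK; apply: measurableC.
by apply: open_measurable_Rn; exact: closed_openC.
Qed.

Lemma compact_measurable_Rn (A : set V) : compact A -> measurable (A : set T).
Proof.
by move=> cA; apply: closed_measurable_Rn; apply: compact_closed => //; exact: norm_hausdorff.
Qed.

Lemma continuous_measurable_Rn (f : V -> R) :
  continuous f -> measurable_fun setT (f : T -> R).
Proof.
move=> cf; apply: (measurability _ (measurable_realfun.RGenOInfty.measurableE R)) => //.
move=> _ [_ [c ->] <-]; rewrite setTI.
apply: open_measurable_Rn; apply: open_comp => [x _|]; first exact: cf.
by rewrite set_itvE; exact: open_gt.
Qed.

End box_measure.

(** * Volume of boxes *)

Section step_functions.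
Variable R : realType.

Lemma step_integral (I : Type) (s : seq I) (c a b : I -> R) :
  let f := fun x : R => \sum_(k <- s) c k * (a k < x <= b k)%R%:R in
  lebesgue_measure.-integrable setT (EFin \o f) /\
  \int[lebesgue_measure]_x f x = \sum_(k <- s) c k * Num.max 0 (b k - a k).
Proof.
elim: s => [|k s [intf intE]] /=.
  rewrite (_ : (fun x => _) = cst 0); last by apply/funext => x; rewrite big_nil.
  split; first exact: integrable0.
  by rewrite Rintegral_cst// mul0r big_nil.
set f := fun x : R => _ in intf intE.
pose g x : R := c k * \1_`]a k, b k] x.
have -> : (fun x => \sum_(k <- k :: s) c k * (a k < x <= b k)%R%:R) = g \+ f.
  by apply/funext => x; rewrite big_cons /f /g /= indicE mem_setE in_itv.
have ig : lebesgue_measure.-integrable setT (EFin \o g).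
  rewrite (_ : _ \o _ = fun x => (c k)%:E * (\1_`]a k, b k] x)%:E)%E//.
  by apply: integrableZl => //; exact: integrable_indic_itv.
split; first by rewrite (_ : _ \o _ = (EFin \o g) \+ (EFin \o f))%E//; exact: integrableD.
rewrite RintegralD// intE big_cons; congr (_ + _).
rewrite RintegralZl//; last exact: integrable_indic_itv.
congr (_ * _); rewrite /Rintegral integral_indic// setIT.
apply: (etrans (congr1 fine (lebesgue_measure_itv `]a k, b k]))).
rewrite /= lte_fin.
case: ltP => ab /=; first by rewrite max_r// subr_ge0 ltW.
by rewrite max_l// subr_le0.
Qed.

Lemma step_ge0 (I : Type) (s : seq I) (c a b : I -> R) :
  (forall x, 0 <= \sum_(k <- s) c k * (a k < x <= b k)%R%:R) ->
  0 <= \sum_(k <- s) c k * Num.max 0 (b k - a k).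
Proof.
by move=> f0; rewrite -(step_integral s c a b).2; apply: Rintegral_ge0 => x _.
Qed.

(** Volume is a positive functional on signed combinations of indicators of
    boxes. Integrating out one coordinate at a time leaves the Lebesgue integral
    on the line to be used. Subadditivity of the volume follows without
    subdividing any box. *)
Lemma box_sum_ge0_nat (I : Type) (s : seq I) d (c : I -> R) (a b : I -> nat -> R) :
  (forall x : nat -> R,
     0 <= \sum_(k <- s) c k * \prod_(i < d) (a k i < x i <= b k i)%R%:R) ->
  0 <= \sum_(k <- s) c k * \prod_(i < d) Num.max 0 (b k i - a k i).
Proof.
elim: d c => [|d IH] c f0.
  have := f0 (fun=> 0); congr (0 <= _).
  by apply: eq_bigr => k _; rewrite !big_ord0.
pose c' k := c k * Num.max 0 (b k d - a k d).
rewrite (eq_bigr (fun k => c' k * \prod_(i < d) Num.max 0 (b k i - a k i))).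
  apply: IH => x; pose c'' k := c k * \prod_(i < d) (a k i < x i <= b k i)%R%:R.
  rewrite (eq_bigr (fun k => c'' k * Num.max 0 (b k d - a k d))).
    apply: step_ge0 => t; have := f0 (fun i => if i == d then t else x i).
    congr (0 <= _); apply: eq_bigr => k _; rewrite big_ord_recr /= eqxx mulrA.
    congr (_ * _ * _); apply: eq_bigr => i _.
    by rewrite (ltn_eqF (ltn_ord i)).
  by move=> k _; rewrite /c' /c'' mulrAC.
by move=> k _; rewrite big_ord_recr /= /c' mulrA mulrAC.
Qed.

End step_functions.

Section box_volume.
Variables (R : realType) (n : nat).
Local Notation V := 'rV[R]_n.+1.
Local Notation mu := (lebesgueRn R n).

Lemma box_sum_ge0 (I : Type) (s : seq I) (c : I -> R) (F : I -> V * V) :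
  (forall x, 0 <= \sum_(k <- s) c k * (`[< box (F k) x >])%:R) ->
  0 <= \sum_(k <- s) c k * box_volume (F k).
Proof.
move=> f0.
pose a k i := (F k).1 0 (inord i); pose b k i := (F k).2 0 (inord i).
rewrite (eq_bigr (fun k => c k * \prod_(i < n.+1) Num.max 0 (b k i - a k i))).
  apply: box_sum_ge0_nat => x; have := f0 (\row_i x i); congr (0 <= _).
  apply: eq_bigr => k _; congr (_ * _).
  case: asboolP => [bx|nbx].
    rewrite big1// => i _; have := bx i.
    by rewrite /= mxE /a /b inord_val => ->.
  have [i /negP bi] : exists i, ~ ((F k).1 0 i < (\row_i x i) 0 i <= (F k).2 0 i).
    by apply: contrapT => /forallNP h; apply: nbx => i; apply: contrapT => /h.
  rewrite (bigD1 i)//=; move: bi; rewrite mxE /a /b inord_val => /negPf ->.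
  by rewrite mul0r.
by move=> k _; congr (_ * _); apply: eq_bigr => i _; rewrite /a /b inord_val.
Qed.

Lemma box_volume_le_sum (ab : V * V) (F : nat -> V * V) m :
  box ab `<=` \bigcup_(k < m) box (F k) ->
  box_volume ab <= \sum_(k < m) box_volume (F k).
Proof.
move=> sub.
pose s : seq (R * (V * V)) := (- 1, ab) :: [seq (1, F k) | k <- index_iota 0 m].
have := @box_sum_ge0 _ s fst snd; rewrite !big_cons /= big_map.
under eq_bigr do rewrite mul1r.
rewrite big_mkord mulN1r addrC subr_ge0; apply => x.
rewrite !big_cons /= big_map mulN1r addrC subr_ge0.
under eq_bigr do rewrite mul1r.
case: asboolP => [/sub[k /= km kx]|_]; last by apply: sumr_ge0.
rewrite big_mkord (bigD1 (Ordinal km))//=; case: asboolP => // _.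
by rewrite lerDl; apply: sumr_ge0.
Qed.

Lemma box_volume0 : box_volume (0 : V, 0 : V) = 0.
Proof. by rewrite /box_volume big_ord_recl /= subrr maxxx mul0r. Qed.

Lemma mu_box_le (ab : V * V) : (mu (box ab) <= (box_volume ab)%:E)%E.
Proof.
apply: ereal_inf_lbound => /=.
exists (fun k => if k == 0%N then ab else (0, 0)); first by move=> x bx; exists 0%N.
rewrite (nneseries_split 0 1); last by move=> k _; rewrite lee_fin box_volume_ge0.
rewrite big_nat1 /= eseries0 ?adde0// => k; rewrite add0n => k1 _.
by rewrite gtn_eqF// box_volume0.
Qed.

Lemma box_volume_cont (a b : V) (al be : R) :
  continuous (fun d : R => box_volume (a + const_mx (al * d), b + const_mx (be * d))).
Proof.
rewrite /box_volume /=.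
apply: continuous_big => [|i _ d]; first exact: mul_continuous.
under eq_fun do rewrite !mxE.
have c1 (u v : R) : {for d, continuous (fun t : R => u + v * t)}.
  by apply: cvgD; [exact: cvg_cst|apply: cvgMr; exact: cvg_id].
have := @continuous_max R R (fun=> 0) (fun t => b 0 i + be * t - (a 0 i + al * t)) d.
by apply; [exact: cvg_cst|apply: cvgB; exact: c1].
Qed.

Lemma box_volume_approx (a b : V) (al be e : R) : 0 < e ->
  exists2 d : R, 0 < d &
    `|box_volume (a + const_mx (al * d), b + const_mx (be * d)) - box_volume (a, b)| < e.
Proof.
move=> e0; have := @box_volume_cont a b al be 0; rewrite /continuous_at /=.
rewrite !mulr0 (_ : const_mx 0 = 0 :> V) ?addr0; last by apply/matrixP => ? ?; rewrite !mxE.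
move=> /cvgrPdist_lt/(_ _ e0)/nbhs_ballP[d /= d0 h].
exists (d / 2); first by rewrite divr_gt0.
rewrite distrC; apply: h; rewrite /ball /= sub0r normrN gtr0_norm ?divr_gt0//.
by rewrite ltr_pdivrMr// ltr_pMr// ltr1n.
Qed.

Lemma closed_box_compact (a b : V) :
  compact [set x : V | forall i, a 0 i <= x 0 i <= b 0 i].
Proof.
have := @rV_compact R n.+1 (fun i => `[a 0 i, b 0 i]%classic).
rewrite /= (_ : [set _ | _] = [set x : V | forall i, a 0 i <= x 0 i <= b 0 i]).
  by apply => i; exact: segment_compact.
by apply/seteqP; split => x /= h i; have := h i; rewrite in_itv.
Qed.

Lemma open_box_open (a b : V) : open [set x : V | forall i, a 0 i < x 0 i < b 0 i].
Proof.
rewrite openE => x /= abx.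
apply: (@filter_forall V _ (fun i (y : V) => a 0 i < y 0 i < b 0 i) (nbhs x) _) => i.
apply: open_nbhs_nbhs; split; last exact: abx.
have : open ((fun x : V => x 0 i) @^-1` `]a 0 i, b 0 i[%classic).
  by apply: open_comp; [move=> y _; exact: coord_continuous|exact: itv_open].
by congr (open _); apply/seteqP; split => y /=; rewrite in_itv.
Qed.

(** Compactness turns a countable cover of the half-open box into a finite one,
    once the box has been shrunk and the covering boxes enlarged a little. *)
Lemma mu_box (ab : V * V) : mu (box ab) = (box_volume ab)%:E.
Proof.
apply/eqP; rewrite eq_le mu_box_le /=.
apply: le_ereal_inf_tmp => _ [F abF <-].
apply/lee_addgt0Pr => e e0.
have e20 : 0 < e / 2 by rewrite divr_gt0.
have [d d0 vd] := box_volume_approx ab.1 ab.2 1 0 e20.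
pose a' : V := ab.1 + const_mx (1 * d).
pose b' : V := ab.2 + const_mx (0 * d).
have aE i : a' 0 i = ab.1 0 i + d by rewrite !mxE mul1r.
have bE i : b' 0 i = ab.2 0 i by rewrite !mxE mul0r addr0.
have ek0 k : 0 < e / 2 / (2 ^ k.+1)%:R by rewrite divr_gt0// ltr0n expn_gt0.
pose G k : R := s2val (cid2 (box_volume_approx (F k).1 (F k).2 0 1 (ek0 k))).
have G0 k : 0 < G k by rewrite /G; case: cid2.
pose H k : V * V := ((F k).1 + const_mx (0 * G k), (F k).2 + const_mx (1 * G k)).
have HF k : box_volume (H k) <= box_volume (F k) + e / 2 / (2 ^ k.+1)%:R.
  rewrite -lerBlDl (le_trans (ler_norm _))// /H /G [in box_volume (F k)](surjective_pairing (F k)).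
  by case: cid2 => /= *; exact: ltW.
have := @closed_box_compact a' b'.
rewrite compact_cover => /(_ nat setT
  (fun k => [set x | forall i, (H k).1 0 i < x 0 i < (H k).2 0 i])).
case => [k _|x /= xab|D' _ D'P]; first exact: open_box_open.
  have /abF[k _ kx] : box ab x.
    by move=> i; have := xab i; rewrite aE bE; move: d0; lra.
  exists k => // i /=; have := kx i; rewrite !mxE mul0r mul1r; have := G0 k; lra.
pose m := (\max_(k <- finmap.enum_fset D') k.+1)%N.
have sub : box (a', b') `<=` \bigcup_(k < m) box (H k).
  move=> x xab; have [|k /= kD kx] := D'P x.
    by move=> i; have /= := xab i => /andP[/ltW -> ->].
  exists k; last by move=> i; have := kx i; case/andP => -> /ltW ->.
  by rewrite /= /m (@leq_bigmax_seq _ _ _ (fun k => k.+1) k).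
have h : box_volume (a', b') <=
    \sum_(k < m) (box_volume (F k) + e / 2 / (2 ^ k.+1)%:R).
  by apply: le_trans (box_volume_le_sum sub) _; apply: ler_sum => k _; exact: HF.
have vab : box_volume ab <= box_volume (a', b') + e / 2.
  rewrite -lerBlDl (le_trans (ler_norm _))// distrC ltW//.
have {h vab} h := le_trans vab (lerD h (lexx (e / 2))).
apply: (@le_trans _ _ (\sum_(0 <= k < m) ((box_volume (F k))%:E + (e / 2 / (2 ^ k.+1)%:R)%:E) + (e / 2)%:E)%E).
  rewrite big_mkord (eq_bigr (fun k : 'I_m => (box_volume (F k) + e / 2 / (2 ^ k.+1)%:R)%:E)).
    by rewrite sumEFin -EFinD lee_fin.
  by move=> k _; rewrite EFinD.
rewrite [e in leRHS]splitr EFinD addeA leeD2r//.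
apply: le_trans (epsilon_trick _ _ _) => //=; last 2 first.
- by move=> k; rewrite lee_fin box_volume_ge0.
- exact: ltW.
apply: nneseries_lim_ge => k _ _; rewrite -EFinD lee_fin addr_ge0//.
  exact: box_volume_ge0.
exact/ltW/ek0.
Qed.

End box_volume.

(** * Translations and compact sets *)

Section translation.
Variables (R : realType) (n : nat).
Local Notation V := 'rV[R]_n.+1.
Local Notation T := (lebesgue_space R n).
Local Notation mu := (lebesgueRn R n).

(** A translated covering has the same total volume. *)
Lemma lebesgue_outer_shift_le (v : V) (A : set V) :
  (lebesgue_outer ((fun y => (y - v)%R) @^-1` A) <= lebesgue_outer A)%E.
Proof.
apply: le_ereal_inf_tmp => _ [F AF <-].
apply: ereal_inf_lbound => /=.
exists (fun k => ((F k).1 + v, (F k).2 + v)).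
  move=> y /= /AF[k _ ky]; exists k => // i /=.
  by have := ky i; rewrite !mxE -ltrBrDr -lerBlDr.
apply: eq_eseriesr => k _; congr EFin; apply: eq_bigr => i _ /=.
by rewrite !mxE; congr Num.max; ring.
Qed.

Lemma lebesgue_outer_shift (v : V) (A : set V) :
  lebesgue_outer ((fun y => y - v) @^-1` A) = lebesgue_outer A.
Proof.
apply/eqP; rewrite eq_le lebesgue_outer_shift_le /=.
apply: le_trans (lebesgue_outer_shift_le (- v) ((fun y => y - v) @^-1` A)).
by apply: le_lebesgue_outer => x /= Ax; rewrite opprK addrK.
Qed.

Lemma measurable_shift (v : V) : measurable_fun setT ((fun y => y - v) : T -> T).
Proof.
move=> _ A mA; rewrite setTI.
suff : (lebesgue_outer_measure R n).-caratheodory ((fun y : V => y - v) @^-1` A) by [].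
have cA : (lebesgue_outer_measure R n).-caratheodory (A : set V) := mA.
move=> X /=.
have h (Y : set V) : lebesgue_outer Y = lebesgue_outer ((fun y => y + v) @^-1` Y).
  rewrite -[LHS](lebesgue_outer_shift (- v)); congr lebesgue_outer.
  by apply/seteqP; split => y /=; rewrite opprK.
rewrite h [X in (_ = X + _)%E]h [X in (_ = _ + X)%E]h.
have := cA ((fun y => y + v) @^-1` X) => /= ->.
by congr (_ + _)%E; apply: (congr1 (@lebesgue_outer R n));
  apply/seteqP; split => y /=; rewrite addrK.
Qed.

Lemma integral_shift (v : V) (f : T -> \bar R) :
  measurable_fun [set: T] f -> (forall y, 0 <= f y)%E ->
  (\int[mu]_y f (((y : V) - v)%R : T) = \int[mu]_y f y)%E.
Proof.
move=> mf f0.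
have pE : pushforward mu (fun y : T => (y - v : V)%R : T) = mu :> (set T -> \bar R).
  by apply/funext => A; exact: lebesgue_outer_shift.
have := @ge0_integral_pushforward _ _ T T R _ (measurable_shift v) mu setT f measurableT mf.
by rewrite preimage_setT pE => <-.
Qed.

Lemma mu_cube (c : V) (r : R) : 0 <= r ->
  mu (box (c - const_mx r, c + const_mx r)) = ((2 * r) ^+ n.+1)%:E.
Proof.
move=> r0; rewrite mu_box; congr EFin; rewrite /box_volume.
rewrite (eq_bigr (fun=> 2 * r)) ?prodr_const ?card_ord// => i _.
by rewrite !mxE max_r; lra.
Qed.

Lemma sub_cube (c : V) (r : R) (x : V) : `|x - c| < r ->
  box (c - const_mx r, c + const_mx r) x.
Proof.
by move=> /norm_rV_ltP h i; have := h i; rewrite !mxE ltr_norml; lra.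
Qed.

Lemma mu_bounded_lty (A : set V) (M : R) : (forall x, A x -> `|x| < M) ->
  (mu A < +oo)%E.
Proof.
move=> AM; apply: (@le_lt_trans _ _ (mu (box (0 - const_mx `|M|, 0 + const_mx `|M|)))).
  apply: le_lebesgue_outer => x Ax; apply: sub_cube.
  by rewrite subr0 (lt_le_trans (AM _ Ax))// ler_norm.
by rewrite mu_cube// ltry.
Qed.

Lemma compact_norm_lt (A : set V) : compact A ->
  exists2 M : R, 0 < M & forall x, A x -> `|x| < M.
Proof.
move=> /compact_bounded[M [_ h]]; exists (`|M| + 2); first by rewrite ltr_wpDl.
move=> x Ax; apply: (@le_lt_trans _ _ (`|M| + 1)); last by rewrite ltrD2l ltr1n.
by apply: (h (`|M| + 1)) => //; rewrite ltr_pwDr// ler_norm.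
Qed.

Lemma mu_compact_lty (A : set V) : compact A -> (mu A < +oo)%E.
Proof. by move=> /compact_norm_lt[M _ /mu_bounded_lty]. Qed.

(** A compact subset of an open set keeps a positive distance to its
    complement, and its neighbourhood of that width is still compact. *)
Lemma compact_thickening (A U : set V) : compact A -> open U -> A `<=` U ->
  exists (h : R) (K : set V), [/\ 0 < h, compact K, K `<=` U &
    forall x y, A x -> `|y - x| <= h -> K y].
Proof.
move=> cA oU AU.
have : \forall h \near (0 : R)^'+, A `<=` [set x | forall y, `|y - x| <= h -> U y].
  apply: ((compact_near_coveringP A).1 cA R (0 : R)^'+
    (fun h x => forall y, `|y - x| <= h -> U y)) => x Ax.
  have /nbhs_ballP[e /= e0 xe] : nbhs x U by apply: open_nbhs_nbhs; split => //; exact: AU.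
  have e20 : 0 < e / 2 by rewrite divr_gt0.
  exists (ball x (e / 2), [set h : R | h < e / 2]) => /=.
    split; first exact: nbhsx_ballx.
    by near=> h; near: h; exact: nbhs_right_lt.
  move=> [x' h] /= []; rewrite mx_norm_ball /ball_ /= => xx' he y yx'.
  apply: xe; rewrite mx_norm_ball /ball_ /= [e]splitr.
  rewrite -(subrKA x') (le_lt_trans (ler_normD _ _))// ltrD//.
  by rewrite distrC (le_lt_trans yx').
move=> h_near.
have [h [h0 hAU]] : exists h : R, 0 < h /\ forall x y, A x -> `|y - x| <= h -> U y.
  near (0 : R)^'+ => h; exists h; split => // x y Ax.
  by have /(_ x Ax y) : A `<=` [set x | forall y, `|y - x| <= h -> U y] by near: h.
exists h, [set x.1 + x.2 | x in A `*` [set z : V | forall i, (const_mx (- h) : V) 0 i <= z 0 i <= (const_mx h : V) 0 i]].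
split => //.
- apply: continuous_compact.
    by apply: continuous_subspaceT => x; exact: add_continuous.
  by apply: compact_setX => //; exact: closed_box_compact.
- move=> _ [[x z] [/= Ax zh] <-]; apply: (hAU x) => //; rewrite addrC addKr.
  by apply/norm_rV_leP => i; have := zh i; rewrite !mxE ler_norml.
- move=> x y Ax xy; exists (x, y - x) => /=; last by rewrite addrC subrK.
  by split => //= i; move/norm_rV_leP : xy => /(_ i); rewrite !mxE ler_norml.
Unshelve. all: by end_near. Qed.

Lemma compact_uniform_continuous (A : set V) (w : V -> R) (e : R) : compact A ->
  (forall x, A x -> {for x, continuous w}) -> 0 < e ->
  exists2 h : R, 0 < h & forall x y, A x -> `|y - x| <= h -> `|w y - w x| <= e.
Proof.
move=> cA wc e0.
have : \forall h \near (0 : R)^'+, A `<=` [set x | forall y, `|y - x| <= h -> `|w y - w x| <= e].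
  apply: ((compact_near_coveringP A).1 cA R (0 : R)^'+
    (fun h x => forall y, `|y - x| <= h -> `|w y - w x| <= e)) => x Ax.
  have e20 : 0 < e / 2 by rewrite divr_gt0.
  have /(wc _ Ax)/nbhs_ballP[d /= d0 xd] := nbhsx_ballx (w x) _ e20.
  have d20 : 0 < d / 2 by rewrite divr_gt0.
  exists (ball x (d / 2), [set h : R | h < d / 2]) => /=.
    split; first exact: nbhsx_ballx.
    by near=> h; near: h; exact: nbhs_right_lt.
  move=> [x' h] /= []; rewrite mx_norm_ball /ball_ /= => xx' hd y yx'.
  have h1 : `|w x - w x'| < e / 2.
    apply: xd; rewrite mx_norm_ball /ball_ /= (lt_trans xx')//.
    by rewrite ltr_pdivrMr// ltr_pMr// ltr1n.
  have h2 : `|w x - w y| < e / 2.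
    apply: xd; rewrite mx_norm_ball /ball_ /= [d]splitr.
    rewrite -(subrKA x') (le_lt_trans (ler_normD _ _))// ltrD//.
    by rewrite distrC (le_lt_trans yx').
  rewrite -(subrKA (w x)) (le_trans (ler_normD _ _))// [e]splitr lerD//; last exact: ltW.
  by rewrite distrC ltW.
move=> h_near.
near (0 : R)^'+ => h; exists h => // x y Ax.
by have /(_ x Ax y) : A `<=` [set x | forall y, `|y - x| <= h -> `|w y - w x| <= e] by near: h.
Unshelve. all: by end_near. Qed.

End translation.

(** * Positive semidefinite forms *)

Section quadratic_forms.
Variables (R : realType) (n : nat).
Implicit Types (A B E : 'I_n -> 'I_n -> R) (x y : 'I_n -> R).

Definition qform A x : R := \sum_i \sum_j A i j * x i * x j.

Lemma sum_delta (f : 'I_n -> R) k : \sum_i f i * (i == k)%:R = f k.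
Proof.
rewrite (bigD1 k)//= eqxx mulr1 big1 ?addr0// => i /negPf ->.
by rewrite mulr0.
Qed.

Lemma qform_shift A x k t : (forall i j, A i j = A j i) ->
  qform A (fun i => x i + t * (i == k)%:R) =
  qform A x + 2 * t * (\sum_j A k j * x j) + t ^+ 2 * A k k.
Proof.
move=> sA; rewrite /qform.
rewrite (eq_bigr (fun i => \sum_j A i j * x i * x j +
   t * (A k i * x i) + (t * (\sum_j A i j * x j) + t ^+ 2 * A i k) * (i == k)%:R)).
  rewrite 2!big_split /= sum_delta -mulr_sumr; ring.
move=> i _.
rewrite (eq_bigr (fun j => (A i j * x i * x j + t * (i == k)%:R * (A i j * x j)) +
    (A i j * t * (x i + t * (i == k)%:R)) * (j == k)%:R)); last by move=> j _; ring.
by rewrite 2!big_split /= sum_delta -mulr_sumr (sA k i); ring.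
Qed.

Lemma qform_delta A k : qform A (fun i => (i == k)%:R) = A k k.
Proof.
rewrite /qform (eq_bigr (fun i => A i k * (i == k)%:R)); first exact: sum_delta.
by move=> i _; rewrite -[RHS](sum_delta (fun j => A i j * (i == k)%:R) k).
Qed.

Lemma psd_diag A : (forall x, 0 <= qform A x) -> forall k, 0 <= A k k.
Proof. by move=> pA k; rewrite -qform_delta. Qed.

Lemma psd_offdiag A : (forall i j, A i j = A j i) -> (forall x, 0 <= qform A x) ->
  forall i j t, 0 <= A j j + 2 * t * A i j + t ^+ 2 * A i i.
Proof.
move=> sA pA i j t; have := pA (fun k => (k == j)%:R + t * (k == i)%:R).
by rewrite qform_shift// qform_delta sum_delta.
Qed.

Lemma psd_zero_row A k : (forall i j, A i j = A j i) -> (forall x, 0 <= qform A x) ->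
  A k k = 0 -> forall j, A k j = 0.
Proof.
move=> sA pA Akk j; apply/eqP/negP => /negP Akj.
have := psd_offdiag sA pA k j (- (A j j + 1) / (2 * A k j)).
rewrite Akk mulr0 addr0 (_ : 2 * _ * _ = - (A j j + 1)); last by field.
lra.
Qed.

(** Completing the square in one variable after the other writes [A] as a sum
    of squares of linear forms, and [B] is nonnegative on each of them. *)
Lemma psd_pairing A B : (forall i j, A i j = A j i) ->
  (forall x, 0 <= qform A x) -> (forall x, 0 <= qform B x) ->
  0 <= \sum_i \sum_j A i j * B i j.
Proof.
move=> sA pA pB.
suff H m : forall A, (forall i j, A i j = A j i) -> (forall x, 0 <= qform A x) ->
    (forall i j : 'I_n, (i + m < n)%N -> A i j = 0) ->
    0 <= \sum_i \sum_j A i j * B i j.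
  by apply: (H n) => // i j; rewrite ltnNge leq_addl.
elim: m {A sA pA} => [|m IH] A sA pA A0.
  rewrite big1// => i _; rewrite big1// => j _.
  by rewrite A0 ?mul0r// addn0.
have [mn|nm] := ltnP m n; last first.
  by apply: IH => // i j; rewrite ltnNge (leq_trans nm)// leq_addl.
have kn : (n - m.+1 < n)%N by rewrite ltn_subrL (leq_ltn_trans _ mn).
pose k := Ordinal kn.
have k_or (i : 'I_n) : (i + m < n)%N -> i = k \/ (i + m.+1 < n)%N.
  rewrite leq_eqVlt => /orP[/eqP im|]; last by rewrite addnS; right.
  by left; apply/val_inj => /=; apply/eqP; rewrite -(eqn_add2r m.+1) subnK// addnS im.
have [Akk|Akk] := eqVneq (A k k) 0.
  apply: IH => // i j /k_or[->|]; first exact: psd_zero_row.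
  exact: A0.
have Akk0 : 0 < A k k by rewrite lt_def Akk psd_diag.
pose A' i j := A i j - A i k * A k j / A k k.
have qA' x : qform A' x = qform A x - (\sum_j A k j * x j) ^+ 2 / A k k.
  set s := \sum_j _; rewrite expr2 -mulrA [in X in _ - X]/s mulr_suml -sumrB.
  apply: eq_bigr => i _; rewrite {}/s mulr_suml mulr_sumr -sumrB.
  by apply: eq_bigr => j _; rewrite /A' (sA k i); ring.
have -> : \sum_i \sum_j A i j * B i j =
    \sum_i \sum_j A' i j * B i j + qform B (A k) / A k k.
  rewrite mulr_suml -big_split; apply: eq_bigr => i _ /=.
  rewrite mulr_suml -big_split; apply: eq_bigr => j _ /=.
  by rewrite /A' (sA k i); ring.
apply: addr_ge0; last by rewrite divr_ge0// ltW.
apply: IH => [i j|x|i j].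
- by rewrite /A' (sA i j) (sA i k) (sA k j); ring.
- rewrite qA'; set s := \sum_j _.
  have := pA (fun i => x i + (- s / A k k) * (i == k)%:R).
  rewrite qform_shift// -/s; congr (0 <= _); field.
  exact: Akk.
- move=> /k_or[->|im]; first by rewrite /A' mulrAC divff// mul1r subrr.
  by rewrite /A' !(A0 i)// !mul0r subrr.
Qed.

Lemma psd_le_trace E : (forall i j, E i j = E j i) -> (forall x, 0 <= qform E x) ->
  forall i j, `|E i j| <= \sum_k E k k.
Proof.
move=> sE pE.
have trE i : E i i <= \sum_k E k k.
  by rewrite (bigD1 i)//= lerDl sumr_ge0// => k _; exact: psd_diag.
move=> i j; have := psd_offdiag sE pE i j 1; have := psd_offdiag sE pE i j (-1).
have := trE i; have := trE j; rewrite ler_norml; set t := \sum_k _; lra.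
Qed.

Lemma qform_sub_scalar A (l : R) x :
  qform (fun i j => A i j - l * (i == j)%:R) x = qform A x - l * \sum_i x i ^+ 2.
Proof.
rewrite mulr_sumr -sumrB; apply: eq_bigr => i _.
have -> : l * x i ^+ 2 = \sum_j l * x i * x j * (j == i)%:R.
  by rewrite sum_delta; ring.
rewrite -sumrB.
by apply: eq_bigr => j _; rewrite [j == i]eq_sym; ring.
Qed.

(** [A - l * 1] and [- E] are positive semidefinite, so their pairing is
    nonnegative. This controls the trace of [- E], which bounds every entry. *)
Lemma contact_bound A E (l : R) : (forall i j, A i j = A j i) ->
  (forall i j, E i j = E j i) ->
  (forall x, l * \sum_i x i ^+ 2 <= qform A x) -> (forall x, qform E x <= 0) ->
  0 <= l -> forall i j, l * `|E i j| <= - \sum_i \sum_j A i j * E i j.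
Proof.
move=> sA sE lA nE l0 i j.
have qN x : qform (fun i j => - E i j) x = - qform E x.
  rewrite /qform -sumrN; apply: eq_bigr => a _; rewrite -sumrN.
  by apply: eq_bigr => b _; ring.
have pE x : 0 <= qform (fun i j => - E i j) x by rewrite qN oppr_ge0.
have := @psd_pairing (fun i j => A i j - l * (i == j)%:R) (fun i j => - E i j).
have -> : \sum_i \sum_j (A i j - l * (i == j)%:R) * - E i j =
    - \sum_i \sum_j A i j * E i j - l * \sum_k - E k k.
  rewrite mulr_sumr -sumrN -sumrB; apply: eq_bigr => a _.
  have -> : l * - E a a = \sum_b l * - E a b * (b == a)%:R by rewrite sum_delta.
  rewrite -sumrN -sumrB.
  by apply: eq_bigr => b _; rewrite [b == a]eq_sym; ring.
move=> /(_ _ _ pE) h; have {h} : l * \sum_k - E k k <= - \sum_i \sum_j A i j * E i j.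
  rewrite -subr_ge0; apply: h => [a b|x]; first by rewrite sA [b == a]eq_sym.
  by rewrite qform_sub_scalar subr_ge0.
apply: le_trans; apply: ler_wpM2l => //; rewrite -normrN.
by apply: (@psd_le_trace (fun a b => - E a b)) => // a b; rewrite sE.
Qed.

End quadratic_forms.

(** * A class of smooth functions *)

Section flat_functions.
Variable R : realType.
Implicit Types (P : {poly R}) (t : R).

(** The derivatives of [exp (- 1 / t)], continued by 0 to negative [t], all have
    the form [P (1 / t) * exp (- 1 / t)]. *)
Definition flat P t : R := if 0 < t then P.[t^-1] * expR (- t^-1) else 0.

Lemma powX_expRN_le k (s : R) : 0 <= s -> s ^+ k * expR (- s) <= k`!%:R.
Proof.
move=> s0; case: k => [|k].
  by rewrite expr0 mul1r expRN invf_le1 ?expR_gt0// -expR0 ler_expR.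
have := expR_ge1Dxn k s0; rewrite expRN ler_pdivrMr ?expR_gt0// => h.
have f0 : (0 : R) < (k.+1)`!%:R by rewrite ltr0n fact_gt0.
rewrite -ler_pdivrMl// mulrC; apply: le_trans h.
by rewrite lerDr.
Qed.

Lemma flat_bounded P : exists C, forall t, `|flat P t| <= C.
Proof.
(* s ^ i * exp (- s) is at most i! because exp s exceeds s ^ i / i!. *)
exists (\sum_(i < size P) `|P`_i| * i`!%:R) => t; rewrite /flat.
case: ifPn => [t0|_]; last first.
  by rewrite normr0 sumr_ge0// => i _; rewrite mulr_ge0.
rewrite horner_coef mulr_suml (le_trans (ler_norm_sum _ _ _))// ler_sum// => i _.
have ti0 : 0 <= t^-1 by rewrite invr_ge0 ltW.
rewrite -mulrA normrM ler_wpM2l// ger0_norm; last first.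
  by rewrite mulr_ge0 ?expR_ge0// exprn_ge0.
exact: powX_expRN_le.
Qed.

Definition dflat P : {poly R} := 'X^2 * (P - P^`()).

Lemma is_derive_flat P t : is_derive t 1 (flat P) (flat (dflat P) t).
Proof.
have [t0|t0|<-] := ltgtP 0 t.
- pose g := fun t : R => P.[t^-1] * expR (- t^-1).
  apply: (@near_eq_is_derive _ _ _ g).
    near=> s; rewrite /flat ifT//; near: s.
    by apply: open_nbhs_nbhs; split => //; exact: open_gt.
  have tn0 : t != 0 by rewrite gt_eqF.
  have iV : is_derive t 1 (fun t : R => t^-1) (- t ^-2).
    split; first exact: derivableV.
    by rewrite deriveV// derive_id /GRing.scale /= mulr1.
  have i1 := is_derive1_comp (is_derive_poly P t^-1) iV.
  have i2 := @is_derive1_comp R expR (- (fun t : R => t^-1)) t _ _ (is_derive_expR (- t^-1)) (is_deriveN iV).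
  apply: (is_derive_eq (is_deriveM i1 i2)).
  rewrite /flat t0 /dflat !hornerE /= /GRing.scale /=; field.
  by rewrite tn0.
- apply: (@near_eq_is_derive _ _ _ (cst 0)).
    near=> s; rewrite /flat ifF//; apply/negbTE; rewrite -leNgt ltW//; near: s.
    by apply: open_nbhs_nbhs; split => //; exact: open_lt.
  by rewrite /flat ifF; [exact: is_derive_cst|apply/negbTE; rewrite -leNgt ltW].
- rewrite {2}/flat ltxx.
  have [C hC] := flat_bounded ('X^2 * P).
  have C0 : 0 <= C by rewrite (le_trans _ (hC 0)).
  suff h : (fun h : R => h^-1 *: (flat P (h *: (1 : R) + 0) - flat P 0)) @ 0^' --> (0 : R).
    by split; [apply/cvg_ex; exists 0|exact/cvg_lim].
  apply/cvgr0Pnorm_le => e e0.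
  have C1 : 0 < C + 1 by rewrite ltr_wpDl.
  have eC : 0 < e / (C + 1) by rewrite divr_gt0.
  near=> h.
  rewrite /GRing.scale /= mulr1 addr0 {2}/flat ltxx subr0.
  have [h0|h0] := ltP 0 h; last by rewrite /flat ltNge h0 /= mulr0 normr0 ltW.
  have -> : h^-1 * flat P h = h * flat ('X^2 * P) h.
    by rewrite /flat h0 !hornerE /=; field; rewrite gt_eqF.
  have he : `|h| < e / (C + 1).
    near: h; apply: (@nbhs_dnbhs R 0); exists (e / (C + 1)).
      exact: eC.
    by move=> s /=; rewrite sub0r normrN.
  rewrite normrM; apply: (@le_trans _ _ (`|h| * (C + 1))).
    by rewrite ler_wpM2l// (le_trans (hC h))// lerDl.
  by rewrite -ler_pdivlMr// ltW.
Unshelve. all: by end_near. Qed.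

End flat_functions.

Section bump_expressions.
Variables (R : realType) (n : nat).
Local Notation V := 'rV[R]_n.+1.

(** Cutoff functions and all their derivatives are denoted by expressions, so
    that smoothness, bounds and symmetry of second derivatives are proved by
    induction once and for all. *)
Inductive bexpr : Type :=
| Cst of R
| Flat of {poly R} & R & R & 'I_n.+1
| Add of bexpr & bexpr
| Mul of bexpr & bexpr.

Fixpoint beval (e : bexpr) (y : V) : R :=
  match e with
  | Cst c => c
  | Flat P a b k => flat P (a * y 0 k + b)
  | Add e f => beval e y + beval f y
  | Mul e f => beval e y * beval f y
  end.

Fixpoint bderiv (i : 'I_n.+1) (e : bexpr) : bexpr :=
  match e with
  | Cst _ => Cst 0
  | Flat P a b k => if i == k then Mul (Cst a) (Flat (dflat P) a b k) else Cst 0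
  | Add e f => Add (bderiv i e) (bderiv i f)
  | Mul e f => Add (Mul (bderiv i e) f) (Mul e (bderiv i f))
  end.

Lemma is_derive_flat_affine (P : {poly R}) (a b t : R) :
  is_derive t 1 (fun t => flat P (a * t + b)) (a * flat (dflat P) (a * t + b)).
Proof.
have ia : is_derive t 1 (fun t : R => a * t + b) a.
  have -> : (fun t : R => a * t + b) = (a *: (id : R -> R) + cst b) by [].
  apply: (is_derive_eq (is_deriveD (is_deriveZ a (is_derive_id t 1)) (is_derive_cst b t 1))).
  by rewrite addr0 /GRing.scale /= mulr1.
have := @is_derive1_comp R _ (fun t : R => a * t + b) t _ _ (is_derive_flat P (a * t + b)) ia.
by rewrite mulrC.
Qed.

Lemma beval_differentiable e (y : V) : differentiable (beval e) y.
Proof.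
elim: e => [c|P a b k|e IHe f IHf|e IHe f IHf].
- exact: differentiable_cst.
- have -> : beval (Flat P a b k) =
     (fun t : R => flat P (a * t + b)) \o (fun y : V => y 0 k) by [].
  apply: differentiable_comp; first exact: differentiable_coord.
  apply/derivable1_diffP.
  by have [] := is_derive_flat_affine P a b (y 0 k).
- exact: differentiableD.
- exact: differentiableM.
Qed.

Lemma beval_continuous e : continuous (beval e).
Proof. by move=> y; apply: differentiable_continuous; exact: beval_differentiable. Qed.

Lemma beval_deriv i e : 'D_(delta_mx 0 i) (beval e) = beval (bderiv i e).
Proof.
apply/funext => y.
elim: e => [c|P a b k|e IHe f IHf|e IHe f IHf] /=.
- exact: derive_cst.
- have [<-|ik] := eqVneq i k.
    have [_ /= <-] := is_derive_flat_affine P a b (y 0 i).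
    apply: (congr1 (fun g : R -> R => lim (g @ 0^'))); apply/funext => h.
    by rewrite /= !mxE !eqxx.
  rewrite /derive (_ : (fun h : R => _) = cst 0); first exact: lim_cst.
  apply/funext => h; rewrite /= !mxE eqxx /= [k == i]eq_sym (negPf ik) mulr0 add0r.
  by rewrite subrr scaler0.
- rewrite -IHe -IHf; have d g : derivable (beval g) y (delta_mx 0 i).
    exact/diff_derivable/beval_differentiable.
  exact: (deriveD (d e) (d f)).
- have d g : derivable (beval g) y (delta_mx 0 i).
    exact/diff_derivable/beval_differentiable.
  apply: (etrans (deriveM (d e) (d f))).
  by rewrite IHe IHf /GRing.scale /= addrC [X in X + _]mulrC.
Qed.

Lemma beval_partials s e : partials s (beval e) = beval (foldr bderiv e s).
Proof. by elim: s => //= i s ->; rewrite beval_deriv. Qed.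

Lemma beval_smooth e : smooth (beval e).
Proof. by move=> s y; rewrite beval_partials; exact: beval_differentiable. Qed.

Lemma bderivC i j e y : beval (bderiv i (bderiv j e)) y = beval (bderiv j (bderiv i e)) y.
Proof.
elim: e => [c|P a b k|e IHe f IHf|e IHe f IHf] //=.
- have [->|ik] := eqVneq i k; have [->|jk] := eqVneq j k => //=;
    by rewrite ?eqxx ?(negPf ik) ?(negPf jk) //= ?mul0r ?mulr0 ?addr0.
- by rewrite IHe IHf.
- by rewrite IHe IHf; ring.
Qed.

Lemma beval_bounded e : exists C, forall y, `|beval e y| <= C.
Proof.
elim: e => [c|P a b k|e [C hC] f [D hD]|e [C hC] f [D hD]] /=.
- by exists `|c|.
- by have [C hC] := flat_bounded P; exists C.
- by exists (C + D) => y; rewrite (le_trans (ler_normD _ _))// lerD.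
- by exists (C * D) => y; rewrite normrM ler_pM.
Qed.

(** The class is stable under [y |-> x - y], which turns a convolution kernel
    into a test function. *)
Fixpoint breflect (x : V) (e : bexpr) : bexpr :=
  match e with
  | Cst c => Cst c
  | Flat P a b k => Flat P (- a) (a * x 0 k + b) k
  | Add e f => Add (breflect x e) (breflect x f)
  | Mul e f => Mul (breflect x e) (breflect x f)
  end.

Lemma beval_reflect x e y : beval (breflect x e) y = beval e (x - y).
Proof.
elim: e => [c|P a b k|e IHe f IHf|e IHe f IHf] //=; try by rewrite IHe IHf.
by congr (flat _ _); rewrite !mxE; ring.
Qed.

Lemma bderiv_reflect x i e y :
  beval (bderiv i (breflect x e)) y = - beval (bderiv i e) (x - y).
Proof.
elim: e => [c|P a b k|e IHe f IHf|e IHe f IHf] /=.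
- by rewrite oppr0.
- case: ifP => _ /=; last by rewrite oppr0.
  by rewrite !mxE mulNr; congr (- (_ * flat _ _)); ring.
- by rewrite IHe IHf opprD.
- by rewrite IHe IHf !beval_reflect; ring.
Qed.

Lemma bderiv2_reflect x i j e y :
  beval (bderiv i (bderiv j (breflect x e))) y = beval (bderiv i (bderiv j e)) (x - y).
Proof.
elim: e => [c|P a b k|e IHe f IHf|e IHe f IHf] //=.
- case: ifP => _ //=; case: ifP => _ /=; last by rewrite !mul0r !mulr0.
  rewrite !mxE !mul0r !add0r.
  by rewrite (_ : _ + _ = a * (x 0 k - y 0 k) + b); ring.
- by rewrite IHe IHf.
- by rewrite IHe IHf !beval_reflect !bderiv_reflect; ring.
Qed.

End bump_expressions.

(** * Taylor expansions *)

Lemma mean_value_bound (R : realType) (f df : R -> R) (M : R) :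
  (forall t : R, is_derive t 1 f (df t)) ->
  (forall t, 0 <= t <= 1 -> `|df t| <= M) -> `|f 1 - f 0| <= M.
Proof.
move=> fd dM.
have [|c] := @MVT_segment R f df 0 1 ler01 (fun x _ => fd x).
  apply: continuous_subspaceT => x.
  by apply: differentiable_continuous; apply/derivable1_diffP; have [] := fd x.
by rewrite in_itv /= subr0 mulr1 => c01 ->; exact: dM.
Qed.

Section taylor.
Variables (R : realType) (n : nat).
Local Notation V := 'rV[R]_n.+1.
Local Notation bexpr := (bexpr R n).
Implicit Types (e : bexpr) (x z : V).

Lemma is_derive_beval_line e x z (t : R) :
  is_derive t 1 (fun t : R => beval e (x + t *: z))
    (\sum_i z 0 i * beval (bderiv i e) (x + t *: z)).
Proof.
elim: e => [c|P a b k|e IHe f IHf|e IHe f IHf] /=.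
- apply: (is_derive_eq (is_derive_cst c t 1)).
  by rewrite big1// => i _; rewrite mulr0.
- rewrite (_ : (fun t : R => _) = fun t => flat P (a * z 0 k * t + (a * x 0 k + b))).
    apply: (is_derive_eq (is_derive_flat_affine _ _ _ _)).
    rewrite (bigD1 k)//= eqxx /= big1 ?addr0 => [|i /negPf ->]; last by rewrite /= mulr0.
    rewrite !mxE mulrCA mulrA; congr (_ * flat _ _); ring.
  by apply/funext => s; rewrite !mxE; congr (flat _ _); ring.
- apply: (is_derive_eq (is_deriveD IHe IHf)).
  by rewrite -big_split; apply: eq_bigr => i _ /=; rewrite mulrDr.
- apply: (is_derive_eq (is_deriveM IHe IHf)).
  rewrite /GRing.scale /= !mulr_sumr -big_split; apply: eq_bigr => i _ /=; ring.
Qed.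

(** Each order of the expansion follows from the previous one, applied to the
    partial derivatives and integrated along the segment by the mean value
    theorem. *)
Lemma taylor0 e : exists2 C, 0 <= C & forall x z,
  `|beval e (x + z) - beval e x| <= C * `|z|.
Proof.
have /choice[B hB] : forall i, exists C, forall y, `|beval (bderiv i e) y| <= C.
  by move=> i; exact: beval_bounded.
have B0 i : 0 <= B i by rewrite (le_trans _ (hB i 0)).
exists (\sum_i B i) => [|x z]; first exact: sumr_ge0.
have := mean_value_bound (is_derive_beval_line e x z).
rewrite scale1r scale0r addr0; apply => t _.
rewrite mulr_suml (le_trans (ler_norm_sum _ _ _))// ler_sum// => i _.
by rewrite normrM mulrC ler_pM// coord_norm_le.
Qed.

Lemma taylor1 e : exists2 C, 0 <= C & forall x z,
  `|beval e (x + z) - beval e x - \sum_i z 0 i * beval (bderiv i e) x|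
    <= C * `|z| ^+ 2.
Proof.
have /choice[B hB] : forall i, exists C, 0 <= C /\ forall x z,
    `|beval (bderiv i e) (x + z) - beval (bderiv i e) x| <= C * `|z|.
  by move=> i; have [C] := taylor0 (bderiv i e); exists C.
exists (\sum_i B i) => [|x z]; first by apply: sumr_ge0 => i _; have [] := hB i.
pose L := \sum_i z 0 i * beval (bderiv i e) x.
have dL (t : R) : is_derive t 1 (fun t => beval e (x + t *: z) - L * t)
    (\sum_i z 0 i * beval (bderiv i e) (x + t *: z) - L * 1).
  exact: (is_deriveB (is_derive_beval_line e x z t) (is_deriveZ L (is_derive_id t 1))).
have := mean_value_bound dL.
rewrite scale1r scale0r addr0 !mulr1 mulr0 subr0 addrAC.
apply => t /andP[t0 t1].
rewrite -sumrB mulr_suml (le_trans (ler_norm_sum _ _ _))// ler_sum// => i _.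
have [B0 {}hB] := hB i.
rewrite -mulrBr normrM expr2 mulrCA ler_pM ?coord_norm_le//.
rewrite (le_trans (hB _ _))// ler_wpM2l// normrZ ger0_norm//.
by rewrite ler_piMl.
Qed.

Lemma taylor2 e : exists2 C, 0 <= C & forall x z,
  `|beval e (x + z) - beval e x - \sum_i z 0 i * beval (bderiv i e) x
    - 2^-1 * \sum_i \sum_j z 0 i * z 0 j * beval (bderiv j (bderiv i e)) x|
    <= C * `|z| ^+ 3.
Proof.
have /choice[B hB] : forall i, exists C, 0 <= C /\ forall x z,
    `|beval (bderiv i e) (x + z) - beval (bderiv i e) x -
      \sum_j z 0 j * beval (bderiv j (bderiv i e)) x| <= C * `|z| ^+ 2.
  by move=> i; have [C] := taylor1 (bderiv i e); exists C.
exists (\sum_i B i) => [|x z]; first by apply: sumr_ge0 => i _; have [] := hB i.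
pose L := \sum_i z 0 i * beval (bderiv i e) x.
pose Q := \sum_i \sum_j z 0 i * z 0 j * beval (bderiv j (bderiv i e)) x.
have dQ (t : R) : is_derive t 1 (fun t => 2^-1 * Q * t ^+ 2) (Q * t).
  have := is_deriveM (is_deriveZ (2^-1 * Q) (is_derive_id t 1)) (is_derive_id t 1).
  rewrite (_ : _ * _ = fun t => 2^-1 * Q * t ^+ 2).
    move=> /is_derive_eq; apply; rewrite /GRing.scale /=.
    by rewrite -[_ *: t]/(2^-1 * Q * t); field.
  by apply/funext => s; rewrite expr2 mulrA.
have dL (t : R) : is_derive t 1
    (fun t => beval e (x + t *: z) - L * t - 2^-1 * Q * t ^+ 2)
    (\sum_i z 0 i * beval (bderiv i e) (x + t *: z) - L * 1 - Q * t).
  exact: (is_deriveB (is_deriveB (is_derive_beval_line e x z t)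
            (is_deriveZ L (is_derive_id t 1))) (dQ t)).
have := mean_value_bound dL.
rewrite scale1r scale0r addr0 !mulr1 mulr0 subr0.
rewrite expr1n expr0n /= mulr1 mulr0 subr0.
rewrite (_ : _ - _ - _ - _ = beval e (x + z) - beval e x - L - 2^-1 * Q); last ring.
apply => t /andP[t0 t1].
rewrite /L /Q mulr_suml -!sumrB mulr_suml (le_trans (ler_norm_sum _ _ _))// ler_sum// => i _.
have [B0 {}hB] := hB i.
have -> : z 0 i * beval (bderiv i e) (x + t *: z) - z 0 i * beval (bderiv i e) x -
    (\sum_j z 0 i * z 0 j * beval (bderiv j (bderiv i e)) x) * t =
  z 0 i * (beval (bderiv i e) (x + t *: z) - beval (bderiv i e) x -
    \sum_j (t *: z) 0 j * beval (bderiv j (bderiv i e)) x).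
  rewrite !mulrBr; congr (_ - _); rewrite mulr_suml mulr_sumr.
  by apply: eq_bigr => j _; rewrite mxE; ring.
rewrite normrM exprS mulrCA ler_pM ?coord_norm_le//.
rewrite (le_trans (hB _ _))// ler_wpM2l// ler_pXn2r ?nnegrE// normrZ ger0_norm//.
by rewrite ler_piMl.
Qed.

End taylor.

(** * Cutoff functions *)

Section cutoff.
Variables (R : realType) (n : nat).
Local Notation bexpr := (bexpr R n).

(** The product over the coordinates of [exp (- 1 / (1 + t)) * exp (- 1 / (1 - t))]
    with [t = z_i / h]: it vanishes outside the open cube of radius [h]. *)
Definition cutoff (h : R) : bexpr :=
  \big[@Mul R n/Cst n 1]_(i < n.+1) Mul (Flat 1 h^-1 1 i) (Flat 1 (- h^-1) 1 i).

Lemma cutoffE h z : beval (cutoff h) z =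
  \prod_(i < n.+1) (flat 1 (h^-1 * z 0 i + 1) * flat 1 (- h^-1 * z 0 i + 1)).
Proof.
rewrite /cutoff (big_morph (fun e => beval e z) (id1 := 1) (op1 := *%R)) //.
Qed.

Lemma flat1_ge0 (t : R) : 0 <= flat 1 t.
Proof. by rewrite /flat; case: ifP => // _; rewrite hornerE mul1r expR_ge0. Qed.

Lemma flat1_le1 (t : R) : flat 1 t <= 1.
Proof.
rewrite /flat; case: ifP => // t0; rewrite hornerE mul1r -expR0 ler_expR.
by rewrite oppr_le0 invr_ge0 ltW.
Qed.

Lemma cutoff_ge0 h z : 0 <= beval (cutoff h) z.
Proof. by rewrite cutoffE prodr_ge0// => i _; rewrite mulr_ge0// flat1_ge0. Qed.

Lemma cutoff_le1 h z : beval (cutoff h) z <= 1.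
Proof.
rewrite cutoffE; apply: prodr_ile1 => i _.
by rewrite mulr_ge0 ?flat1_ge0//= mulr_ile1 ?flat1_ge0 ?flat1_le1.
Qed.

Lemma cutoff_even h z : beval (cutoff h) (- z) = beval (cutoff h) z.
Proof.
rewrite !cutoffE; apply: eq_bigr => i _; rewrite mulrC !mxE.
by congr (flat _ _ * flat _ _); ring.
Qed.

Lemma cutoff_support h z : 0 < h -> beval (cutoff h) z != 0 -> `|z| < h.
Proof.
move=> h0 bz; apply/norm_rV_ltP => i; move: bz; apply: contraNT.
rewrite -leNgt cutoffE (bigD1 i)//= => hz.
suff -> : flat 1 (h^-1 * z 0 i + 1) * flat 1 (- h^-1 * z 0 i + 1) = 0 by rewrite mul0r.
have hi : h^-1 * h = 1 by rewrite mulVf ?gt_eqF.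
have hp : 0 < h^-1 by rewrite invr_gt0.
move: hz; rewrite ler_normr => /orP[] hz; rewrite /flat.
- rewrite [in X in _ * X]ifF ?mulr0//; apply/negbTE; rewrite -leNgt.
  have := ler_wpM2l (ltW hp) hz; rewrite hi mulNr; lra.
- rewrite [in X in X * _]ifF ?mul0r//; apply/negbTE; rewrite -leNgt.
  have := ler_wpM2l (ltW hp) hz; rewrite hi mulrN; lra.
Qed.

(** On the cube of half the radius both arguments of [flat] are at least [1/2],
    so that the cutoff is bounded below by a constant independent of the scale. *)
Definition cutoff_floor : R := \prod_(i < n.+1) (expR (- 2) * expR (- 2)).

Lemma cutoff_floor_gt0 : 0 < cutoff_floor.
Proof. by apply: prodr_gt0 => i _; rewrite mulr_gt0// expR_gt0. Qed.

Lemma cutoff_ge h z : 0 < h -> `|z| <= h / 2 -> cutoff_floor <= beval (cutoff h) z.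
Proof.
move=> h0 /norm_rV_leP zh; rewrite cutoffE; apply: ler_prod => i _.
have fl (s : R) : 2^-1 <= s -> expR (- 2) <= flat 1 s.
  move=> s2; have s0 : 0 < s by rewrite (lt_le_trans _ s2)// invr_gt0.
  by rewrite /flat s0 hornerE mul1r ler_expR lerN2 invf_ple ?posrE.
have hi : h^-1 * h = 1 by rewrite mulVf ?gt_eqF.
have hp : 0 < h^-1 by rewrite invr_gt0.
have := zh i; rewrite ler_norml => /andP[z1 z2].
have := ler_wpM2l (ltW hp) z1; rewrite mulrN mulrA hi mul1r => {}z1.
have := ler_wpM2l (ltW hp) z2; rewrite mulrA hi mul1r => {}z2.
rewrite mulr_ge0 ?expR_ge0//=; apply: ler_pM; rewrite ?expR_ge0//; apply: fl.
- by move: z1 z2; lra.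
- by rewrite mulNr; move: z1 z2; lra.
Qed.

End cutoff.

Section test_functions.
Variables (R : realType) (n : nat).
Local Notation V := 'rV[R]_n.+1.

Lemma bderiv_eq0_near (e : bexpr R n) i (y : V) :
  (\forall z \near y, beval e z = 0) -> \forall z \near y, beval (bderiv i e) z = 0.
Proof.
move=> /near_join; apply: filterS => z e0.
rewrite -beval_deriv (@near_eq_derive _ _ _ (beval e) (cst 0) z (delta_mx 0 i))//.
exact: derive_cst.
Qed.

Lemma far_near (x y : V) (h : R) : h < `|x - y| -> \forall z \near y, h < `|x - z|.
Proof.
move=> hxy; apply: (@cvgr_gt R V (nbhs y) _ (fun z => `|x - z|) `|x - y|) => //.
by apply: cvg_norm; apply: cvgB; [exact: cvg_cst|exact: cvg_id].
Qed.

Lemma cutoff_partials_support h (x y : V) s : 0 < h ->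
  beval (foldr (@bderiv R n) (cutoff n h) s) (x - y) != 0 -> `|y - x| <= h.
Proof.
move=> h0; rewrite -(distrC x y); apply: contraNT; rewrite -ltNge => hxy.
suff : \forall z \near x - y, beval (foldr (@bderiv R n) (cutoff n h) s) z = 0.
  by move/nbhs_singleton => ->.
elim: s => /= [|i s IH]; last exact: bderiv_eq0_near.
have h' : h < `|0 - (x - y)| by rewrite sub0r normrN.
have := far_near h'; apply: filterS => z.
rewrite sub0r normrN => hz; apply/eqP; apply: contraTT hz => /(cutoff_support h0).
by rewrite -leNgt => /ltW.
Qed.

Lemma cutoff_test_function (U : set V) h (x : V) : 0 < h ->
  (forall y, `|y - x| <= h -> U y) ->
  test_function U (fun y => beval (cutoff n h) (x - y)).
Proof.
move=> h0 hU.
have E : (fun y => beval (cutoff n h) (x - y)) = beval (breflect x (cutoff n h)).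
  by apply/funext => y; rewrite beval_reflect.
pose K := [set y : V | forall i, (x - const_mx h) 0 i <= y 0 i <= (x + const_mx h) 0 i].
have cK : compact K by exact: closed_box_compact.
have sub : closure [set y | beval (cutoff n h) (x - y) != 0] `<=` K.
  rewrite [X in _ `<=` X](closure_id K).1; last by apply: compact_closed => //; exact: norm_hausdorff.
  apply: closure_subset => y /= /(cutoff_support h0) /norm_rV_ltP xy i.
  by have := xy i; rewrite !mxE ltr_norml => /andP[? ?]; apply/andP; split; lra.
split.
- by rewrite E; exact: beval_smooth.
- by apply: subclosed_compact cK sub; exact: closed_closure.
- move=> y /sub Ky; apply: hU; apply/norm_rV_leP => i.
  by have := Ky i; rewrite !mxE ler_norml => /andP[? ?]; apply/andP; split; lra.
Qed.

End test_functions.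

(** * Density of Lipschitz functions *)

Lemma min_dist (R : realDomainType) (u v u' v' c : R) : `|u - u'| <= c -> `|v - v'| <= c ->
  `|Num.min u v - Num.min u' v'| <= c.
Proof. by rewrite !ler_norml; case: (leP u v) => ?; case: (leP u' v') => ?; lra. Qed.

Lemma max_dist (R : realDomainType) (u v u' v' c : R) : `|u - u'| <= c -> `|v - v'| <= c ->
  `|Num.max u v - Num.max u' v'| <= c.
Proof. by rewrite !ler_norml; case: (leP u v) => ?; case: (leP u' v') => ?; lra. Qed.

Section outer_regularity.
Variables (R : realType) (n : nat).
Local Notation V := 'rV[R]_n.+1.
Local Notation T := (lebesgue_space R n).
Local Notation mu := (lebesgueRn R n).

(** Outer regularity, with the explicit open sets for which Lipschitz
    approximants of the indicator can be written down. *)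
Lemma open_box_cover (E : set V) (e : R) : (mu E < +oo)%E -> 0 < e ->
  exists a b : nat -> V,
    let O := \bigcup_k [set x : V | forall i, a k 0 i < x 0 i < b k 0 i] in
    E `<=` O /\ (mu O <= mu E + e%:E)%E.
Proof.
move=> Efin e0.
have Efn : mu E \is a fin_num by rewrite ge0_fin_numE// measure_ge0.
have e20 : 0 < e / 2 by rewrite divr_gt0.
have [_ [F EF <-] Fe] := lb_ereal_inf_adherent e20 Efn.
have ek0 k : 0 < e / 2 / (2 ^ k.+1)%:R by rewrite divr_gt0// ltr0n expn_gt0.
have /choice[d dP] : forall k, exists d : R, 0 < d /\
    box_volume ((F k).1, (F k).2 + const_mx d) <= box_volume (F k) + e / 2 / (2 ^ k.+1)%:R.
  move=> k; have [d d0 h] := box_volume_approx (F k).1 (F k).2 0 1 (ek0 k).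
  exists d; split=> //; rewrite -lerBlDl (le_trans (ler_norm _))// ltW//.
  have c0 : const_mx 0 = 0 :> V by apply/matrixP => ? ?; rewrite !mxE.
  by move: h; rewrite mul0r mul1r c0 addr0 -surjective_pairing.
exists (fun k => (F k).1), (fun k => (F k).2 + const_mx (d k)); split.
  move=> x /EF[k _ kx]; exists k => // i; have := kx i.
  have [d0 _] := dP k.
  by rewrite !mxE => /andP[-> h]; rewrite (le_lt_trans h)// ltrDl.
apply: (@le_trans _ _ (\sum_(k <oo) ((box_volume (F k))%:E + (e / 2 / (2 ^ k.+1)%:R)%:E))%E).
  apply: (@le_trans _ _ (\sum_(k <oo) (box_volume ((F k).1, (F k).2 + const_mx (d k)))%:E)%E).
    apply: ereal_inf_lbound => /=; exists (fun k => ((F k).1, (F k).2 + const_mx (d k))) => //.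
    by move=> x [k _ kx]; exists k => // i /=; have /andP[-> /ltW ->] := kx i.
  apply: lee_nneseries => [k _ _|k _]; first by rewrite lee_fin box_volume_ge0.
  by rewrite -EFinD lee_fin; have [] := dP k.
apply: le_trans (epsilon_trick _ _ _) _ => [k||]; last 1 first.
- rewrite [e in leRHS]splitr EFinD addeA leeD2r//; exact/ltW.
- by rewrite lee_fin box_volume_ge0.
- exact: ltW.
Qed.

(** A Lipschitz function chosen to be positive exactly on the open box between
    [a] and [b]; [min 1 (m * slab a b x)] then increases to its indicator. *)
Definition slab (a b x : V) : R :=
  Num.max 0 (\big[Num.min/1]_(i < n.+1) Num.min (x 0 i - a 0 i) (b 0 i - x 0 i)).

Lemma slab_ge0 (a b x : V) : 0 <= slab a b x.
Proof. by rewrite le_max lexx. Qed.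

Lemma slab_gt0P (a b x : V) :
  reflect (forall i, a 0 i < x 0 i < b 0 i) (0 < slab a b x).
Proof.
rewrite /slab lt_max ltxx /=.
apply: (iffP idP) => [h i|h].
  move: h; rewrite (bigD1 i)//= !lt_min !subr_gt0.
  by case/andP.
elim/big_ind : _ => [//|u v u0 v0|i _]; first by rewrite lt_min u0.
by rewrite lt_min !subr_gt0.
Qed.

Definition lipschitz_fun (g : V -> R) :=
  exists2 L : R, 0 <= L & forall x y, `|g x - g y| <= L * `|x - y|.

Lemma lipschitz_slab (a b : V) : lipschitz_fun (slab a b).
Proof.
exists 1 => // x y; rewrite mul1r; apply: max_dist; first by rewrite subrr normr0.
elim/big_ind2 : _ => [|*|i _]; first by rewrite subrr normr0.
  exact: min_dist.
have := coord_norm_le (x - y) i; rewrite !mxE => h.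
apply: min_dist; first by rewrite (_ : _ - _ = x 0 i - y 0 i)//; ring.
by rewrite distrC (_ : _ - _ = x 0 i - y 0 i)//; ring.
Qed.

Lemma lipschitz_cst c : lipschitz_fun (fun=> c).
Proof. by exists 0 => // x y; rewrite subrr normr0 mul0r. Qed.

Lemma lipschitzD f g : lipschitz_fun f -> lipschitz_fun g ->
  lipschitz_fun (fun x => f x + g x).
Proof.
move=> [L L0 fL] [M M0 gM]; exists (L + M) => [|x y]; first exact: addr_ge0.
by rewrite opprD addrACA mulrDl (le_trans (ler_normD _ _))// lerD.
Qed.

Lemma lipschitzZ c f : lipschitz_fun f -> lipschitz_fun (fun x => c * f x).
Proof.
move=> [L L0 fL]; exists (`|c| * L) => [|x y]; first exact: mulr_ge0.
by rewrite -mulrBr normrM -mulrA ler_wpM2l.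
Qed.

Lemma lipschitz_min f g : lipschitz_fun f -> lipschitz_fun g ->
  lipschitz_fun (fun x => Num.min (f x) (g x)).
Proof.
move=> [L L0 fL] [M M0 gM]; exists (L + M) => [|x y]; first exact: addr_ge0.
apply: min_dist; [apply: le_trans (fL x y) _|apply: le_trans (gM x y) _];
  by rewrite ler_wpM2r// ?lerDl ?lerDr.
Qed.

Lemma lipschitz_max f g : lipschitz_fun f -> lipschitz_fun g ->
  lipschitz_fun (fun x => Num.max (f x) (g x)).
Proof.
move=> [L L0 fL] [M M0 gM]; exists (L + M) => [|x y]; first exact: addr_ge0.
apply: max_dist; [apply: le_trans (fL x y) _|apply: le_trans (gM x y) _];
  by rewrite ler_wpM2r// ?lerDl ?lerDr.
Qed.

Lemma lipschitz_sum (I : Type) (s : seq I) (f : I -> V -> R) :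
  (forall i, lipschitz_fun (f i)) -> lipschitz_fun (fun x => \sum_(i <- s) f i x).
Proof.
move=> fl; elim: s => [|i s IH].
  by under eq_fun do rewrite big_nil; exact: lipschitz_cst.
by under eq_fun do rewrite big_cons; exact: lipschitzD.
Qed.

Lemma lipschitz_continuous g : lipschitz_fun g -> continuous g.
Proof.
move=> [L L0 gL] x; apply/(@cvgrPdist_le _ _ _ (nbhs (x : V)) _) => e e0.
have L1 : 0 < L + 1 by rewrite ltr_wpDl.
have d0 : 0 < (L + 1)^-1 * e by rewrite mulr_gt0// invr_gt0.
apply/nbhs_ballP; exists ((L + 1)^-1 * e) => // y; rewrite mx_norm_ball /ball_ /= => xy.
rewrite (le_trans (gL x y))//; apply: (@le_trans _ _ ((L + 1) * `|x - y|)).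
  by rewrite ler_wpM2r// lerDl.
by rewrite -ler_pdivlMl// ltW.
Qed.

Lemma lipschitz_measurable g : lipschitz_fun g -> measurable_fun setT (g : T -> R).
Proof. by move=> /lipschitz_continuous; exact: continuous_measurable_Rn. Qed.

End outer_regularity.

Section density.
Context d (T : measurableType d) (R : realType).
Variables (mu : {measure set T -> \bar R}) (K : set T).
Hypotheses (mK : measurable K) (Kfin : (mu K < +oo)%E).

Lemma dominated_small (h_ : nat -> T -> R) (g : T -> R) (e : R) : 0 < e ->
  (forall m, measurable_fun K (h_ m)) ->
  (forall m x, K x -> 0 <= h_ m x <= g x) ->
  (forall x, K x -> h_ ^~ x @ \oo --> (0 : R)) ->
  mu.-integrable K (EFin \o g) ->
  exists m, (\int[mu]_(x in K) (h_ m x)%:E <= e%:E)%E.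
Proof.
move=> e0 mh hg h0 ig.
have [] := @dominated_convergence _ T R mu K mK (fun m => EFin \o h_ m) (cst 0%E) (EFin \o g).
- by move=> m; exact/measurable_EFinP.
- exact: measurable_cst.
- by apply: aeW => x Kx; apply: cvg_EFin; [exact: nearW|exact: h0].
- exact: ig.
- apply: aeW => x m Kx /=; have /andP[h1 h2] := hg m x Kx.
  by rewrite lee_fin ger0_norm.
move=> _ _; rewrite integral0 => /fine_cvgP[fin_near /cvgrPdist_lt/(_ e e0) small].
have [m _ hm] : \forall m \near \oo, (\int[mu]_(x in K) (h_ m x)%:E <= e%:E)%E.
  near=> m.
  have fm : (\int[mu]_(x in K) (h_ m x)%:E)%E \is a fin_num by near: m.
  rewrite -(fineK fm) lee_fin.
  have : `|0 - fine (\int[mu]_(x in K) (h_ m x)%:E)%E| < e by near: m.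
  by rewrite sub0r normrN => /(le_lt_trans (ler_norm _))/ltW.
by exists m; apply: hm => /=.
Unshelve. all: by end_near. Qed.

Lemma measurable_dist (u v : T -> R) : measurable_fun K u -> measurable_fun K v ->
  measurable_fun K (fun x => (`|u x - v x|)%:E).
Proof.
move=> mu_ mv; apply/measurable_EFinP; apply: measurableT_comp => //.
exact: measurable_funB.
Qed.

Lemma integral_dist_triangle (f g h : T -> R) : measurable_fun K f ->
  measurable_fun K g -> measurable_fun K h ->
  (\int[mu]_(x in K) (`|f x - h x|)%:E <=
   \int[mu]_(x in K) (`|f x - g x|)%:E + \int[mu]_(x in K) (`|g x - h x|)%:E)%E.
Proof.
move=> mf mg mh.
have mfg := measurable_dist mf mg; have mgh := measurable_dist mg mh.
have mfh := measurable_dist mf mh.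
rewrite -ge0_integralD//.
apply: ge0_le_integral => //; first exact: emeasurable_funD.
move=> x _; rewrite -EFinD lee_fin -(subrKA (g x)).
exact: ler_normD.
Qed.

(** [G] is a vector lattice of measurable functions, thought of as a class of
    nice functions among which approximants are sought. *)
Variable G : (T -> R) -> Prop.
Hypothesis G_meas : forall g, G g -> measurable_fun K g.
Hypothesis G_cst : forall c, G (fun=> c).
Hypothesis G_D : forall f g, G f -> G g -> G (fun x => f x + g x).
Hypothesis G_Z : forall c f, G f -> G (fun x => c * f x).
Hypothesis G_min : forall f g, G f -> G g -> G (fun x => Num.min (f x) (g x)).
Hypothesis G_max : forall f g, G f -> G g -> G (fun x => Num.max (f x) (g x)).

Definition L1_approx (f : T -> R) := forall e : R, 0 < e ->
  exists2 g, G g & (\int[mu]_(x in K) (`|f x - g x|)%:E <= e%:E)%E.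

Lemma L1_approx_limit (f : T -> R) : measurable_fun K f ->
  (forall e : R, 0 < e -> exists2 h : T -> R, measurable_fun K h /\ L1_approx h &
     (\int[mu]_(x in K) (`|f x - h x|)%:E <= e%:E)%E) -> L1_approx f.
Proof.
move=> mf H e e0; have e20 : 0 < e / 2 by rewrite divr_gt0.
have [h [mh /(_ _ e20)[g gl hg]] fh] := H _ e20.
exists g => //; apply: le_trans (integral_dist_triangle mf mh (G_meas gl)) _.
by rewrite [e]splitr EFinD leeD.
Qed.

Lemma L1_approxD (f h : T -> R) : measurable_fun K f -> measurable_fun K h ->
  L1_approx f -> L1_approx h -> L1_approx (fun x => f x + h x).
Proof.
move=> mf mh Af Ah e e0; have e20 : 0 < e / 2 by rewrite divr_gt0.
have [g gl fg] := Af _ e20; have [k kl hk] := Ah _ e20.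
exists (fun x => g x + k x); first exact: G_D.
have mg := G_meas gl; have mk := G_meas kl.
apply: le_trans (integral_dist_triangle (g := fun x => g x + h x) _ _ _) _.
- exact: measurable_funD.
- exact: measurable_funD.
- exact: measurable_funD.
rewrite [e]splitr EFinD leeD//.
- apply: le_trans fg; rewrite le_eqVlt; apply/orP; left; apply/eqP.
  by apply: eq_integral => x _; congr (`|_|%:E); ring.
- apply: le_trans hk; rewrite le_eqVlt; apply/orP; left; apply/eqP.
  by apply: eq_integral => x _; congr (`|_|%:E); ring.
Qed.

Lemma L1_approxZ (c : R) (f : T -> R) : measurable_fun K f -> L1_approx f ->
  L1_approx (fun x => c * f x).
Proof.
move=> mf Af e e0.
have c1 : 0 < `|c| + 1 by rewrite ltr_wpDl.
have [g gl fg] := Af _ (divr_gt0 e0 c1); exists (fun x => c * g x); first exact: G_Z.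
under eq_integral do rewrite -mulrBr normrM EFinM.
rewrite ge0_integralZl//; last exact: measurable_dist (G_meas gl).
apply: (@le_trans _ _ ((`|c| + 1)%:E * (e / (`|c| + 1))%:E)%E).
  apply: lee_pmul => //; last by rewrite lee_fin lerDl.
  by apply: integral_ge0 => x _; rewrite lee_fin.
by rewrite -EFinM lee_fin mulrC divfK// gt_eqF.
Qed.

Hypothesis G_indic : forall E, measurable E -> E `<=` K -> L1_approx \1_E.

Import HBSimple.

Lemma L1_approx_integrable (f : T -> R) :
  mu.-integrable K (EFin \o f) -> L1_approx f.
Proof.
move=> intf; apply: L1_approx_limit => [|e e0].
  exact/measurable_EFinP/(measurable_int _ intf).
have [g_ [intg _ cvg0]] := approximation_sfun_integrable mK intf.
have /fine_cvgP[fin_near /cvgrPdist_lt/(_ e e0) small] := cvg0.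
have [m _ hm] : \forall m \near \oo,
    (\int[mu]_(x in K) (`|f x - g_ m x|)%:E <= e%:E)%E.
  near=> m.
  have fm : (\int[mu]_(z in K) `|(EFin \o f) z - (g_ m z)%:E|)%E \is a fin_num by near: m.
  have -> : (\int[mu]_(x in K) (`|f x - g_ m x|)%:E = \int[mu]_(z in K) `|(EFin \o f) z - (g_ m z)%:E|)%E.
    by apply: eq_integral => x _.
  rewrite -(fineK fm) lee_fin.
  have : `|0 - fine (\int[mu]_(z in K) `|(EFin \o f) z - (g_ m z)%:E|)%E| < e by near: m.
  by rewrite sub0r normrN => /(le_lt_trans (ler_norm _))/ltW.
exists (g_ m); last by apply: hm => /=.
split; first exact: measurable_funTS.
pose s := finmap.enum_fset (fset_set (range (g_ m))).
have -> : (g_ m : T -> R) = fun x => \sum_(r <- s) r * \1_(g_ m @^-1` [set r]) x.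
  by apply/funext => x; rewrite fimfunE fsbig_finite.
have mI r : measurable_fun K (\1_(g_ m @^-1` [set r]) : T -> R).
  by apply: measurable_indic; exact: measurable_sfunP.
have : measurable_fun K (fun x => \sum_(r <- s) r * \1_(g_ m @^-1` [set r]) x) /\
   L1_approx (fun x => \sum_(r <- s) r * \1_(g_ m @^-1` [set r]) x); last by case.
elim: s => [|r s [mS AS]].
  under eq_fun do rewrite big_nil.
  split; first exact: measurable_cst.
  move=> d' d'0; exists (fun=> 0) => //; rewrite integral0_eq ?lee_fin ?ltW//.
  by move=> x _; rewrite subrr normr0.
under eq_fun do rewrite big_cons.
have mrI : measurable_fun K (fun x => r * (\1_(g_ m @^-1` [set r]) x : R)).
  exact: measurable_funM.
split; first exact: measurable_funD.
apply: L1_approxD => //; apply: L1_approxZ => //.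
move=> d' d'0.
have mE : measurable (K `&` g_ m @^-1` [set r]).
  by apply: measurableI => //; exact: measurable_sfunP.
have [h Gh hE] := G_indic mE (@subIsetl _ _ _) d'0.
exists h => //; apply: le_trans hE; rewrite le_eqVlt; apply/orP; left; apply/eqP.
apply: eq_integral => x /set_mem Kx; congr (`|_ - _|%:E).
by rewrite !indicE in_setI (mem_set Kx).
Unshelve. all: by end_near. Qed.

Lemma exprD_le (p : nat) (a b : R) : 0 <= a -> 0 <= b ->
  (a + b) ^+ p <= 2 ^+ p * (a ^+ p + b ^+ p).
Proof.
move=> a0 b0; apply: (@le_trans _ _ ((2 * Num.max a b) ^+ p)).
  rewrite lerXn2r ?nnegrE ?addr_ge0 ?mulr_ge0 ?le_max ?a0//.
  by case: (leP a b) => ?; lra.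
rewrite exprMn ler_wpM2l ?exprn_ge0//.
by case: (leP a b) => _; rewrite ?lerDl ?lerDr exprn_ge0.
Qed.

(** Truncation reduces the power [q.+1] to the first power: where both functions
    are bounded by [B], the power of their difference is at most [(2 * B) ^+ q]
    times the difference. *)
Lemma Lq_approx (f : T -> R) (q : nat) (e : R) : measurable_fun K f ->
  (\int[mu]_(x in K) (`|f x| ^+ q.+1)%:E < +oo)%E -> 0 < e ->
  exists2 g, G g & (\int[mu]_(x in K) (`|f x - g x| ^+ q.+1)%:E <= e%:E)%E.
Proof.
move=> mf fq e0.
pose cl (B t : R) := Num.max (- B) (Num.min B t).
have cl_bd B t : 0 <= B -> `|cl B t| <= B.
  by rewrite ler_norml /cl => ?; case: (leP B t) => ?; [case: (leP (- B) B) => ?|case: (leP (- B) t) => ?]; lra.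
have cl_id B t : `|t| <= B -> cl B t = t.
  by rewrite ler_norml /cl => h; case: (leP B t) => ?; [case: (leP (- B) B) => ?|case: (leP (- B) t) => ?]; lra.
have cl_dist B s t : `|cl B s - cl B t| <= `|s - t|.
  by apply: max_dist; [rewrite subrr normr0|apply: min_dist => //; rewrite subrr normr0].
have cl_sub B t : 0 <= B -> `|t - cl B t| <= `|t|.
  move=> B0; have [h|h] := leP `|t| B; first by rewrite cl_id// subrr normr0.
  suff h' : forall c : R, t <= c -> - t <= c -> `|t - cl B t| <= c.
    by apply: h'; rewrite ?ler_norm// -normrN ler_norm.
  move=> c h1 h2; rewrite ler_norml /cl.
  by case: (leP B t) => ?; [case: (leP (- B) B) => ?|case: (leP (- B) t) => ?]; lra.
have mcl B (u : T -> R) : measurable_fun K u -> measurable_fun K (fun x => cl B (u x)).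
  move=> mu_; apply: measurable_maxr; first exact: measurable_cst.
  by apply: measurable_minr => //; exact: measurable_cst.
have mdX (u v : T -> R) p : measurable_fun K u -> measurable_fun K v ->
    measurable_fun K (fun x => `|u x - v x| ^+ p).
  move=> mu_ mv; apply: measurable_funX; apply: measurableT_comp => //.
  exact: measurable_funB.
pose c : R := 2 ^+ q.+1.
have c0 : 0 < c by rewrite exprn_gt0.
have [m hm] : exists m, (\int[mu]_(x in K) (`|f x - cl m%:R (f x)| ^+ q.+1)%:E
    <= (e / (2 * c))%:E)%E.
  apply: (@dominated_small (fun m x => `|f x - cl m%:R (f x)| ^+ q.+1)
    (fun x => `|f x| ^+ q.+1)) => //.
  - by rewrite divr_gt0// mulr_gt0.
  - by move=> m; apply: mdX => //; exact: mcl.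
  - by move=> m x _; rewrite exprn_ge0//= lerXn2r ?nnegrE// cl_sub.
  - move=> x _; apply: cvg_near_cst; near=> m.
    rewrite cl_id ?subrr ?normr0 ?expr0n// ltW//.
    by near: m; exact: nbhs_infty_gtr.
  - apply/integrableP; split.
      by apply/measurable_EFinP; apply: measurable_funX; exact: measurableT_comp.
    rewrite [ltLHS](_ : _ = \int[mu]_(x in K) (`|f x| ^+ q.+1)%:E)%E//.
    by apply: eq_integral => x _; rewrite /= ger0_norm// exprn_ge0.
pose B : R := m%:R.
have B0 : 0 <= B by [].
have intB : mu.-integrable K (EFin \o (fun x => cl B (f x))).
  apply: measurable_bounded_integrable => //; first exact: mcl.
  by exists B; split; [exact: num_real|] => x Bx y _ /=; rewrite (le_trans (cl_bd _ _ B0))// ltW.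
pose b : R := (2 * B) ^+ q.
have b0 : 0 <= b by rewrite exprn_ge0// mulr_ge0.
have cb0 : 0 < e / (2 * c * (b + 1)) by rewrite divr_gt0// mulr_gt0// ?mulr_gt0// ltr_wpDl.
have [g Gg hg] := L1_approx_integrable intB cb0.
have mg := G_meas Gg.
exists (fun x => cl B (g x)); first by apply: G_max => //; exact: G_min.
have h1 x : `|f x - cl B (g x)| ^+ q.+1 <=
   c * `|f x - cl B (f x)| ^+ q.+1 + c * b * `|cl B (f x) - g x|.
  apply: (@le_trans _ _ (c * (`|f x - cl B (f x)| ^+ q.+1 + `|cl B (f x) - cl B (g x)| ^+ q.+1))).
    apply: le_trans (exprD_le q.+1 (normr_ge0 _) (normr_ge0 _)).
    by rewrite lerXn2r ?nnegrE ?addr_ge0// -(subrKA (cl B (f x))) ler_normD.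
  rewrite mulrDr lerD2l -mulrA; apply: ler_wpM2l; first exact: ltW.
  rewrite [leLHS]exprSr; apply: ler_pM; rewrite ?exprn_ge0//.
    rewrite lerXn2r ?nnegrE ?mulr_ge0//.
    rewrite (le_trans (ler_normB _ _))// mulr_natl mulr2n.
    by rewrite lerD// cl_bd.
  by rewrite -[in leLHS](cl_id B (cl B (f x))) ?cl_dist// cl_bd.
apply: (@le_trans _ _ (\int[mu]_(x in K) (c%:E * (`|f x - cl B (f x)| ^+ q.+1)%:E +
    (c * b)%:E * (`|cl B (f x) - g x|)%:E))%E).
  apply: ge0_le_integral => //.
  - by apply/measurable_EFinP; apply: mdX => //; exact: mcl.
  - apply: emeasurable_funD; apply: emeasurable_funM; try exact: measurable_cst.
      by apply/measurable_EFinP; apply: mdX => //; exact: mcl.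
    by apply: measurable_dist => //; exact: mcl.
  - by move=> x _; rewrite -!EFinM -EFinD lee_fin.
have mI1 : measurable_fun K (fun x => (`|f x - cl B (f x)| ^+ q.+1)%:E).
  by apply/measurable_EFinP; apply: mdX => //; exact: mcl.
have mI2 : measurable_fun K (fun x => (`|cl B (f x) - g x|)%:E).
  by apply: measurable_dist => //; exact: mcl.
rewrite ge0_integralD//; last 4 first.
- by move=> x _; rewrite -EFinM lee_fin mulr_ge0// ltW.
- by apply: emeasurable_funM => //; exact: measurable_cst.
- by move=> x _; rewrite -EFinM lee_fin !mulr_ge0// ltW.
- by apply: emeasurable_funM => //; exact: measurable_cst.
rewrite !ge0_integralZl//; last 2 first.
- by rewrite lee_fin mulr_ge0// ltW.
- by rewrite lee_fin ltW.
apply: (@le_trans _ _ (c%:E * (e / (2 * c))%:E + (c * b)%:E * (e / (2 * c * (b + 1)))%:E)%E).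
  by apply: leeD; rewrite lee_wpmul2l// lee_fin ?mulr_ge0// ltW.
rewrite -!EFinM -EFinD lee_fin.
have -> : c * (e / (2 * c)) = e / 2 by field; rewrite gt_eqF.
have -> : c * b * (e / (2 * c * (b + 1))) = (e / 2) * (b / (b + 1)).
  by field; rewrite !gt_eqF// ltr_wpDl.
have b1 : b / (b + 1) <= 1 by rewrite ler_pdivrMr ?ltr_wpDl// mul1r lerDl.
rewrite [leRHS]splitr lerD2l; apply: ler_piMr => //.
by rewrite divr_ge0// ltW.
Unshelve. all: by end_near. Qed.

End density.

Section lipschitz_density.
Variables (R : realType) (n : nat).
Local Notation V := 'rV[R]_n.+1.
Local Notation T := (lebesgue_space R n).
Local Notation mu := (lebesgueRn R n).
Variable K : set T.
Hypotheses (mK : measurable K) (Kfin : (mu K < +oo)%E).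

Definition lip_class (g : T -> R) := lipschitz_fun (g : V -> R).

Lemma lip_class_meas (g : T -> R) : lip_class g -> measurable_fun K g.
Proof. by move=> /lipschitz_measurable; exact: measurable_funTS. Qed.

(** The first [m] slabs, added up, multiplied by [m] and cut off at 1, converge
    to the indicator of the union of all the boxes. *)
Lemma L1_approx_open (a b : nat -> V) :
  L1_approx mu K lip_class
    (\1_(\bigcup_k [set x : V | forall i, a k 0 i < x 0 i < b k 0 i]) : T -> R).
Proof.
set O := \bigcup_k _ => e e0.
pose S m x := \sum_(k < m) slab (a k) (b k) x.
pose g m (x : V) := Num.min 1 (m%:R * S m x).
have gl m : lipschitz_fun (g m).
  apply: lipschitz_min; first exact: lipschitz_cst.
  by apply: lipschitzZ; apply: lipschitz_sum => k; exact: lipschitz_slab.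
have S0 m x : 0 <= S m x by apply: sumr_ge0 => k _; exact: slab_ge0.
have g0 m x : 0 <= g m x by rewrite le_min ler01 mulr_ge0.
have g1 m x : g m x <= 1 by rewrite ge_min lexx.
have mO : measurable (O : set T).
  apply: bigcupT_measurable => k; exact/open_measurable_Rn/open_box_open.
have mh m : measurable_fun K (fun x : T => `|\1_O x - g m x|).
  apply: (measurableT_comp (@normr_measurable R setT)).
  apply: measurable_funB; first exact: measurable_indic.
  exact: (lip_class_meas (gl m)).
have [m hm] : exists m, (\int[mu]_(x in K) (`|\1_O x - g m x|)%:E <= e%:E)%E.
  apply: (@dominated_small _ T R mu K mK (fun m x => `|\1_O x - g m x|) (cst 1) e e0 mh).
  - move=> m x _; rewrite normr_ge0/= ler_norml indicE.
    by have := g0 m x; have := g1 m x; case: (x \in O) => /=; lra.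
  - move=> x _; apply: cvg_near_cst.
    rewrite indicE; case: (boolP (x \in (O : set T))) => [/set_mem[k _ /slab_gt0P kx]|xO].
      near=> m.
      rewrite /g min_l ?subrr ?normr0//.
      have km : (k < m)%N by near: m; exists k.+1.
      have h : 1 <= m%:R * slab (a k) (b k) x.
        rewrite -ler_pdivrMr// div1r ltW//.
        by near: m; exact: nbhs_infty_gtr.
      rewrite (le_trans h)// ler_wpM2l// /S (bigD1 (Ordinal km))//= lerDl.
      by apply: sumr_ge0 => j _; exact: slab_ge0.
    apply: nearW => m; rewrite /g [S m x]big1 ?mulr0 ?min_r ?subrr ?normr0//.
    move=> k _; apply/eqP; rewrite eq_le slab_ge0 andbT leNgt.
    apply: contra xO => /slab_gt0P kx; apply/mem_set; by exists k.
  - apply: measurable_bounded_integrable => //; exact: bounded_cst.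
by exists (g m); [exact: gl|exact: hm].
Unshelve. all: by end_near. Qed.

Lemma L1_approx_indic (E : set T) : measurable E -> E `<=` K ->
  L1_approx mu K lip_class \1_E.
Proof.
move=> mE EK.
apply: (@L1_approx_limit _ T R mu K mK lip_class lip_class_meas) => [|e e0].
  exact: (@measurable_indic _ T R K E mE).
have Efin : (mu E < +oo)%E by rewrite (le_lt_trans _ Kfin)// le_measure ?inE.
have [a [b /= [EO muO]]] := open_box_cover Efin e0.
set O := \bigcup_k _ in EO muO.
have mO : measurable (O : set T).
  apply: bigcupT_measurable => k; exact/open_measurable_Rn/open_box_open.
exists (\1_O : T -> R).
  by split; [exact: measurable_indic|exact: L1_approx_open].
have Efn : mu E \is a fin_num by rewrite ge0_fin_numE// measure_ge0.
pose W : set T := O `\` E.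
have mW : measurable W by exact: measurableD.
have We : (mu W <= e%:E)%E.
  have : (mu W + mu (O `&` E) <= mu E + e%:E)%E.
    by rewrite -(measureDI mu mO mE); exact: muO.
  by rewrite (setIidr EO) addeC leeD2lE.
rewrite (_ : (\int[mu]_(x in K) _)%E = (\int[mu]_(x in K) (\1_W x)%:E)%E).
  by rewrite integral_indic// (le_trans _ We)// le_measure ?inE//; exact: measurableI.
apply: eq_integral => x _; congr EFin; rewrite !indicE /W in_setD.
case: (boolP (x \in E)) => [/set_mem xE|xE]; last by rewrite sub0r normrN andbT ger0_norm.
by rewrite mem_set ?subrr ?normr0//; exact: EO.
Qed.

Lemma lipschitz_dense (f : T -> R) (q : nat) (e : R) : measurable_fun K f ->
  (\int[mu]_(x in K) (`|f x| ^+ q.+1)%:E < +oo)%E -> 0 < e ->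
  exists2 g : V -> R, lipschitz_fun g &
    (\int[mu]_(x in K) (`|f x - g x| ^+ q.+1)%:E <= e%:E)%E.
Proof.
move=> mf fq e0; apply: (@Lq_approx _ T R mu K mK Kfin lip_class) => //.
- exact: lip_class_meas.
- by move=> c; exact: lipschitz_cst.
- by move=> u v; exact: lipschitzD.
- by move=> c u; exact: lipschitzZ.
- by move=> u v; exact: lipschitz_min.
- by move=> u v; exact: lipschitz_max.
- exact: L1_approx_indic.
Qed.

End lipschitz_density.

(** * Integral inequalities *)

Section integral_inequalities.
Context d (T : measurableType d) (R : realType).
Variable mu : {measure set T -> \bar R}.
Implicit Types (D Q : set T) (f b : T -> R).

Lemma integrable_mul_bounded D b f C : measurable D -> measurable_fun D b ->
  (forall x, D x -> `|b x| <= C) -> mu.-integrable D (EFin \o f) ->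
  mu.-integrable D (EFin \o (fun x => b x * f x)).
Proof.
move=> mD mb bC intf.
have : [bounded b x | x in D].
  exists C; split; first exact: num_real.
  by move=> x Cx y Dy; rewrite /= (le_trans (bC _ Dy))// ltW.
by move=> h; have := integrableMr mD mb h intf.
Qed.

Lemma integrable_bounded D b C : measurable D -> (mu D < +oo)%E ->
  measurable_fun D b -> (forall x, D x -> `|b x| <= C) ->
  mu.-integrable D (EFin \o b).
Proof.
move=> mD Dfin mb bC; apply: measurable_bounded_integrable => //.
by exists C; split; [exact: num_real|move=> x x1 y Dy; rewrite /= (le_trans (bC _ Dy))// ltW].
Qed.

Lemma normr_Rintegral_le D f g : measurable D -> mu.-integrable D (EFin \o f) ->
  mu.-integrable D (EFin \o g) -> (forall x, D x -> `|f x| <= g x) ->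
  `|\int[mu]_(x in D) f x| <= \int[mu]_(x in D) g x.
Proof.
move=> mD fi gi fg; apply: (le_trans (le_normr_Rintegral mD fi)).
by apply: le_Rintegral => //; exact: (integrable_abse fi).
Qed.

Lemma integrable_cst_fin D c : measurable D -> (mu D < +oo)%E ->
  mu.-integrable D (EFin \o (fun=> c)).
Proof.
by move=> mD Dfin; apply: measurable_bounded_integrable => //; exact: bounded_cst.
Qed.

Lemma integrable_subc D f c : measurable D -> (mu D < +oo)%E ->
  mu.-integrable D (EFin \o f) -> mu.-integrable D (EFin \o (fun x => f x - c)).
Proof.
move=> mD Dfin fi.
exact: (integrableB mD fi (integrable_cst_fin c mD Dfin)).
Qed.

Lemma integrable_normr D f : mu.-integrable D (EFin \o f) ->
  mu.-integrable D (EFin \o (fun x => `|f x|)).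
Proof. by move=> /integrable_abse. Qed.

Lemma Rintegral_restrict0 D Q f : measurable D -> measurable Q -> Q `<=` D ->
  (forall x, D x -> ~ Q x -> f x = 0) ->
  \int[mu]_(x in D) f x = \int[mu]_(x in Q) f x.
Proof.
move=> mD mQ QD f0; rewrite [RHS]Rintegral_mkcond [LHS]Rintegral_mkcond.
congr Rintegral; apply/funext => x; rewrite /patch.
case: ifPn => [/set_mem Dx|xD]; case: ifPn => [/set_mem Qx|xQ] //.
- by apply: f0 => //; rewrite notin_setE in xQ.
- by move/negP: xD; case; apply/mem_set/QD.
Qed.

Lemma measurable_distX D f (g : T -> R) (c : R) (p : nat) : measurable_fun D f -> measurable_fun D g ->
  measurable_fun D (fun x => (`|f x - g x| ^+ p + c)%:E).
Proof.
move=> mf mg; apply/measurable_EFinP; apply: measurable_funD => //.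
apply: measurable_funX; apply: measurableT_comp => //.
exact: measurable_funB.
Qed.

(** Subtracting a constant commutes with averaging against the probability
    density [m^-1 * b]. *)
Lemma average_sub D b f (m c : R) : measurable D -> (mu D < +oo)%E ->
  measurable_fun D b -> (forall x, D x -> 0 <= b x <= 1) ->
  mu.-integrable D (EFin \o f) -> 0 < m -> \int[mu]_(x in D) b x = m ->
  mu.-integrable D (EFin \o (fun x => b x * (f x - c))) /\
  `|m^-1 * \int[mu]_(x in D) (b x * f x) - c| =
    m^-1 * `|\int[mu]_(x in D) (b x * (f x - c))|.
Proof.
move=> mD Dfin mb b01 fi m0 bm.
have bC x : D x -> `|b x| <= 1 by move=> /b01/andP[? ?]; rewrite ger0_norm.
have bi := integrable_bounded mD Dfin mb bC.
have bfi := integrable_mul_bounded mD mb bC fi.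
split; first exact: integrable_mul_bounded mD mb bC (integrable_subc c mD Dfin fi).
have -> : \int[mu]_(x in D) (b x * (f x - c)) =
    \int[mu]_(x in D) (b x * f x) - \int[mu]_(x in D) (b x * c).
  rewrite -RintegralB//; last first.
    exact: (integrable_mul_bounded mD mb bC (integrable_cst_fin c mD Dfin)).
  by congr Rintegral; apply/funext => x; rewrite mulrBr.
rewrite RintegralZr// bm -[X in X * `|_|]gtr0_norm ?invr_gt0// -normrM mulrBr mulrA.
by rewrite mulVf ?mul1r// gt_eqF.
Qed.

Lemma average_bound D Q b f (m c : R) : measurable D -> (mu D < +oo)%E ->
  measurable Q -> Q `<=` D -> measurable_fun D b ->
  (forall x, D x -> 0 <= b x <= 1) -> (forall x, D x -> ~ Q x -> b x = 0) ->
  mu.-integrable D (EFin \o f) -> 0 < m -> \int[mu]_(x in D) b x = m ->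
  `|m^-1 * \int[mu]_(x in D) (b x * f x) - c| <=
    m^-1 * \int[mu]_(x in Q) `|f x - c|.
Proof.
move=> mD Dfin mQ QD mb b01 bQ fi m0 bm.
have [bfci ->] := average_sub c mD Dfin mb b01 fi m0 bm.
apply: ler_wpM2l; first by rewrite invr_ge0 ltW.
rewrite (Rintegral_restrict0 mD mQ QD) => [|x Dx Qx]; last by rewrite bQ ?mul0r.
apply: normr_Rintegral_le => //.
- exact: integrableS bfci.
- by apply: integrable_normr; exact: integrableS (integrable_subc c mD Dfin fi).
- move=> x /QD /b01/andP[b0 b1]; rewrite normrM ler_piMl// ger0_norm//.
Qed.

Lemma sum_integral_indic (I : finType) (P : pred I) (Q : I -> set T) D (F : T -> R) :
  measurable D -> (forall k, P k -> measurable (Q k) /\ Q k `<=` D) ->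
  (forall x, D x -> 0 <= F x) -> measurable_fun D F ->
  measurable_fun D (fun x => ((\sum_(k | P k) \1_(Q k) x) * F x)%:E) /\
  (\sum_(k | P k) \int[mu]_(x in Q k) (F x)%:E =
   \int[mu]_(x in D) ((\sum_(k | P k) \1_(Q k) x) * F x)%:E)%E.
Proof.
move=> mD QD F0 mF.
have mFE : measurable_fun D (EFin \o F) by exact/measurable_EFinP.
pose s := [seq k <- index_enum I | P k].
pose G k x : \bar R := if P k then ((\1_(Q k) x)%:E * (F x)%:E)%E else 0%E.
have G0 k x : D x -> (0 <= G k x)%E.
  by move=> Dx; rewrite /G; case: ifP => // _; rewrite mule_ge0// ?lee_fin ?F0.
have mG k : measurable_fun D (G k).
  rewrite /G; have [Pk|_] := boolP (P k); last exact: measurable_cst.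
  have [mQ _] := QD k Pk.
  by apply: emeasurable_funM => //; apply/measurable_EFinP; exact: measurable_indic.
have GE : (fun x => ((\sum_(k | P k) \1_(Q k) x) * F x)%:E) = fun x => (\sum_(k <- s) G k x)%E.
  apply/funext => x; rewrite big_filter mulr_suml -sumEFin.
  by apply: eq_bigr => k Pk; rewrite /G Pk.
rewrite GE; split; first by apply: emeasurable_sum => k; exact: mG.
rewrite ge0_integral_sum// big_filter; apply: eq_bigr => k Pk; have [mQ QDk] := QD k Pk.
rewrite -[in LHS](setIidr QDk) integral_mkcondr; apply: eq_integral => x _.
by rewrite /G Pk /patch indicE; case: (x \in Q k); rewrite ?mul1e ?mul0e.
Qed.

Lemma overlap_sum (I : finType) (P : pred I) (Q : I -> set T) D (F : T -> R) (M : R) :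
  measurable D -> (forall k, P k -> measurable (Q k) /\ Q k `<=` D) ->
  (forall x, D x -> 0 <= F x) -> measurable_fun D F ->
  0 <= M ->
  (forall x, D x -> \sum_(k | P k) (\1_(Q k) x : R) <= M) ->
  (\sum_(k | P k) \int[mu]_(x in Q k) (F x)%:E <= M%:E * \int[mu]_(x in D) (F x)%:E)%E.
Proof.
move=> mD QD F0 mF M0 QM.
have mFE : measurable_fun D (EFin \o F) by exact/measurable_EFinP.
have FE0 x : D x -> (0 <= (F x)%:E)%E by move=> Dx; rewrite lee_fin F0.
rewrite -ge0_integralZl//; have [mS ->] := sum_integral_indic mD QD F0 mF.
apply: ge0_le_integral => //.
- by move=> x Dx; rewrite lee_fin mulr_ge0 ?F0// sumr_ge0.
- by apply: emeasurable_funM => //; exact: measurable_cst.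
by move=> x Dx; rewrite -EFinM lee_fin ler_wpM2r ?F0// QM.
Qed.

(** On each piece [f - c k] is the sum of [f - g] and [g - c k]; the power of
    the sum is split between them, and the pieces overlap at most [M] times. *)
Lemma local_constants_bound (I : finType) (P : pred I) (W : I -> set T) D f (g : T -> R)
    (c : I -> R) (q : nat) (M s : R) :
  measurable D -> measurable_fun D f -> measurable_fun D g ->
  (forall k, P k -> measurable (W k) /\ W k `<=` D) -> 0 <= M -> 0 <= s ->
  (forall x, D x -> \sum_(k | P k) (\1_(W k) x : R) <= M) ->
  (forall k x, P k -> W k x -> `|g x - c k| <= s) ->
  (\sum_(k | P k) \int[mu]_(x in W k) (`|f x - c k| ^+ q.+1)%:E <=
   (M * 2 ^+ q.+1)%:E *
     (\int[mu]_(x in D) (`|f x - g x| ^+ q.+1)%:E + (s ^+ q.+1)%:E * mu D))%E.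
Proof.
move=> mD mf mg WD M0 s0 WM gs.
pose F x := 2 ^+ q.+1 * (`|f x - g x| ^+ q.+1 + s ^+ q.+1).
have mF0 : measurable_fun D (fun x => (`|f x - g x| ^+ q.+1 + s ^+ q.+1)%:E).
  exact: measurable_distX.
have F0 x : 0 <= F x by rewrite mulr_ge0 ?addr_ge0 ?exprn_ge0.
have mFE : measurable_fun D (fun x => (F x)%:E).
  rewrite (_ : (fun x => (F x)%:E) =
    (fun x => (2 ^+ q.+1)%:E * (`|f x - g x| ^+ q.+1 + s ^+ q.+1)%:E)%E)//.
  by apply: emeasurable_funM => //; exact: measurable_cst.
have mX (h : T -> R) : measurable_fun D h -> measurable_fun D (fun x => (`|f x - h x| ^+ q.+1)%:E).
  by move=> mh; have := measurable_distX 0 q.+1 mf mh; under eq_fun do rewrite addr0.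
apply: (@le_trans _ _ (\sum_(k | P k) \int[mu]_(x in W k) (F x)%:E)%E).
  apply: lee_sum => k Pk; have [mW WDk] := WD k Pk.
  apply: ge0_le_integral => //.
  - by apply: measurable_funS WDk (mX _ _) => //; exact: measurable_cst.
  - exact: measurable_funS WDk mFE.
  move=> x kx; rewrite lee_fin /F.
  apply: le_trans (exprD_le q.+1 (normr_ge0 _) s0).
  rewrite lerXn2r ?nnegrE ?addr_ge0// -(subrKA (g x)).
  by rewrite (le_trans (ler_normD _ _))// lerD2l gs.
apply: le_trans (overlap_sum mD WD _ _ M0 WM) _ => //; first exact/measurable_EFinP.
rewrite EFinM -muleA; apply: lee_wpmul2l; first by rewrite lee_fin.
under eq_integral do rewrite EFinM.
rewrite ge0_integralZl//; last by move=> x _; rewrite lee_fin addr_ge0 ?exprn_ge0.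
under eq_integral do rewrite EFinD.
rewrite ge0_integralD//; last 2 first.
- exact: mX.
- by move=> x _; rewrite lee_fin exprn_ge0.
by rewrite integral_cst.
Qed.

(** Jensen's inequality up to a constant. For every [s > 0] one has
    [f <= s + s ^- p * f ^+ p.+1]; integrating, it remains to choose [s] as half
    the mean value of [f]. *)
Lemma power_mean Q f (p : nat) : measurable Q -> (mu Q < +oo)%E -> 0 < fine (mu Q) ->
  mu.-integrable Q (EFin \o f) -> (forall x, Q x -> 0 <= f x) ->
  mu.-integrable Q (EFin \o (fun x => f x ^+ p.+1)) ->
  (\int[mu]_(x in Q) f x) ^+ p.+1 <=
    2 ^+ p.+1 * fine (mu Q) ^+ p * \int[mu]_(x in Q) (f x ^+ p.+1).
Proof.
move=> mQ Qfin m0 fi f0 fpi.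
set X := \int[mu]_(x in Q) f x; set Y := \int[mu]_(x in Q) (f x ^+ p.+1).
set m := fine (mu Q) in m0 *.
have X0 : 0 <= X by exact: Rintegral_ge0.
have Y0 : 0 <= Y by apply: Rintegral_ge0 => x Qx; rewrite exprn_ge0// f0.
have H (s : R) : 0 < s -> X <= s * m + s ^- p * Y.
  move=> s0.
  have sfi : mu.-integrable Q (EFin \o (fun x => s ^- p * f x ^+ p.+1)).
    exact: (@integrable_mul_bounded Q (fun=> s ^- p) _ `|s ^- p| mQ
      (measurable_cst _) (fun x _ => lexx _) fpi).
  have -> : s * m + s ^- p * Y = \int[mu]_(x in Q) (s + s ^- p * f x ^+ p.+1).
    rewrite (_ : (fun x => _) = (fun=> s) \+ (fun x => s ^- p * f x ^+ p.+1))//.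
    rewrite RintegralD//; last exact: integrable_cst_fin.
    by rewrite Rintegral_cst// RintegralZl.
  apply: le_Rintegral => //.
    exact: (integrableD mQ (integrable_cst_fin s mQ Qfin) sfi).
  move=> x Qx /=; have [fs|sf] := leP (f x) s.
    by rewrite (le_trans fs)// lerDl mulr_ge0 ?invr_ge0 ?exprn_ge0 ?f0// ltW.
  apply: (@le_trans _ _ (s ^- p * f x ^+ p.+1)); last by rewrite lerDr ltW.
  rewrite exprS mulrCA ler_peMr ?f0// mulrC -exprVn -exprMn exprn_ege1//.
  by rewrite ler_pdivlMr// mul1r ltW.
have [X00|Xn0] := eqVneq X 0.
  by rewrite X00 expr0n /= mulr_ge0// mulr_ge0 ?exprn_ge0// ltW.
have Xp : 0 < X by rewrite lt_def Xn0.
have s0 : 0 < X / (2 * m) by rewrite divr_gt0// mulr_gt0.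
have := H _ s0.
rewrite (_ : X / (2 * m) * m = X / 2); last by field; rewrite gt_eqF.
rewrite -lerBlDl (_ : X - X / 2 = X / 2); last by field.
rewrite expr_div_n invf_div => h.
have {h} : X / 2 * X ^+ p <= (2 * m) ^+ p * Y.
  by rewrite -ler_pdivlMr ?exprn_gt0// mulrAC.
rewrite mulrAC -exprS ler_pdivrMr//.
rewrite (_ : 2 ^+ p.+1 * m ^+ p * Y = (2 * m) ^+ p * Y * 2)//.
by rewrite exprMn exprS; ring.
Qed.

Lemma EFin_Rintegral D f : measurable D -> mu.-integrable D (EFin \o f) ->
  (\int[mu]_(x in D) f x)%:E = (\int[mu]_(x in D) (f x)%:E)%E.
Proof. by move=> mD fi; rewrite /Rintegral fineK//; exact: integrable_fin_num. Qed.

Lemma cover_sum (I : finType) (P : pred I) (Q : I -> set T) (K : set T) D (F : T -> R) :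
  measurable K -> measurable D -> K `<=` D ->
  (forall k, P k -> measurable (Q k) /\ Q k `<=` D) ->
  (forall x, D x -> 0 <= F x) -> measurable_fun D F ->
  (forall x, K x -> exists k, P k /\ Q k x) ->
  (\int[mu]_(x in K) (F x)%:E <= \sum_(k | P k) \int[mu]_(x in Q k) (F x)%:E)%E.
Proof.
move=> mK mD KD QD F0 mF cov.
have mFE : measurable_fun D (EFin \o F) by exact/measurable_EFinP.
have [mS ->] := sum_integral_indic mD QD F0 mF.
have S0 x : D x -> (0 <= ((\sum_(k | P k) \1_(Q k) x) * F x)%:E)%E.
  by move=> Dx; rewrite lee_fin mulr_ge0 ?F0// sumr_ge0.
apply: (@le_trans _ _ (\int[mu]_(x in K) ((\sum_(k | P k) \1_(Q k) x) * F x)%:E)%E); last first.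
  exact: ge0_subset_integral.
apply: ge0_le_integral => //.
- by move=> x /KD Dx; rewrite lee_fin F0.
- exact: measurable_funS mFE.
- exact: measurable_funS mS.
move=> x Kx; have [k [Pk Qk]] := cov x Kx.
rewrite lee_fin ler_peMl ?F0//; first exact: KD.
by rewrite (bigD1 k)//= indicE mem_set// lerDl sumr_ge0.
Qed.

(** A constant controlled by the mean oscillation of [f] can be absorbed, so that
    [f] itself is controlled by its oscillation. *)
Lemma norm_le_oscillation (A W : set T) f (c t : R) : measurable A -> measurable W ->
  A `<=` W -> (mu W < +oo)%E -> mu.-integrable W (EFin \o f) -> 0 <= t ->
  `|c| <= t * \int[mu]_(x in W) `|f x - c| ->
  (\int[mu]_(x in A) (`|f x|)%:E <=
   (1 + t * fine (mu A))%:E * \int[mu]_(x in W) (`|f x - c|)%:E)%E.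
Proof.
move=> mA mW AW Wfin fi t0 ct.
have Afin : (mu A < +oo)%E by rewrite (le_lt_trans _ Wfin)// le_measure ?inE.
have fci := integrable_normr (integrable_subc c mW Wfin fi).
have fAi := integrableS mW mA AW fi.
have fcAi := integrableS mW mA AW fci.
rewrite -(EFin_Rintegral mA (integrable_normr fAi)) -(EFin_Rintegral mW fci).
rewrite -EFinM lee_fin.
set Y := \int[mu]_(x in W) `|f x - c| in ct *.
apply: (@le_trans _ _ (\int[mu]_(x in A) (`|f x - c| + `|c|))).
  apply: le_Rintegral => //; first exact: (integrable_normr fAi).
    exact: (integrableD mA fcAi (integrable_cst_fin `|c| mA Afin)).
  by move=> x _; rewrite -{1}(subrK c (f x)) ler_normD.
rewrite RintegralD//; last exact: integrable_cst_fin.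
rewrite Rintegral_cst// mulrDl mul1r; apply: lerD.
  rewrite -lee_fin (EFin_Rintegral mA fcAi) (EFin_Rintegral mW fci).
  apply: ge0_subset_integral => //.
  by have [] := integrableP _ _ _ fci.
by rewrite mulrAC ler_wpM2r// fine_ge0.
Qed.

Lemma Rintegral_ge_cst Q D b (c : R) : measurable Q -> measurable D -> Q `<=` D ->
  mu.-integrable D (EFin \o b) -> 0 <= c -> (forall x, D x -> 0 <= b x) ->
  (forall x, Q x -> c <= b x) -> (mu Q < +oo)%E ->
  c * fine (mu Q) <= \int[mu]_(x in D) b x.
Proof.
move=> mQ mD QD bi c0 b0 cb Qfin.
have bQi := integrableS mD mQ QD bi.
rewrite -Rintegral_cst//; apply: (@le_trans _ _ (\int[mu]_(x in Q) b x)).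
  by apply: le_Rintegral => //; exact: integrable_cst_fin.
rewrite -lee_fin (EFin_Rintegral mD bi) (EFin_Rintegral mQ bQi).
apply: ge0_subset_integral => //; by have [] := integrableP _ _ _ bi.
Qed.

Lemma ae_cst_le_Rintegral (W : set T) (F : T -> R) (c : R) : measurable W ->
  (mu W < +oo)%E -> mu.-integrable W (EFin \o F) -> 0 <= c ->
  (forall x, W x -> 0 <= F x) -> {ae mu, forall x, W x -> c <= F x} ->
  c * fine (mu W) <= \int[mu]_(x in W) F x.
Proof.
move=> mW Wfin Fi c0 F0 cF.
rewrite -Rintegral_cst// -lee_fin (EFin_Rintegral mW Fi) EFin_Rintegral//; last first.
  exact: integrable_cst_fin.
apply: ae_ge0_le_integral => //.
  by have [] := integrableP _ _ _ Fi.
Qed.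

End integral_inequalities.

(** * Grids of cells *)

Section grid.
Variables (R : realType) (n : nat).
Local Notation V := 'rV[R]_n.+1.
Local Notation mu := (lebesgueRn R n).

Definition mesh (B : R) (N : nat) : R := 2 * B / N%:R.

Definition corner (B : R) (N : nat) (k : {ffun 'I_n.+1 -> 'I_N}) : V :=
  \row_i (- B + mesh B N * (k i)%:R).

Definition cell B N (k : {ffun 'I_n.+1 -> 'I_N}) : set V :=
  box (corner B k, corner B k + const_mx (mesh B N)).

(** The cell together with its neighbours: it contains every cutoff of radius
    [mesh B N] centred in the cell, while the overlap of these boxes does not
    depend on the mesh. *)
Definition wide_cell B N (k : {ffun 'I_n.+1 -> 'I_N}) : set V :=
  box (corner B k - const_mx (mesh B N), corner B k + const_mx (2 * mesh B N)).

Lemma mesh_gt0 B N : 0 < B -> (0 < N)%N -> 0 < mesh B N.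
Proof. by move=> B0 N0; rewrite divr_gt0 ?mulr_gt0// ltr0n. Qed.

Lemma cell_index (B t : R) N : 0 < B -> (0 < N)%N -> `|t| < B ->
  exists j : 'I_N, - B + mesh B N * j%:R < t <= - B + mesh B N * j%:R + mesh B N.
Proof.
move=> B0 N0; rewrite ltr_norml => /andP[t1 t2].
have h0 := mesh_gt0 B0 N0; set h := mesh B N in h0 *.
have hN : h * N%:R = 2 * B by rewrite /h /mesh divfK// pnatr_eq0 -lt0n.
have ex : exists m : nat, t <= - B + h * m%:R by exists N; rewrite hN; lra.
have := ex_minnP ex; case: ex_minnP => m tm m_min _.
have m0 : (0 < m)%N.
  by case: m tm {m_min} => // ; rewrite mulr0 addr0 => /(lt_le_trans t1); rewrite ltxx.
have mN : (m <= N)%N by apply: m_min; rewrite hN; lra.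
have m1N : (m.-1 < N)%N by rewrite (leq_trans _ mN)// prednK.
exists (Ordinal m1N) => /=; apply/andP; split.
  rewrite ltNge; apply/negP => /m_min; by rewrite -ltnS prednK ?ltnn.
by rewrite -addrA -[X in _ + (_ + X)]mulr1 -mulrDr natr1 prednK.
Qed.

Lemma cell_cover (B : R) N x : 0 < B -> (0 < N)%N -> `|x| < B -> exists k, @cell B N k x.
Proof.
move=> B0 N0 /norm_rV_ltP xB.
have /choice[k kP] := fun i => cell_index B0 N0 (xB i).
by exists (finfun k) => i; rewrite !mxE ffunE.
Qed.

Lemma wide_cell_near B N k x y : 0 < mesh B N ->
  @cell B N k x -> @wide_cell B N k y -> `|y - x| <= 2 * mesh B N.
Proof.
set h := mesh B N => h0 kx ky; apply/norm_rV_leP => i; have := kx i; have := ky i.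
by rewrite /= !mxE -/h ler_norml => /andP[? ?] /andP[? ?]; apply/andP; split; lra.
Qed.

Lemma wide_cell_ball B N k x y : 0 < mesh B N ->
  @cell B N k x -> `|y - x| < mesh B N -> @wide_cell B N k y.
Proof.
set h := mesh B N => h0 kx /norm_rV_ltP xy i; have := kx i; have := xy i.
by rewrite /= !mxE -/h ltr_norml => /andP[? ?] /andP[? ?]; apply/andP; split; lra.
Qed.

Lemma wide_cell_corner B N k y : 0 < mesh B N ->
  @wide_cell B N k y -> `|y - corner B k| <= 2 * mesh B N.
Proof.
set h := mesh B N => h0 ky; apply/norm_rV_leP => i; have := ky i.
by rewrite /= !mxE -/h ler_norml => /andP[? ?]; apply/andP; split; lra.
Qed.

Lemma cell_dist B N k x y : 0 < mesh B N ->
  @cell B N k x -> @cell B N k y -> `|y - x| <= mesh B N.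
Proof.
set h := mesh B N => h0 kx ky; apply/norm_rV_leP => i; have := kx i; have := ky i.
by rewrite /= !mxE -/h ler_norml => /andP[? ?] /andP[? ?]; apply/andP; split; lra.
Qed.

Lemma cell_convex B N k x y (t : R) : 0 <= t <= 1 ->
  @cell B N k x -> @cell B N k y -> @cell B N k (x + t *: (y - x)).
Proof.
move=> /andP[t0 t1] kx ky i; have := kx i; have := ky i; rewrite /= !mxE.
set u := - B + _; set a := x 0 i; set b := y 0 i => /andP[h1 h2] /andP[h3 h4].
apply/andP; split.
  have [t2|t2] := ltP t 1.
    have : 0 < (1 - t) * (a - u) by rewrite mulr_gt0// subr_gt0.
    have : 0 <= t * (b - u) by rewrite mulr_ge0// subr_ge0 ltW.
    by lra.
  by have -> : t = 1 by [apply/eqP; rewrite eq_le t1]; rewrite mul1r subrKC.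
have : 0 <= (1 - t) * (u + mesh B N - a) by rewrite mulr_ge0// subr_ge0.
have : 0 <= t * (u + mesh B N - b) by rewrite mulr_ge0// subr_ge0.
by lra.
Qed.

Lemma cell_sub_wide B N k : 0 < mesh B N -> @cell B N k `<=` @wide_cell B N k.
Proof. by move=> h0 x kx; apply: (wide_cell_ball h0 kx); rewrite subrr normr0. Qed.

Lemma mu_cell B N k : 0 < mesh B N -> mu (@cell B N k) = (mesh B N ^+ n.+1)%:E.
Proof.
move=> h0; rewrite mu_box /box_volume (eq_bigr (fun=> mesh B N)) ?prodr_const ?card_ord//.
by move=> i _; rewrite !mxE max_r; lra.
Qed.

Lemma mu_wide_cell B N k : 0 < mesh B N -> mu (@wide_cell B N k) = ((3 * mesh B N) ^+ n.+1)%:E.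
Proof.
move=> h0; rewrite mu_box /box_volume (eq_bigr (fun=> 3 * mesh B N)) ?prodr_const ?card_ord//.
by move=> i _; rewrite !mxE max_r; lra.
Qed.

(** The least index counted is followed by at most two more. *)
Lemma overlap_index (z : R) N : \sum_(j < N) (j%:R - 1 < z <= j%:R + 2)%R%:R <= 3 :> R.
Proof.
pose P (j : nat) := (j%:R - 1 < z <= j%:R + 2)%R.
have [ex|nex] := pselect (exists j, P j); last first.
  rewrite big1 => [|j _]; first by [].
  by rewrite -/(P j); have /negPf -> : ~~ P j by apply/negP => Pj; case: nex; exists j.
case: (ex_minnP ex) => j0 Pj0 j0_min.
apply: (@le_trans _ _ (\sum_(j < N) \sum_(e < 3) (j == j0 + e :> nat)%N%:R)).
  apply: ler_sum => j _; rewrite -/(P j); case: (boolP (P j)) => [Pj|_]; last exact: sumr_ge0.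
  have jj0 := j0_min _ Pj.
  have j3 : (j - j0 < 3)%N.
    rewrite ltn_subLR// -(ltr_nat R) natrD; move: Pj Pj0; rewrite /P; lra.
  rewrite (bigD1 (Ordinal j3))//= subnKC// eqxx lerDl; exact: sumr_ge0.
rewrite exchange_big /=.
apply: (@le_trans _ _ (\sum_(e < 3) 1)); last by rewrite sumr_const card_ord.
apply: ler_sum => e _; have [je|je] := ltnP (j0 + e) N; last first.
  rewrite big1// => j _; case: eqP => // jE; have := ltn_ord j.
  by rewrite jE ltnNge je.
rewrite (bigD1 (Ordinal je))//= eqxx big1 ?addr0// => j /eqP jj.
by case: eqP => // jE; case: jj; exact: val_inj.
Qed.

Lemma wide_cell_overlap B N (y : V) : 0 < mesh B N ->
  \sum_k (\1_(@wide_cell B N k) y : R) <= 3 ^+ n.+1.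
Proof.
move=> h0; set h := mesh B N in h0.
pose F (i : 'I_n.+1) (j : 'I_N) : R := (j%:R - 1 < (y 0 i + B) / h <= j%:R + 2)%R%:R.
apply: (@le_trans _ _ (\sum_(k : {ffun 'I_n.+1 -> 'I_N}) \prod_i F i (k i))).
  apply: ler_sum => k _; rewrite indicE.
  case: (boolP (y \in _)) => [/set_mem ky|_]; last by apply: prodr_ge0.
  rewrite big1// => i _; have := ky i; rewrite /= !mxE -/h /F.
  rewrite ltr_pdivlMr// ler_pdivrMr// => /andP[y1 y2].
  by rewrite (_ : (_ < _ <= _) = true)//; apply/andP; split; lra.
rewrite -(bigA_distr_bigA F).
apply: (@le_trans _ _ (\prod_(i < n.+1) 3)); last by rewrite prodr_const card_ord.
apply: ler_prod => i _; rewrite /F overlap_index andbT; exact: sumr_ge0.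
Qed.

End grid.

Section grid_oscillation.
Variables (R : realType) (n : nat).
Local Notation T := (lebesgue_space R n).
Local Notation mu := (lebesgueRn R n).

Lemma measurable_wide_cell B N k : measurable (@wide_cell R n B N k : set T).
Proof. exact: measurable_box. Qed.

Lemma measurable_cell B N k : measurable (@cell R n B N k : set T).
Proof. exact: measurable_box. Qed.

(** Local constants approximate an [L^q] function well in the mean: replace it
    by a Lipschitz function, which hardly varies on a cell of a fine grid. *)
Lemma grid_oscillation (K : set T) (f : T -> R) (q : nat) (B e : R) :
  measurable K -> (mu K < +oo)%E -> measurable_fun K f ->
  (\int[mu]_(x in K) (`|f x| ^+ q.+1)%:E < +oo)%E -> 0 < B -> 0 < e ->
  exists N0, forall N, (N0 <= N)%N -> (0 < N)%N ->
    exists c : {ffun 'I_n.+1 -> 'I_N} -> R,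
    (\sum_(k | `[< @wide_cell R n B N k `<=` K >])
      \int[mu]_(x in @wide_cell R n B N k) (`|f x - c k| ^+ q.+1)%:E <= e%:E)%E.
Proof.
move=> mK Kfin mf fq B0 e0.
pose a : R := 3 ^+ n.+1 * 2 ^+ q.+1.
have a0 : 0 < a by rewrite mulr_gt0// exprn_gt0.
pose e' := e / (2 * a).
have e'0 : 0 < e' by rewrite divr_gt0// mulr_gt0.
have [g gl fg] := lipschitz_dense mK Kfin mf fq e'0.
have mg : measurable_fun K (g : T -> R) by exact: lip_class_meas.
have [L L0 gL] := gl.
pose m := fine (mu K).
have m0 : 0 <= m by rewrite fine_ge0.
have mE : mu K = m%:E by rewrite fineK// ge0_fin_numE.
exists (Num.truncn (4 * L * B + 4 * L * B * m / e')).+1 => N NN N0.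
have h0 := mesh_gt0 B0 N0; set h := mesh B N in h0 *.
have hN : h * N%:R = 2 * B by rewrite /h /mesh divfK// pnatr_eq0 -lt0n.
have NR : 4 * L * B + 4 * L * B * m / e' <= N%:R.
  apply: le_trans (ltW (truncnS_gt _)) _; by rewrite ler_nat.
pose s := L * (2 * h).
have s0 : 0 <= s by rewrite mulr_ge0// mulr_ge0// ltW.
have LB0 : 0 <= 4 * L * B by rewrite !mulr_ge0// ltW.
have sN : s * N%:R = 4 * L * B by transitivity (L * 2 * (h * N%:R)); [rewrite /s; ring|rewrite hN; ring].
have N0R : 0 < N%:R :> R by rewrite ltr0n.
have s1 : s <= 1.
  rewrite -(ler_pM2r N0R) sN mul1r (le_trans _ NR)// lerDl.
  by apply: divr_ge0; [exact: mulr_ge0|exact: ltW].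
have sm : s * m <= e'.
  have : 4 * L * B * m / e' <= N%:R by rewrite (le_trans _ NR)// lerDr.
  by rewrite ler_pdivrMr// => h1; rewrite -(ler_pM2r N0R) mulrAC sN [leRHS]mulrC.
exists (fun k => g (corner B k)).
apply: le_trans (@local_constants_bound _ T R mu _ _ _ K f g _ q (3 ^+ n.+1) s
  mK mf mg _ _ s0 _ _) _.
- move=> k /asboolP kK; split; [exact: measurable_wide_cell|exact: kK].
- exact: exprn_ge0.
- move=> x _; apply: le_trans (wide_cell_overlap x h0).
  rewrite big_mkcond /=; apply: ler_sum => k _; case: ifP => // _.
- move=> k x _ kx; rewrite (le_trans (gL _ _))//.
  by rewrite ler_wpM2l// wide_cell_corner.
rewrite mE -/a.
apply: (@le_trans _ _ (a%:E * (e'%:E + e'%:E))%E).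
  apply: lee_wpmul2l; first by rewrite lee_fin ltW.
  apply: leeD => //.
  rewrite -EFinM lee_fin (le_trans _ sm)// ler_wpM2r// exprS ler_piMr//.
  exact: exprn_ile1.
rewrite -EFinD -EFinM lee_fin /e' le_eqVlt; apply/orP; left; apply/eqP; field.
by rewrite gt_eqF.
Qed.

End grid_oscillation.

(** * Mollification *)

Section mollification.
Variables (R : realType) (n : nat).
Local Notation V := 'rV[R]_n.+1.
Local Notation T := (lebesgue_space R n).
Local Notation mu := (lebesgueRn R n).

Lemma measurable_beval (e : bexpr R n) (x : V) :
  measurable_fun setT ((fun y => beval e (x - y)) : T -> R).
Proof.
apply: continuous_measurable_Rn.
rewrite (_ : (fun y => _) = beval (breflect x e)); first exact: beval_continuous.
by apply/funext => y; rewrite beval_reflect.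
Qed.

Definition cutoff_mass (h : R) : R := \int[mu]_(y in [set: T]) beval (cutoff n h) y.

Lemma cutoff_integral (D : set T) (x : V) h : 0 < h -> measurable D ->
  (forall y : V, `|y - x| < h -> D y) ->
  \int[mu]_(y in D) beval (cutoff n h) (x - (y : V)) = cutoff_mass h.
Proof.
move=> h0 mD hD.
rewrite -(@Rintegral_restrict0 _ T R mu setT D _ measurableT mD (@subsetT _ _)); last first.
  move=> y _ nDy; apply/eqP/negP => /negP /(cutoff_support h0).
  by rewrite distrC => /hD.
rewrite /cutoff_mass /Rintegral; congr fine.
have mb : measurable_fun [set: T] (fun y : T => (beval (cutoff n h) (y : V))%:E).
  by apply/measurable_EFinP; apply: continuous_measurable_Rn; exact: beval_continuous.
have b0 (y : T) : (0 <= (beval (cutoff n h) (y : V))%:E)%E by rewrite lee_fin cutoff_ge0.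
rewrite -(integral_shift x mb b0).
by apply: eq_integral => y _; rewrite -cutoff_even opprB.
Qed.

Lemma cutoff_mass_ge h : 0 < h -> cutoff_floor R n * h ^+ n.+1 <= cutoff_mass h.
Proof.
move=> h0.
pose D : set V := [set y | forall i, (const_mx (- h) : V) 0 i <= y 0 i <= (const_mx h : V) 0 i].
have cD : compact D by exact: closed_box_compact.
have mD : measurable (D : set T) by exact: compact_measurable_Rn.
have Dfin : (mu D < +oo)%E by exact: mu_compact_lty.
pose Q : set V := box ((0 : V) - const_mx (h / 2), (0 : V) + const_mx (h / 2)).
have mQ : measurable (Q : set T) by exact: measurable_box.
have hh : h / 2 <= h by rewrite ler_pdivrMr// ler_peMr ?ler1n// ltW.
have QD : Q `<=` D.
  by move=> y Qy i; have := Qy i; rewrite /= !mxE => /andP[? ?]; apply/andP; split; lra.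
have muQ : mu Q = (h ^+ n.+1)%:E.
  by rewrite mu_cube ?divr_ge0 ?(ltW h0)//; congr (_ ^+ _)%:E; field.
rewrite -(@cutoff_integral (D : set T) 0 h)//; last first.
  move=> y; rewrite subr0 => /norm_rV_ltP yh i; have := yh i.
  by rewrite !mxE ltr_norml => /andP[? ?]; apply/andP; split; apply: ltW.
have bi : mu.-integrable (D : set T) (EFin \o (fun y : T => beval (cutoff n h) (0 - (y : V)))).
  apply: (@integrable_bounded _ T R mu D _ 1 mD Dfin).
    by apply: measurable_funTS; exact: measurable_beval.
  by move=> y _; rewrite ger0_norm ?cutoff_ge0// cutoff_le1.
have -> : h ^+ n.+1 = fine (mu Q) by rewrite muQ.
apply: (@Rintegral_ge_cst _ T R mu Q D _ _ mQ mD QD bi).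
- by rewrite ltW// cutoff_floor_gt0.
- by move=> y _; exact: cutoff_ge0.
- move=> y Qy; apply: cutoff_ge => //; rewrite sub0r normrN.
  apply/norm_rV_leP => i; have := Qy i; rewrite /= !mxE ler_norml.
  by move=> /andP[? ?]; apply/andP; split; lra.
- by rewrite muQ ltry.
Qed.

Lemma cutoff_mass_gt0 h : 0 < h -> 0 < cutoff_mass h.
Proof.
by move=> h0; rewrite (lt_le_trans _ (cutoff_mass_ge h0))// mulr_gt0 ?cutoff_floor_gt0 ?exprn_gt0.
Qed.

Definition mollify (D : set T) (f : T -> R) (h : R) (x : V) : R :=
  (cutoff_mass h)^-1 * \int[mu]_(y in D) (beval (cutoff n h) (x - (y : V)) * f y).

(** The kernel is centred in the cell, has the radius of the mesh and is therefore
    supported in the wide cell, where it is at most a multiple of the uniform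
    density. *)
Lemma mollify_oscillation (D : set T) (f : T -> R) B N k (x : V) (c : R) :
  measurable D -> (mu D < +oo)%E -> mu.-integrable D (EFin \o f) ->
  0 < mesh B N -> @cell R n B N k x -> @wide_cell R n B N k `<=` D ->
  `|mollify D f (mesh B N) x - c| <= (cutoff_floor R n * mesh B N ^+ n.+1)^-1 *
     \int[mu]_(y in @wide_cell R n B N k) `|f y - c|.
Proof.
move=> mD Dfin fi h0 kx WD.
have m0 := cutoff_mass_gt0 h0.
have mW := measurable_wide_cell B k.
have := @average_bound _ T R mu D (@wide_cell R n B N k)
  (fun y => beval (cutoff n (mesh B N)) (x - (y : V))) f (cutoff_mass (mesh B N)) c mD Dfin
  mW WD.
move=> /(_ _ _ _ fi m0 _) h; apply: le_trans (h _ _ _ _) _.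
- by apply: measurable_funTS; exact: measurable_beval.
- by move=> y _; rewrite cutoff_ge0 cutoff_le1.
- move=> y _ nWy; apply/eqP/negP => /negP /(cutoff_support h0).
  by rewrite distrC => /(wide_cell_ball h0 kx).
- by apply: cutoff_integral => // y /(wide_cell_ball h0 kx) /WD.
apply: ler_wpM2r; first exact: Rintegral_ge0.
rewrite lef_pV2 ?posrE ?cutoff_mass_ge// mulr_gt0 ?cutoff_floor_gt0//.
exact: exprn_gt0.
Qed.

End mollification.

(** * The fundamental lemma of the calculus of variations *)

Section uniqueness.
Variables (R : realType) (n : nat).
Local Notation V := 'rV[R]_n.+1.
Local Notation T := (lebesgue_space R n).
Local Notation mu := (lebesgueRn R n).

Lemma L1_loc_integrable (U K : set V) (f : V -> R) : Lp_loc 1%E U f ->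
  compact K -> K `<=` U -> mu.-integrable (K : set T) (EFin \o (f : T -> R)).
Proof.
move=> fU cK KU; have /Lfun1_integrable := fU K cK KU.
have mK : measurable (K : set T) by exact: compact_measurable_Rn.
by move=> h; apply/(integrable_mkcond _ mK); rewrite restrict_EFin.
Qed.

Lemma mesh_small (B del : R) : 0 < B -> 0 < del ->
  exists N1, forall N, (N1 <= N)%N -> (0 < N)%N /\ mesh B N <= del.
Proof.
move=> B0 d0; exists (Num.truncn (2 * B / del)).+1 => N NN.
have N0 : (0 < N)%N by exact: leq_trans NN.
split=> //; rewrite /mesh ler_pdivrMr ?ltr0n// [del * _]mulrC -ler_pdivrMr//.
by rewrite (le_trans (ltW (truncnS_gt _)))// ler_nat.
Qed.

Lemma wide_cell_sub (K K0 : set V) (h0 : R) B N k x :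
  (forall x y, K x -> `|y - x| <= h0 -> K0 y) -> 0 < mesh B N -> 2 * mesh B N <= h0 ->
  K x -> @cell R n B N k x -> @wide_cell R n B N k `<=` K0.
Proof.
move=> KK0 m0 mh Kx kx y ky; apply: (KK0 x) => //.
exact: le_trans (wide_cell_near m0 kx ky) mh.
Qed.

Lemma mollify_cutoff_eq (U D : set V) (f : V -> R) (g : V -> R) h (x : V) : 0 < h ->
  open U -> measurable (D : set T) -> D `<=` U -> (forall y, `|y - x| <= h -> D y) ->
  (forall y, g y != 0 -> `|y - x| <= h) ->
  \int[mu]_(y in (U : set T)) (f y * g y) = \int[mu]_(y in (D : set T)) (g y * f y).
Proof.
move=> h0 oU mD DU hD gh.
have mU : measurable (U : set T) by exact: open_measurable_Rn.
rewrite (@Rintegral_restrict0 _ T R mu U D _ mU mD DU).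
  by congr Rintegral; apply/funext => y; rewrite mulrC.
move=> y _ nDy; have [->|/gh/hD//] := eqVneq (g y) 0; exact: mulr0.
Qed.

Lemma le_sum_pred (I : finType) (P P' : pred I) (a : I -> \bar R) :
  (forall i, P i -> P' i) -> (forall i, (0 <= a i)%E) ->
  (\sum_(i | P i) a i <= \sum_(i | P' i) a i)%E.
Proof.
move=> PP' a0; rewrite big_mkcond [leRHS]big_mkcond; apply: lee_sum => i _.
by case: ifP => [/PP' -> //|_]; case: ifP.
Qed.

(** The averages of [f] against translated cutoffs vanish, so on every cell [f] is controlled by its
    oscillation, and the oscillations sum to zero as the grid is refined. *)
Lemma weak_zero (U : set V) (f : V -> R) : open U -> Lp_loc 1%E U f ->
  (forall phi, test_function U phi -> \int[mu]_(x in (U : set T)) (f x * phi x) = 0) ->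
  forall K : set V, compact K -> K `<=` U ->
    {ae mu, forall x : T, K x -> f x = 0}.
Proof.
move=> oU fU f0 K cK KU.
have [h0 [K0 [h00 cK0 K0U KK0]]] := compact_thickening cK oU KU.
have [B B0 KB] := compact_norm_lt cK.
have mK : measurable (K : set T) by exact: compact_measurable_Rn.
have mK0 : measurable (K0 : set T) by exact: compact_measurable_Rn.
have K0fin : (mu K0 < +oo)%E by exact: mu_compact_lty.
have fi := L1_loc_integrable fU cK0 K0U.
have KsubK0 : K `<=` K0 by move=> x Kx; apply: (KK0 x) => //; rewrite subrr normr0 ltW.
pose fl := cutoff_floor R n.
have fl0 : 0 < fl by exact: cutoff_floor_gt0.
have mf : measurable_fun (K0 : set T) (f : T -> R).
  by apply/measurable_EFinP; have [] := integrableP _ _ _ fi.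
have mfn : measurable_fun (K0 : set T) (fun x : T => `|f x|).
  exact: (measurableT_comp (@normr_measurable R setT) mf).
have f1 : (\int[mu]_(x in (K0 : set T)) (`|f x| ^+ 1)%:E < +oo)%E.
  by have [] := integrableP _ _ _ fi.
have key (e : R) : 0 < e -> (\int[mu]_(x in (K : set T)) (`|f x|)%:E <= (1 + fl^-1)%:E * e%:E)%E.
  move=> e0.
  have [N0 HN0] := grid_oscillation mK0 K0fin mf f1 B0 e0.
  have [N1 HN1] := mesh_small B0 (divr_gt0 h00 (ltr0Sn R 1)).
  have [Np mh] := HN1 (maxn N0 N1) (leq_maxr _ _).
  have [c hc] := HN0 (maxn N0 N1) (leq_maxl _ _) Np.
  set N := maxn N0 N1 in Np mh c hc.
  have m0 := mesh_gt0 B0 Np; set h := mesh B N in mh m0.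
  have mh2 : 2 * h <= h0 by rewrite mulrC -ler_pdivlMr.
  pose P k := `[< exists x, K x /\ @cell R n B N k x >].
  have PW k : P k -> @wide_cell R n B N k `<=` K0.
    by move=> /asboolP[x [Kx kx]]; exact: (wide_cell_sub KK0 m0 mh2 Kx kx).
  have PC k : P k -> @cell R n B N k `<=` K0.
    by move=> Pk; apply: subset_trans (PW k Pk); exact: cell_sub_wide.
  apply: (@le_trans _ _ (\sum_(k | P k) \int[mu]_(x in (@cell R n B N k : set T)) (`|f x|)%:E)%E).
    refine (@cover_sum _ T R mu _ P (fun k => @cell R n B N k : set T) (K : set T) (K0 : set T)
      (fun x => `|f x|) mK mK0 KsubK0 _ _ mfn _).
    - by move=> k Pk; split; [exact: measurable_cell|exact: PC].
    - by move=> x _; exact: normr_ge0.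
    - move=> x Kx; have [k kx] := cell_cover B0 Np (KB x Kx).
      by exists k; split; [apply/asboolP; exists x|exact: kx].
  apply: (@le_trans _ _ (\sum_(k | P k) (1 + fl^-1)%:E *
      \int[mu]_(x in (@wide_cell R n B N k : set T)) (`|f x - c k| ^+ 1)%:E)%E).
    apply: lee_sum => k Pk.
    have mW := measurable_wide_cell B k.
    have mC := measurable_cell B k.
    have fWi := integrableS mK0 mW (PW k Pk) fi.
    have [x [Kx kx]] := asboolP _ Pk.
    have hx y : `|y - x| <= h -> K0 y.
      by move=> xy; apply: (KK0 x) => //; apply: le_trans xy _; lra.
    have tf : test_function U (fun y => beval (cutoff n h) (x - y)).
      by apply: cutoff_test_function => // y /hx /K0U.
    have mo0 : mollify (K0 : set T) f h x = 0.
      rewrite /mollify -(@mollify_cutoff_eq U K0 f _ h x m0 oU mK0 K0U hx).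
        by rewrite (f0 _ tf) mulr0.
      by move=> y /(cutoff_support m0); rewrite distrC => /ltW.
    have := mollify_oscillation (c k) mK0 K0fin fi m0 kx (PW k Pk).
    rewrite mo0 sub0r normrN => ck.
    have Wfin : (mu (@wide_cell R n B N k) < +oo)%E by rewrite mu_wide_cell// ltry.
    have := norm_le_oscillation mC mW (cell_sub_wide m0) Wfin fWi _ ck.
    rewrite mu_cell// -/h /=.
    rewrite (_ : (fl * h ^+ n.+1)^-1 * h ^+ n.+1 = fl^-1); last first.
      by rewrite invfM mulfVK// expf_neq0// gt_eqF.
    by apply; rewrite invr_ge0 mulr_ge0 ?exprn_ge0// ltW.
  rewrite -ge0_sume_distrr; last by move=> k _; apply: integral_ge0 => x _; rewrite lee_fin.
  apply: lee_wpmul2l; first by rewrite lee_fin addr_ge0// invr_ge0 ltW.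
  apply: le_trans hc; apply: le_sum_pred => [k Pk|k]; first exact/asboolP/PW.
  by apply: integral_ge0 => x _; rewrite lee_fin.
have int0 : (\int[mu]_(x in (K : set T)) `|(f x)%:E| = 0)%E.
  apply/eqP; rewrite eq_le integral_ge0 ?andbT//.
  apply/lee_addgt0Pr => e e0; rewrite add0e.
  have fl1 : 0 < 1 + fl^-1 by rewrite addr_gt0// invr_gt0.
  have := key (e / (1 + fl^-1)) (divr_gt0 e0 fl1).
  by rewrite -EFinM mulrC divfK// gt_eqF.
have mfK : measurable_fun (K : set T) (EFin \o (f : T -> R)).
  by apply/measurable_EFinP; exact: measurable_funS mf.
have /(ae_eq_integral_abs mu mK mfK) := int0.
by apply: filterS => x h Kx; have [] := h Kx.
Qed.

End uniqueness.

(** * Derivatives of mollified functions *)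

Section weighted_integral.
Context d (T : measurableType d) (R : realType).
Variables (mu : {measure set T -> \bar R}) (D : set T) (u : T -> R).
Hypotheses (mD : measurable D) (ui : mu.-integrable D (EFin \o u)).

Definition bounded_measurable (b : T -> R) :=
  measurable_fun D b /\ exists C, forall x, `|b x| <= C.

Definition weighted (b : T -> R) : R := \int[mu]_(x in D) (b x * u x).

Lemma weighted_integrable b : bounded_measurable b ->
  mu.-integrable D (EFin \o (fun x => b x * u x)).
Proof.
by move=> [mb [C bC]]; apply: (integrable_mul_bounded mD mb _ ui) => x _; exact: bC.
Qed.

Lemma bounded_measurableD b c : bounded_measurable b -> bounded_measurable c ->
  bounded_measurable (fun x => b x + c x).
Proof.
move=> [mb [B bB]] [mc [C cC]]; split; first exact: measurable_funD.
by exists (B + C) => x; rewrite (le_trans (ler_normD _ _))// lerD.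
Qed.

Lemma bounded_measurableZ k b : bounded_measurable b ->
  bounded_measurable (fun x => k * b x).
Proof.
move=> [mb [B bB]]; split; first exact: measurable_funM.
by exists (`|k| * B) => x; rewrite normrM ler_wpM2l.
Qed.

Lemma weightedD b c : bounded_measurable b -> bounded_measurable c ->
  weighted (fun x => b x + c x) = weighted b + weighted c.
Proof.
move=> /weighted_integrable ib /weighted_integrable ic.
rewrite /weighted -RintegralD//; congr Rintegral; apply/funext => x.
by rewrite mulrDl.
Qed.

Lemma weightedZ k b : bounded_measurable b ->
  weighted (fun x => k * b x) = k * weighted b.
Proof.
move=> /weighted_integrable ib; rewrite /weighted -RintegralZl//.
by congr Rintegral; apply/funext => x; rewrite mulrA.
Qed.

Lemma weighted_sum (I : Type) (s : seq I) (b : I -> T -> R) :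
  (forall i, bounded_measurable (b i)) ->
  bounded_measurable (fun x => \sum_(i <- s) b i x) /\
  weighted (fun x => \sum_(i <- s) b i x) = \sum_(i <- s) weighted (b i).
Proof.
move=> bm; elim: s => [|i s [IHm IH]].
  under eq_fun do rewrite big_nil; rewrite big_nil; split.
    by split; [exact: measurable_cst|exists 0 => x; rewrite normr0].
  by rewrite /weighted; under eq_Rintegral do rewrite mul0r; rewrite Rintegral_cst// mul0r.
under eq_fun do rewrite big_cons; rewrite big_cons; split.
  exact: bounded_measurableD.
by rewrite weightedD// IH.
Qed.

Lemma weighted_bound b C : bounded_measurable b -> (forall x, `|b x| <= C) ->
  `|weighted b| <= C * \int[mu]_(x in D) `|u x|.
Proof.
move=> bm bC; have un := integrable_normr ui.
rewrite -RintegralZl//; apply: normr_Rintegral_le => //.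
- exact: weighted_integrable.
- exact: (integrable_mul_bounded mD (measurable_cst C) (fun x _ => lexx `|C|) un).
- by move=> x _; rewrite normrM ler_wpM2r.
Qed.

Lemma average_close (b : T -> R) (m c e : R) : (mu D < +oo)%E -> measurable_fun D b ->
  (forall x, 0 <= b x <= 1) ->
  \int[mu]_(x in D) b x = m -> 0 < m -> 0 <= e ->
  (forall x, D x -> b x != 0 -> `|u x - c| <= e) ->
  `|m^-1 * weighted b - c| <= e.
Proof.
move=> Dfin mb b01 bm m0 e0 uc.
have [bui ->] := average_sub c mD Dfin mb (fun x _ => b01 x) ui m0 bm.
have bC x : D x -> `|b x| <= 1 by have /andP[? ?] := b01 x; rewrite ger0_norm.
have bi := integrable_bounded mD Dfin mb bC.
rewrite mulrC ler_pdivrMr// -bm -RintegralZl//; apply: normr_Rintegral_le => //.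
  exact: (integrable_mul_bounded mD (measurable_cst e) (fun x _ => lexx `|e|) bi).
move=> x Dx; have [->|bx] := eqVneq (b x) 0; first by rewrite mul0r mulr0 normr0.
have /andP[b0 _] := b01 x.
by rewrite normrM ger0_norm// mulrC ler_wpM2r// uc.
Qed.

End weighted_integral.

Lemma is_derive_quadratic (R : realType) (f : R -> R) (t a C : R) :
  (forall s, `|f (s + t) - f t - s * a| <= C * s ^+ 2) -> is_derive t 1 f a.
Proof.
move=> fq.
have C0 : 0 <= C by have := le_trans (normr_ge0 _) (fq 1); rewrite expr1n mulr1.
suff h : (fun h : R => h^-1 *: (f (h *: (1 : R) + t) - f t)) @ 0^' --> a.
  by split; [apply/cvg_ex; exists a|exact/cvg_lim].
apply/cvgrPdist_le => e e0.
have C1 : 0 < C + 1 by rewrite ltr_wpDl.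
have eC : 0 < e / (C + 1) by rewrite divr_gt0.
near=> h.
have h0 : h != 0 by near: h; exact: nbhs_dnbhs_neq.
have he : `|h| < e / (C + 1).
  near: h; apply: (@nbhs_dnbhs R 0); exists (e / (C + 1)); first exact: eC.
  by move=> s /=; rewrite sub0r normrN.
rewrite /GRing.scale /= mulr1.
have -> : a - h^-1 * (f (h + t) - f t) = - h^-1 * (f (h + t) - f t - h * a).
  by field.
rewrite normrM normrN normfV mulrC ler_pdivrMr ?normr_gt0//.
rewrite (le_trans (fq h))// -real_normK ?num_real// expr2 mulrA ler_wpM2r//.
apply: (@le_trans _ _ ((C + 1) * `|h|)); first by rewrite ler_wpM2r// lerDl.
by rewrite mulrC -ler_pdivlMr// ltW.
Unshelve. all: by end_near. Qed.

Lemma second_order_test (R : realType) (al be K t0 : R) : 0 < t0 -> 0 <= K ->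
  (forall t, `|t| < t0 -> t * al + 2^-1 * t ^+ 2 * be <= K * `|t| ^+ 3) ->
  al = 0 /\ be <= 0.
Proof.
move=> t00 K0 H.
pose M := `|be| + K + 1.
have M0 : 0 < M by rewrite /M ltr_wpDl// addr_ge0.
have key a : (forall t, 0 < t < t0 -> t <= 1 -> a <= t * M) -> a <= 0.
  move=> Ha; rewrite leNgt; apply/negP => a0.
  pose t := Num.min 1 (Num.min (t0 / 2) (a / (2 * M))).
  have t_gt : 0 < t by rewrite !lt_min ltr01 !divr_gt0// mulr_gt0.
  have tt0 : t < t0.
    rewrite /t !gt_min; apply/orP; right; apply/orP; left.
    by rewrite ltr_pdivrMr// ltr_pMr// ltr1n.
  have := Ha t; rewrite t_gt tt0 ge_min lexx => /(_ isT isT).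
  apply/negP; rewrite -ltNge -ltr_pdivlMr//.
  apply: (@le_lt_trans _ _ (a / (2 * M))); first by rewrite /t !ge_min lexx !orbT.
  by rewrite ltr_pM2l// ltf_pV2 ?posrE ?mulr_gt0// ltr_pMl// ltr1n.
have bound (t : R) : 0 < t -> t <= 1 -> K * t ^+ 2 - 2^-1 * t * be <= t * M.
  move=> tp t1; have h1 : - be <= `|be| by rewrite -normrN ler_norm.
  have h2 : 0 <= K * t * (1 - t) by rewrite !mulr_ge0 ?subr_ge0// ltW.
  have h3 : 0 <= t * (`|be| + be) by rewrite mulr_ge0 ?(ltW tp)//; lra.
  have h4 : 0 <= t * `|be| by rewrite mulr_ge0// ltW.
  by rewrite /M; lra.
have al0 : al <= 0.
  apply: key => t /andP[tp tt] t1.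
  have := H t; rewrite gtr0_norm// => /(_ tt) h.
  apply: le_trans (bound t tp t1).
  by rewrite -(ler_pM2l tp); lra.
have al1 : - al <= 0.
  apply: key => t /andP[tp tt] t1.
  have := H (- t); rewrite normrN gtr0_norm// => /(_ tt) h.
  apply: le_trans (bound t tp t1).
  by rewrite -(ler_pM2l tp); lra.
have ale : al = 0 by apply/eqP; rewrite eq_le al0 -oppr_le0.
split=> //; suff : be / 2 <= 0 by lra.
apply: key => t /andP[tp tt] t1.
have := H t; rewrite gtr0_norm// ale => /(_ tt) h.
have h3 : 0 <= t * `|be| by rewrite mulr_ge0// ltW.
apply: (@le_trans _ _ (K * t)); last by rewrite /M; lra.
have t2 : 0 < t ^+ 2 by rewrite exprn_gt0.
by rewrite -(ler_pM2l t2); lra.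
Qed.

Section convolution.
Variables (R : realType) (n : nat).
Local Notation V := 'rV[R]_n.+1.
Local Notation T := (lebesgue_space R n).
Local Notation mu := (lebesgueRn R n).
Variables (D : set T) (u : T -> R).
Hypotheses (mD : measurable D) (ui : mu.-integrable D (EFin \o u)).

Definition wconv (e : bexpr R n) (x : V) : R :=
  weighted mu D u (fun y : T => beval e (x - (y : V))).

Lemma bounded_measurable_beval (e : bexpr R n) (x : V) :
  bounded_measurable D (fun y : T => beval e (x - (y : V))).
Proof.
split; first by apply: measurable_funTS; exact: measurable_beval.
by have [C hC] := beval_bounded e; exists C => y; exact: hC.
Qed.

Let bmb := bounded_measurable_beval.

(** An expansion of the kernel that is uniform in its argument is inherited by
    the convolution. *)
Lemma wconv_remainder (e : bexpr R n) (x z : V) (I : Type) (s : seq I)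
    (c : I -> R) (f : I -> bexpr R n) (C : R) :
  (forall v, `|beval e (v + z) - beval e v - \sum_(i <- s) c i * beval (f i) v| <= C) ->
  `|wconv e (x + z) - wconv e x - \sum_(i <- s) c i * wconv (f i) x| <=
    C * \int[mu]_(y in D) `|u y|.
Proof.
move=> eC.
have bS := weighted_sum mD ui s (fun i => bounded_measurableZ (c i) (bmb (f i) x)).
pose r := fun y : T => beval e (x - (y : V) + z) - beval e (x - (y : V)) -
  \sum_(i <- s) c i * beval (f i) (x - (y : V)).
have rC y : `|r y| <= C by exact: eC.
have brE : (fun y : T => beval e (x + z - (y : V)) + -1 * (beval e (x - (y : V)) +
    \sum_(i <- s) c i * beval (f i) (x - (y : V)))) = r.
  by apply/funext => y; rewrite /r addrAC; ring.
have b1 := bounded_measurableD (bmb e x) bS.1.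
have b2 := bounded_measurableZ (-1) b1.
have br : bounded_measurable D r by rewrite -brE; exact: bounded_measurableD.
have -> : wconv e (x + z) - wconv e x - \sum_(i <- s) c i * wconv (f i) x =
    weighted mu D u r.
  rewrite -brE (weightedD mD ui (bmb e (x + z)) b2) (weightedZ mD ui _ b1).
  rewrite (weightedD mD ui (bmb e x) bS.1) bS.2 mulN1r opprD addrA.
  congr (_ - _ - _); apply: eq_bigr => i _.
  by rewrite (weightedZ mD ui _ (bmb (f i) x)).
exact: weighted_bound.
Qed.

Lemma wconv_taylor1 e : exists C, forall x z,
  `|wconv e (x + z) - wconv e x - \sum_i z 0 i * wconv (bderiv i e) x| <= C * `|z| ^+ 2.
Proof.
have [C _ hC] := taylor1 e; exists (C * \int[mu]_(y in D) `|u y|) => x z.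
by rewrite mulrAC; apply: wconv_remainder => v; exact: hC.
Qed.

Lemma wconv_taylor2 e : exists2 C, 0 <= C & forall x z,
  `|wconv e (x + z) - wconv e x - (\sum_i z 0 i * wconv (bderiv i e) x
    + 2^-1 * \sum_i \sum_j z 0 i * z 0 j * wconv (bderiv j (bderiv i e)) x)|
    <= C * `|z| ^+ 3.
Proof.
have [C C0 hC] := taylor2 e; exists (C * \int[mu]_(y in D) `|u y|).
  by rewrite mulr_ge0// Rintegral_ge0.
move=> x z; rewrite mulrAC.
(* the first- and second-order terms, listed as one family *)
pose s := [seq inl i | i <- index_enum 'I_n.+1] ++
          [seq inr ij | ij <- index_enum ('I_n.+1 * 'I_n.+1)%type]
  : seq ('I_n.+1 + 'I_n.+1 * 'I_n.+1).
pose c (k : 'I_n.+1 + 'I_n.+1 * 'I_n.+1) : R :=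
  match k with inl i => z 0 i | inr ij => 2^-1 * (z 0 ij.1 * z 0 ij.2) end.
pose f (k : 'I_n.+1 + 'I_n.+1 * 'I_n.+1) : bexpr R n :=
  match k with inl i => bderiv i e | inr ij => bderiv ij.2 (bderiv ij.1 e) end.
have sE (g : bexpr R n -> R) : \sum_(k <- s) c k * g (f k) =
    \sum_i z 0 i * g (bderiv i e) +
    2^-1 * \sum_i \sum_j z 0 i * z 0 j * g (bderiv j (bderiv i e)).
  rewrite big_cat !big_map /=; congr (_ + _).
  rewrite pair_big /= mulr_sumr; apply: eq_bigr => ij _.
  by rewrite !mulrA.
rewrite -(sE (fun e => wconv e x)); apply: wconv_remainder => v.
by rewrite (sE (fun e => beval e v)) opprD addrA.
Qed.

Lemma wconv_derivC i j e x : wconv (bderiv i (bderiv j e)) x = wconv (bderiv j (bderiv i e)) x.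
Proof.
by congr Rintegral; apply/funext => y; rewrite bderivC.
Qed.

Lemma wconv_continuous e : continuous (wconv e).
Proof.
have [B hB] : exists B, forall x z, `|wconv e (x + z) - wconv e x| <= B * `|z|.
  have [C C0 hC] := taylor0 e; exists (C * \int[mu]_(y in D) `|u y|) => x z.
  have := @wconv_remainder e x z 'I_0 [::] (fun=> 0) (fun=> e) (C * `|z|).
  rewrite big_nil subr0 mulrAC; apply => v; rewrite big_nil subr0; exact: hC.
apply: lipschitz_continuous; exists `|B| => // x y.
rewrite distrC -{1}(subrKC x y) (le_trans (hB _ _))// distrC.
by rewrite ler_wpM2r// ler_norm.
Qed.

End convolution.

Section contact.
Variables (R : realType) (n : nat).
Local Notation V := 'rV[R]_n.+1.

Definition sqdist (c x : V) : R := \sum_i (x 0 i - c 0 i) ^+ 2.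

Definition dotp (p x : V) : R := \sum_i p 0 i * x 0 i.

(** First and second derivative test for [W - kap * sqdist c - dotp p], where
    [G] and [H] are the gradient and Hessian of [W] at [x], given through the
    Taylor expansion of [W]. *)
Lemma contact_test (W : V -> R) (G : 'I_n.+1 -> R) (H : 'I_n.+1 -> 'I_n.+1 -> R)
    (C kap del : R) (c p x : V) : 0 <= C -> 0 < del ->
  (forall z, `|W (x + z) - W x - (\sum_i z 0 i * G i
     + 2^-1 * \sum_i \sum_j z 0 i * z 0 j * H i j)| <= C * `|z| ^+ 3) ->
  (forall z, `|z| < del ->
     W (x + z) - kap * sqdist c (x + z) - dotp p (x + z) <=
     W x - kap * sqdist c x - dotp p x) ->
  (forall i, p 0 i = G i - 2 * kap * (x 0 i - c 0 i)) /\
  (forall xi : 'I_n.+1 -> R, qform H xi <= 2 * kap * \sum_i xi i ^+ 2).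
Proof.
move=> C0 d0 WT xmax.
have key (z : V) : \sum_i z 0 i * (G i - 2 * kap * (x 0 i - c 0 i) - p 0 i) = 0 /\
    qform H (z 0) - 2 * kap * \sum_i z 0 i ^+ 2 <= 0.
  set al := \sum_i z 0 i * (_ - _); set be := qform H _ - _.
  have z1 : 0 < `|z| + 1 by rewrite ltr_wpDl.
  have t00 : 0 < del / (`|z| + 1) by rewrite divr_gt0.
  have K0 : 0 <= C * `|z| ^+ 3 by rewrite mulr_ge0 ?exprn_ge0.
  apply: (second_order_test t00 K0) => t tt.
  have tz : `|t *: z| < del.
    rewrite normrZ (@le_lt_trans _ _ (`|t| * (`|z| + 1)))//.
      by rewrite ler_wpM2l// lerDl.
    by rewrite -ltr_pdivlMr.
  have h1 := xmax _ tz; have h2 := WT (t *: z).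
  have e1 : \sum_i (t *: z) 0 i * G i + 2^-1 * \sum_i \sum_j (t *: z) 0 i * (t *: z) 0 j * H i j
      = t * (\sum_i z 0 i * G i) + 2^-1 * t ^+ 2 * qform H (z 0).
    congr (_ + _); first by rewrite mulr_sumr; apply: eq_bigr => i _; rewrite !mxE; ring.
    rewrite -mulrA; congr (_ * _); rewrite mulr_sumr; apply: eq_bigr => i _.
    rewrite mulr_sumr; apply: eq_bigr => j _; rewrite !mxE; ring.
  have e2 : sqdist c (x + t *: z) - sqdist c x =
      2 * t * (\sum_i z 0 i * (x 0 i - c 0 i)) + t ^+ 2 * \sum_i z 0 i ^+ 2.
    rewrite /sqdist -sumrB !mulr_sumr -big_split; apply: eq_bigr => i _ /=.
    by rewrite !mxE; ring.
  have e3 : dotp p (x + t *: z) - dotp p x = t * \sum_i z 0 i * p 0 i.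
    rewrite /dotp -sumrB mulr_sumr; apply: eq_bigr => i _; rewrite !mxE; ring.
  have e4 : t * al + 2^-1 * t ^+ 2 * be =
      (\sum_i (t *: z) 0 i * G i + 2^-1 * \sum_i \sum_j (t *: z) 0 i * (t *: z) 0 j * H i j)
      - kap * (sqdist c (x + t *: z) - sqdist c x) - (dotp p (x + t *: z) - dotp p x).
    rewrite e1 e2 e3.
    have -> : al = \sum_i z 0 i * G i - 2 * kap * (\sum_i z 0 i * (x 0 i - c 0 i)) -
        \sum_i z 0 i * p 0 i.
      rewrite /al mulr_sumr -!sumrB; apply: eq_bigr => i _; ring.
    by rewrite /be; field.
  rewrite e4; move: h2; rewrite normrZ exprMn [`|t| ^+ 3 * _]mulrC mulrA ler_norml.
  by move=> /andP[h2 h3]; lra.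
split=> [i|xi].
  have [+ _] := key (\row_j (j == i)%:R).
  rewrite (eq_bigr (fun j => (G j - 2 * kap * (x 0 j - c 0 j) - p 0 j) * (j == i)%:R)).
    by rewrite sum_delta => /eqP; rewrite subr_eq0 => /eqP.
  by move=> j _; rewrite mxE mulrC.
have [_] := key (\row_j xi j); rewrite subr_le0.
rewrite (_ : (\row_j xi j) 0 = xi); last by apply/funext => j; rewrite mxE.
by [].
Qed.

End contact.

Section mollified_solution.
Variables (R : realType) (n : nat).
Local Notation V := 'rV[R]_n.+1.
Local Notation T := (lebesgue_space R n).
Local Notation mu := (lebesgueRn R n).
Variables (K : set V) (w : V -> R).
Hypotheses (cK : compact K) (wi : mu.-integrable (K : set T) (EFin \o (w : T -> R))).

Let mK : measurable (K : set T). Proof. exact: compact_measurable_Rn. Qed.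

(** [mollified] is the convolution of [w] with a normalised cutoff; [mgrad] and
    [mhess] are its derivatives, which fall on the kernel. *)
Definition mollified (h : R) (x : V) : R := (cutoff_mass n h)^-1 * wconv (K : set T) w (cutoff n h) x.
Definition mgrad (h : R) (x : V) i : R :=
  (cutoff_mass n h)^-1 * wconv (K : set T) w (bderiv i (cutoff n h)) x.
Definition mhess (h : R) (x : V) i j : R :=
  (cutoff_mass n h)^-1 * wconv (K : set T) w (bderiv j (bderiv i (cutoff n h))) x.

Lemma mhessC h x i j : mhess h x i j = mhess h x j i.
Proof. by rewrite /mhess wconv_derivC. Qed.

Lemma mollified_continuous h : continuous (mollified h).
Proof.
move=> x; have := @wconv_continuous R n K w mK wi (cutoff n h) x.
by rewrite /continuous_at => cx; exact: (cvgM (cvg_cst (cutoff_mass n h)^-1) cx).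
Qed.

Lemma mollified_taylor h : 0 < h -> exists2 C, 0 <= C & forall x z,
  `|mollified h (x + z) - mollified h x - (\sum_i z 0 i * mgrad h x i
    + 2^-1 * \sum_i \sum_j z 0 i * z 0 j * mhess h x i j)| <= C * `|z| ^+ 3.
Proof.
move=> h0; have m0 : 0 <= (cutoff_mass n h)^-1 :> R by rewrite invr_ge0 ltW// cutoff_mass_gt0.
have [C C0 hC] := wconv_taylor2 mK wi (cutoff n h).
exists ((cutoff_mass n h)^-1 * C) => [|x z]; first exact: mulr_ge0.
have := ler_wpM2l m0 (hC x z); rewrite -{1}(ger0_norm m0) -normrM mulrA.
congr (`|_| <= _); rewrite mulrBr mulrBr mulrDr /mollified; congr (_ - (_ + _)).
  by rewrite mulr_sumr; apply: eq_bigr => i _; rewrite mulrCA.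
rewrite mulrCA; congr (_ * _); rewrite mulr_sumr; apply: eq_bigr => i _.
by rewrite mulr_sumr; apply: eq_bigr => j _; rewrite mulrCA.
Qed.

(** The map [x |-> mgrad x - 2 * kap * x] has derivative [mhess - 2 * kap * 1];
    the mean value theorem is applied along the segment. *)
Lemma mgrad_diff h (x x' : V) i (kap M : R) : 0 < h ->
  (forall t, 0 <= t <= 1 -> forall j,
     `|mhess h (x + t *: (x' - x)) i j - 2 * kap * (j == i)%:R| <= M) ->
  `|(mgrad h x' i - 2 * kap * x' 0 i) - (mgrad h x i - 2 * kap * x 0 i)| <=
    n.+1%:R * `|x' - x| * M.
Proof.
move=> h0 HM; set z := x' - x.
have [C hC] := wconv_taylor1 mK wi (bderiv i (cutoff n h)).
pose f t := mgrad h (x + t *: z) i - 2 * kap * (x + t *: z) 0 i.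
pose df t := \sum_j z 0 j * (mhess h (x + t *: z) i j - 2 * kap * (j == i)%:R).
have dfE (t : R) : is_derive t 1 f (df t).
  apply: (@is_derive_quadratic R f t (df t) (`|(cutoff_mass n h)^-1| * (C * `|z| ^+ 2))) => s.
  have := hC (x + t *: z) (s *: z).
  rewrite -[x + t *: z + s *: z]addrA -scalerDl [t + s]addrC.
  move=> /(ler_wpM2l (normr_ge0 (cutoff_mass n h)^-1)).
  have -> : `|s *: z| ^+ 2 = s ^+ 2 * `|z| ^+ 2.
    by rewrite normrZ exprMn real_normK ?num_real.
  rewrite -normrM.
  have -> : `|(cutoff_mass n h)^-1| * (C * (s ^+ 2 * `|z| ^+ 2)) =
    `|(cutoff_mass n h)^-1| * (C * `|z| ^+ 2) * s ^+ 2 by ring.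
  congr (`|_| <= _).
  have -> : df t = (cutoff_mass n h)^-1 *
     (\sum_j z 0 j * wconv (K : set T) w (bderiv j (bderiv i (cutoff n h))) (x + t *: z))
     - 2 * kap * z 0 i.
    rewrite mulr_sumr -[in RHS](sum_delta (fun j => z 0 j) i) mulr_sumr -sumrB.
    by apply: eq_bigr => j _; rewrite /mhess; ring.
  have -> : \sum_j (s *: z) 0 j * wconv (K : set T) w (bderiv j (bderiv i (cutoff n h))) (x + t *: z)
     = s * \sum_j z 0 j * wconv (K : set T) w (bderiv j (bderiv i (cutoff n h))) (x + t *: z).
    by rewrite mulr_sumr; apply: eq_bigr => j _; rewrite mxE mulrA.
  by rewrite /f /mgrad !mxE; ring.
have := @mean_value_bound R f df (n.+1%:R * `|z| * M) dfE.
rewrite /f scale1r scale0r addr0 /z subrKC; apply => t t01.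
rewrite (le_trans (ler_norm_sum _ _ _))//.
apply: (@le_trans _ _ (\sum_(j < n.+1) `|z| * M)).
  apply: ler_sum => j _; rewrite normrM; apply: ler_pM => //; first exact: coord_norm_le.
  exact: HM.
by rewrite sumr_const card_ord -[leLHS]mulr_natl mulrA.
Qed.

(** Two integrations by parts move the Hessian of the cutoff onto the weak
    Hessian of [w]. *)
Lemma mhess_weak (U : set V) (Dij : V -> R) h (x : V) i j : 0 < h -> open U -> K `<=` U ->
  weak_partials U [:: i; j] w Dij -> (forall y, `|y - x| <= h -> K y) ->
  mhess h x i j = mollify (K : set T) Dij h x.
Proof.
move=> h0 oU KU [_ _ wD] hK.
have tf : test_function U (fun y => beval (cutoff n h) (x - y)).
  by apply: cutoff_test_function => // y /hK /KU.
have /= := wD _ tf.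
have E : partials [:: i; j] (fun y => beval (cutoff n h) (x - y)) =
    fun y => beval (bderiv i (bderiv j (cutoff n h))) (x - y).
  rewrite (_ : (fun y => beval (cutoff n h) (x - y)) = beval (breflect x (cutoff n h))).
    by rewrite beval_partials; apply/funext => y /=; rewrite bderiv2_reflect.
  by apply/funext => y; rewrite beval_reflect.
have supp (y : V) : beval (bderiv i (bderiv j (cutoff n h))) (x - y) != 0 -> `|y - x| <= h.
  exact: (@cutoff_partials_support R n h x y [:: i; j] h0).
have supp0 (y : V) : beval (cutoff n h) (x - y) != 0 -> `|y - x| <= h.
  exact: (@cutoff_partials_support R n h x y [::] h0).
rewrite (_ : \int[mu]_(y in (U : set T)) (w y * _) =
    wconv (K : set T) w (bderiv i (bderiv j (cutoff n h))) x); last first.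
  rewrite /wconv /weighted -(@mollify_cutoff_eq R n U K w _ h x h0 oU mK KU hK supp).
  congr Rintegral; apply/funext => y; congr (_ * _).
  exact: (congr1 (fun g => g y) E).
rewrite expr2 mulrNN mulr1 mul1r.
rewrite (@mollify_cutoff_eq R n U K Dij _ h x h0 oU mK KU hK supp0) => wE.
by rewrite /mhess /mollify -wE wconv_derivC.
Qed.

End mollified_solution.

(** * The Hessian near a contact point *)

Section pointwise.
Variables (R : realType) (n : nat).
Implicit Types (A H D : 'I_n -> 'I_n -> R).

Lemma entry_le A (L : R) : (forall i j, A i j = A j i) ->
  (forall x, 0 <= qform A x <= L * \sum_i x i ^+ 2) -> forall i j, `|A i j| <= L.
Proof.
move=> sA AL.
have pA x : 0 <= qform A x by have /andP[] := AL x.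
have dL k : A k k <= L.
  have /andP[_] := AL (fun i => (i == k)%:R).
  rewrite qform_delta (eq_bigr (fun i => (i == k)%:R * (i == k)%:R)) ?sum_delta.
    by rewrite eqxx mulr1.
  by move=> i _; rewrite expr2.
move=> i j; have := psd_offdiag sA pA i j 1; have := psd_offdiag sA pA i j (-1).
have := dL i; have := dL j; rewrite ler_norml; lra.
Qed.

(** At a contact point the Hessian [H] lies below [2 * kap * 1], whereas the
    equation keeps the trace of [A D] above that of [2 * kap * A]. Hence the gap
    [2 * kap * 1 - H], of size comparable to its trace, is paid for by [D - H]. *)
Lemma pointwise_contact A H D (l L kap : R) : 0 < l ->
  (forall i j, A i j = A j i) -> (forall i j, H i j = H j i) ->
  (forall x, l * \sum_i x i ^+ 2 <= qform A x <= L * \sum_i x i ^+ 2) ->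
  (forall x, qform H x <= 2 * kap * \sum_i x i ^+ 2) ->
  2 * kap * \sum_i A i i <= \sum_i \sum_j A i j * D i j ->
  forall i j, l * `|H i j - 2 * kap * (i == j)%:R| <=
    L * \sum_i \sum_j `|D i j - H i j|.
Proof.
move=> l0 sA sH AB Hk AD i j.
have A0 x : 0 <= qform A x <= L * \sum_i x i ^+ 2.
  have /andP[h1 ->] := AB x; rewrite andbT (le_trans _ h1)//.
  by rewrite mulr_ge0 ?(ltW l0)// sumr_ge0// => k _; exact: sqr_ge0.
have AL := entry_le sA A0.
have sE a b : H a b - 2 * kap * (a == b)%:R = H b a - 2 * kap * (b == a)%:R.
  by rewrite sH eq_sym.
have := contact_bound (E := fun a b => H a b - 2 * kap * (a == b)%:R) sA sE.
move=> /(_ l _ _ (ltW l0) i j) h; apply: le_trans (h _ _) _ => [x|x|].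
- by have /andP[] := AB x.
- by rewrite qform_sub_scalar subr_le0.
have -> : \sum_a \sum_b A a b * (H a b - 2 * kap * (a == b)%:R) =
    \sum_a \sum_b A a b * H a b - 2 * kap * \sum_a A a a.
  rewrite mulr_sumr -sumrB; apply: eq_bigr => a _.
  have -> : 2 * kap * A a a = \sum_b 2 * kap * A a b * (b == a)%:R by rewrite sum_delta.
  by rewrite -sumrB; apply: eq_bigr => b _; rewrite [b == a]eq_sym; ring.
rewrite opprB; apply: le_trans (lerB AD (lexx _)) _.
rewrite -sumrB mulr_sumr; apply: ler_sum => a _.
rewrite -sumrB mulr_sumr; apply: ler_sum => b _.
rewrite -mulrBr (le_trans (ler_norm _))// normrM.
by rewrite ler_wpM2r.
Qed.

Lemma pow_sum_le (I : finType) (i0 : I) (t : I -> R) p : (forall i, 0 <= t i) ->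
  (\sum_i t i) ^+ p <= #|I|%:R ^+ p * \sum_i t i ^+ p.
Proof.
move=> t0.
have [m _ tm] := @Order.TotalTheory.arg_maxP _ _ _ i0 xpredT t isT.
have s1 : \sum_i t i <= #|I|%:R * t m.
  rewrite -sum1_card natr_sum mulr_suml; apply: ler_sum => i _.
  by rewrite mul1r; exact: tm.
apply: (@le_trans _ _ ((#|I|%:R * t m) ^+ p)).
  by rewrite lerXn2r ?nnegrE ?sumr_ge0 ?mulr_ge0.
rewrite exprMn ler_wpM2l ?exprn_ge0// (bigD1 m)//= lerDl.
by apply: sumr_ge0 => i _; rewrite exprn_ge0.
Qed.

End pointwise.

Section finite_sums.
Context d (T : measurableType d) (R : realType).
Variables (mu : {measure set T -> \bar R}) (D : set T).
Hypothesis mD : measurable D.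

Lemma Rintegral_sum (I : Type) (s : seq I) (f : I -> T -> R) :
  (forall i, mu.-integrable D (EFin \o f i)) ->
  mu.-integrable D (EFin \o (fun x => \sum_(i <- s) f i x)) /\
  \int[mu]_(x in D) (\sum_(i <- s) f i x) = \sum_(i <- s) \int[mu]_(x in D) f i x.
Proof.
move=> fi; elim: s => [|i s [IHi IH]].
  have -> : (fun x => \sum_(i <- [::]) f i x) = fun=> 0.
    by apply/funext => x; rewrite big_nil.
  rewrite big_nil; split; first exact: integrable0.
  by rewrite Rintegral_cst// mul0r.
have -> : (fun x => \sum_(j <- i :: s) f j x) = f i \+ (fun x => \sum_(j <- s) f j x).
  by apply/funext => x; rewrite big_cons.
split; first exact: (integrableD mD (fi i) IHi).
by rewrite RintegralD// IH big_cons.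
Qed.

End finite_sums.

Lemma mx_between_qform (R : realType) n (l L : R) (A : 'M[R]_n) : mx_between l L A ->
  forall xi : 'I_n -> R,
    l * \sum_i xi i ^+ 2 <= qform (fun i j => A i j) xi <= L * \sum_i xi i ^+ 2.
Proof.
move=> Ab xi; have := Ab (\row_p xi p); rewrite /enorm sqr_sqrtr; last first.
  by apply: sumr_ge0 => q _; exact: sqr_ge0.
rewrite (eq_bigr (fun p => xi p ^+ 2)) => [|p _]; last by rewrite mxE.
rewrite (_ : \sum_p \sum_q _ = qform (fun p q => A p q) xi)//.
by apply: eq_bigr => p _; apply: eq_bigr => q _; rewrite !mxE.
Qed.

Section cell_estimate.
Variables (R : realType) (n : nat).
Local Notation V := 'rV[R]_n.+1.
Local Notation T := (lebesgue_space R n).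
Local Notation mu := (lebesgueRn R n).
Local Notation I2 := ('I_n.+1 * 'I_n.+1)%type.

(** A single contact point [xb] controls the Hessian in the whole cell. The
    mollified Hessian is an average of [Dw], hence [Dw] oscillating little around
    a constant keeps it nearly constant on the cell; at [xb] itself the bound of
    [pointwise_contact] is averaged over the wide cell. *)
Lemma cell_hessian_bound (U K : set V) (a : V -> 'M[R]_n.+1) (w : V -> R)
    (Dw : 'I_n.+1 -> 'I_n.+1 -> V -> R) (l L kap B : R) N k (xb : V)
    (c : 'I_n.+1 -> 'I_n.+1 -> R) :
  open U -> compact K -> K `<=` U -> 0 < l -> 0 <= L ->
  mu.-integrable (K : set T) (EFin \o (w : T -> R)) ->
  (forall i j, weak_partials U [:: i; j] w (Dw i j)) ->
  (forall i j, mu.-integrable (K : set T) (EFin \o (Dw i j : T -> R))) ->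
  {ae mu, forall x : T, U x -> (a x)^T = a x /\ mx_between l L (a x)} ->
  {ae mu, forall x : T, U x ->
     2 * kap * \sum_i a x i i <= \sum_i \sum_j a x i j * Dw i j x} ->
  0 < mesh B N -> @wide_cell R n B N k `<=` K ->
  (forall x y, @cell R n B N k x -> `|y - x| <= mesh B N -> K y) ->
  @cell R n B N k xb ->
  (forall xi, qform (mhess K w (mesh B N) xb) xi <= 2 * kap * \sum_i xi i ^+ 2) ->
  let t := (cutoff_floor R n * mesh B N ^+ n.+1)^-1 in
  forall x, @cell R n B N k x -> forall i j,
    `|mhess K w (mesh B N) x i j - 2 * kap * (i == j)%:R| <=
    (L / l * (((3 * mesh B N) ^+ n.+1)^-1 + t) + 2 * t) *
    \sum_(p : I2) \int[mu]_(y in (@wide_cell R n B N k : set T)) `|Dw p.1 p.2 y - c p.1 p.2|.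
Proof.
move=> oU cK KU l0 L0 wi wD Dwi ell ineq h0 WK hK kxb Hxb t x kx i j.
set h := mesh B N in h0 hK Hxb t *; set W : set T := @wide_cell R n B N k.
set S := \sum_p _; set om := (3 * h) ^+ n.+1.
have om0 : 0 < om by rewrite exprn_gt0// mulr_gt0.
have t0 : 0 < t by rewrite invr_gt0 mulr_gt0 ?cutoff_floor_gt0 ?exprn_gt0.
have mK : measurable (K : set T) by exact: compact_measurable_Rn.
have Kfin : (mu K < +oo)%E by exact: mu_compact_lty.
have mW : measurable W by exact: measurable_wide_cell.
have muW : mu W = om%:E by exact: mu_wide_cell.
have Wfin : (mu W < +oo)%E by rewrite muW ltry.
pose Sp (p : I2) := \int[mu]_(y in W) `|Dw p.1 p.2 y - c p.1 p.2|.
have Sp0 p : 0 <= Sp p by apply: Rintegral_ge0.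
have SpS p : Sp p <= S.
  rewrite /S -[leRHS]/(\sum_q Sp q) (bigD1 p)//= lerDl.
  by apply: sumr_ge0 => q _; exact: Sp0.
have Spi (p : I2) : mu.-integrable W (EFin \o (fun y : T => `|Dw p.1 p.2 y - c p.1 p.2|)).
  apply: integrable_normr; apply: integrable_subc => //.
  exact: (integrableS mK mW WK (Dwi p.1 p.2)).
have osc z a' b' : @cell R n B N k z -> `|mhess K w h z a' b' - c a' b'| <= t * Sp (a', b').
  move=> kz; rewrite (mhess_weak cK h0 oU KU (wD a' b') (hK z ^~ kz)).
  exact: mollify_oscillation.
have Eb : `|mhess K w h xb i j - 2 * kap * (i == j)%:R| <= L / l * (om^-1 + t) * S.
  pose F (y : T) : R := L * (\sum_p `|Dw p.1 p.2 y - c p.1 p.2| + t * S).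
  have [Si SE] := Rintegral_sum mW (index_enum I2) Spi.
  have Fi0 := integrableD mW Si (integrable_cst_fin (t * S) mW Wfin).
  have Fi : mu.-integrable W (EFin \o F).
    exact: (integrable_mul_bounded mW (measurable_cst L) (fun x _ => lexx `|L|) Fi0).
  have FE : \int[mu]_(y in W) F y = L * (S + t * S * om).
    rewrite RintegralZl// RintegralD//; last exact: integrable_cst_fin.
    by rewrite SE Rintegral_cst// muW.
  have F0 y : W y -> 0 <= F y.
    move=> _; rewrite mulr_ge0// addr_ge0 ?sumr_ge0//.
    by rewrite mulr_ge0 ?(ltW t0)//; apply: sumr_ge0 => p _; exact: Sp0.
  have ae1 : {ae mu, forall y, W y -> l * `|mhess K w h xb i j - 2 * kap * (i == j)%:R| <= F y}.
    apply: filterS2 ell ineq => y ell_y ineq_y Wy.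
    have Uy : U y by apply/KU/WK.
    have [sa ab] := ell_y Uy.
    have := @pointwise_contact R n.+1 (fun p q => a y p q) (mhess K w h xb)
       (fun p q => Dw p q y) l L kap l0.
    move=> /(_ _ _ _ Hxb (ineq_y Uy) i j) hh; apply: le_trans (hh _ _ _) _.
    - by move=> p q; rewrite -[in LHS]sa mxE.
    - by move=> p q; exact: mhessC.
    - exact: mx_between_qform.
    rewrite /F ler_wpM2l// pair_big /= /S mulr_sumr -big_split.
    apply: ler_sum => -[p q] _ /=.
    rewrite -(subrKA (c p q)) (le_trans (ler_normD _ _))// lerD2l distrC.
    exact: osc.
  have h1 := ae_cst_le_Rintegral mW Wfin Fi (mulr_ge0 (ltW l0) (normr_ge0 _)) F0 ae1.
  rewrite FE muW /= in h1.
  have -> : L / l * (om^-1 + t) * S = (L * (S + t * S * om)) / (l * om).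
    by field; rewrite !gt_eqF.
  rewrite ler_pdivlMr ?mulr_gt0//; apply: le_trans h1.
  by rewrite le_eqVlt; apply/orP; left; apply/eqP; ring.
have h1 := osc x i j kx; have h2 := osc xb i j kxb.
have tS : t * Sp (i, j) <= t * S by rewrite ler_wpM2l// ltW.
have tri (X Y z k' e s : R) : `|Y - k'| <= e -> `|X - z| <= s -> `|Y - z| <= s ->
    `|X - k'| <= e + 2 * s.
  rewrite !ler_norml => /andP[? ?] /andP[? ?] /andP[? ?]; apply/andP; split; lra.
rewrite [leRHS]mulrDl -[2 * t * S]mulrA; apply: (tri _ _ _ _ _ _ Eb); [exact: le_trans h1 tS|exact: le_trans h2 tS].
Qed.

End cell_estimate.

(** * Slopes at contact points *)

Section slopes.
Variables (R : realType) (n : nat).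
Local Notation V := 'rV[R]_n.+1.
Local Notation T := (lebesgue_space R n).
Local Notation mu := (lebesgueRn R n).
Local Notation I2 := ('I_n.+1 * 'I_n.+1)%type.

Definition closed_cube (p : V) (r : R) : set V :=
  [set x | forall i, (p - const_mx r) 0 i <= x 0 i <= (p + const_mx r) 0 i].

Lemma measurable_closed_cube p r : measurable (closed_cube p r : set T).
Proof. exact/compact_measurable_Rn/closed_box_compact. Qed.

Lemma mu_closed_cube_le p r : 0 <= r -> (mu (closed_cube p r) <= ((2 * r) ^+ n.+1)%:E)%E.
Proof.
move=> r0; apply/lee_addgt0Pr => e e0.
have [d d0 vd] := box_volume_approx (p - const_mx r) (p + const_mx r) (-1) 1 e0.
apply: (@le_trans _ _ (mu (box (p - const_mx r + const_mx (-1 * d), p + const_mx r + const_mx (1 * d))))).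
  by apply: le_lebesgue_outer => x px i; have := px i; rewrite !mxE; lra.
rewrite mu_box -EFinD lee_fin -lerBlDl (le_trans (ler_norm _))// ltW//.
rewrite (_ : (2 * r) ^+ n.+1 = box_volume (p - const_mx r, p + const_mx r))//.
rewrite /box_volume (eq_bigr (fun=> 2 * r)) ?prodr_const ?card_ord// => i _.
by rewrite !mxE max_r; lra.
Qed.

Lemma sqdist_continuous (c : V) : continuous (sqdist c).
Proof.
apply: continuous_big => [|i _]; first exact: add_continuous.
have h : continuous (fun y : V => y 0 i - c 0 i).
  have hi : continuous (fun y : V => y 0 i) by move=> y; exact: coord_continuous.
  by move=> y; exact: (cvgB (hi y) (cvg_cst (c 0 i))).
by move=> x; exact: (cvgM (h x) (h x)).
Qed.

Lemma dotp_continuous (p : V) : continuous (dotp p).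
Proof.
apply: continuous_big => [|i _]; first exact: add_continuous.
have hi : continuous (fun y : V => y 0 i) by move=> y; exact: coord_continuous.
by move=> x; exact: (cvgM (cvg_cst (p 0 i)) (hi x)).
Qed.

(** The graph of the mollified function is touched from above at [x], to second
    order, by a paraboloid of opening [kap] tilted by the slope [p]. *)
Definition contact_point (K : set V) (w : V -> R) (h kap : R) (c p x : V) :=
  (forall i, p 0 i = mgrad K w h x i - 2 * kap * (x 0 i - c 0 i)) /\
  (forall xi, qform (mhess K w h x) xi <= 2 * kap * \sum_i xi i ^+ 2).

(** Every small slope [p] is attained: tilting by [p] moves the maximum of the
    mollified function only slightly, so it stays in the interior of [A]. *)
Lemma contact_exists (A K : set V) (w : V -> R) (h kap tau B : R) (c x1 p : V) :
  compact A -> compact K -> mu.-integrable (K : set T) (EFin \o (w : T -> R)) -> 0 < h ->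
  A x1 -> (forall x, A x -> `|x| < B) ->
  let v x := w x - kap * sqdist c x in
  tau < v x1 ->
  (forall x, A x -> tau < v x -> A^° x) ->
  (forall x, A x -> `|mollified K w h x - w x| <= (v x1 - tau) / 4) ->
  `|p| * (n.+1%:R * (2 * B)) <= (v x1 - tau) / 4 ->
  exists2 x, A x & contact_point K w h kap c p x.
Proof.
move=> cA cK wi h0 Ax1 AB v tv Aint wclose pB.
have mK : measurable (K : set T) by exact: compact_measurable_Rn.
pose z (x : V) := mollified K w h x - kap * sqdist c x - dotp p x.
have zc : {within A, continuous z}.
  apply: continuous_subspaceT => x.
  have c1 : mollified K w h y @[y --> x] --> mollified K w h x by exact: mollified_continuous.
  have c2 : kap * sqdist c y @[y --> x] --> kap * sqdist c x.
    have c0 : sqdist c y @[y --> x] --> sqdist c x by exact: sqdist_continuous.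
    exact: (cvgM (cvg_cst kap) c0).
  have c3 : dotp p y @[y --> x] --> dotp p x by exact: dotp_continuous.
  have c4 : (mollified K w h y - kap * sqdist c y) @[y --> x] --> mollified K w h x - kap * sqdist c x.
    exact: (cvgB c1 c2).
  exact: (cvgB c4 c3).
have [x /set_mem Ax xmax] := EVT_max_rV (ex_intro _ x1 Ax1) cA zc.
have zx : z x1 <= z x by apply: xmax; exact/mem_set.
have dp : `|dotp p x - dotp p x1| <= (v x1 - tau) / 4.
  apply: le_trans pB; rewrite /dotp -sumrB (le_trans (ler_norm_sum _ _ _))//.
  apply: (@le_trans _ _ (\sum_(i < n.+1) `|p| * (2 * B))).
    apply: ler_sum => i _; rewrite -mulrBr normrM ler_pM ?coord_norm_le//.
    rewrite (le_trans (ler_normB _ _))// mulr_natl mulr2n lerD//.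
      by rewrite (le_trans (coord_norm_le _ _))// ltW// AB.
    by rewrite (le_trans (coord_norm_le _ _))// ltW// AB.
  by rewrite sumr_const card_ord -[leLHS]mulr_natl mulrCA.
have tx : tau < v x.
  have := wclose x Ax; have := wclose x1 Ax1; move: zx dp tv; rewrite /z /v !ler_norml.
  set a := kap * _; set b := kap * _; set q := dotp p x; set q1 := dotp p x1.
  by move=> h1 /andP[h2 h3] h4 /andP[h5 h6] /andP[h7 h8]; lra.
have /nbhs_ballP[del /= d0 xd] := Aint x Ax tx.
have [C C0 hC] := mollified_taylor cK wi h0.
exists x => //.
apply: (@contact_test R n (mollified K w h) (mgrad K w h x) (mhess K w h x) C kap del c p x C0 d0).
  by move=> y; exact: hC.
move=> y yd; apply: xmax; apply/mem_set; apply: xd.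
by rewrite mx_norm_ball /ball_ /= opprD addrA subrr sub0r normrN.
Qed.

(** The slope varies on the cell by at most the bound on [mhess - 2 * kap * 1]
    times the diameter. *)
Lemma contact_slopes_close (K : set V) (w : V -> R) (B kap M : R) N k (c p p' x x' : V) :
  compact K -> mu.-integrable (K : set T) (EFin \o (w : T -> R)) ->
  0 < mesh B N -> 0 <= M ->
  @cell R n B N k x -> @cell R n B N k x' ->
  contact_point K w (mesh B N) kap c p x -> contact_point K w (mesh B N) kap c p' x' ->
  (forall y, @cell R n B N k y -> forall i j,
     `|mhess K w (mesh B N) y i j - 2 * kap * (i == j)%:R| <= M) ->
  closed_cube p (n.+1%:R * mesh B N * M) p'.
Proof.
move=> cK wi h0 M0 kx kx' [px _] [px' _] HM i.
set h := mesh B N in h0 px px' HM *.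
have := @mgrad_diff R n K w cK wi h x x' i kap M h0.
rewrite !mxE px px' => hd.
have {hd} : `|(mgrad K w h x' i - 2 * kap * x' 0 i) - (mgrad K w h x i - 2 * kap * x 0 i)|
    <= n.+1%:R * h * M.
  apply: (@le_trans _ _ (n.+1%:R * `|x' - x| * M)).
    apply: hd => t t01 j; rewrite [j == i]eq_sym; apply: HM.
    exact: cell_convex.
  by rewrite ler_wpM2r// ler_wpM2l//; exact: cell_dist kx kx'.
by rewrite ler_norml => /andP[h1 h2]; apply/andP; split; lra.
Qed.

(** The radius of the cube of slopes is a multiple of [h / h ^+ n.+1] times the
    integral of the oscillation. Raised to the power [n.+1] and estimated by
    [power_mean], it leaves a constant that does not depend on [h]: this is where
    the integrability exponent [n.+1] enters. *)
Lemma cell_slope_volume (W : set T) (f : I2 -> T -> R) (L l h fl : R) :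
  measurable W -> mu W = ((3 * h) ^+ n.+1)%:E -> 0 < h -> 0 < fl -> 0 <= L -> 0 < l ->
  (forall p, mu.-integrable W (EFin \o f p)) ->
  (forall p x, 0 <= f p x) ->
  (forall p, mu.-integrable W (EFin \o (fun x => f p x ^+ n.+1))) ->
  forall t, t = (fl * h ^+ n.+1)^-1 ->
  (2 * (n.+1%:R * h * ((L / l * (((3 * h) ^+ n.+1)^-1 + t) + 2 * t) *
     \sum_p \int[mu]_(y in W) f p y))) ^+ n.+1 <=
  (2 * n.+1%:R * (L / l * ((3 ^+ n.+1)^-1 + fl^-1) + 2 * fl^-1)) ^+ n.+1 *
    (#|{: I2}|%:R ^+ n.+1 * (2 ^+ n.+1 * 3 ^+ (n.+1 * n))) *
    \sum_p \int[mu]_(y in W) (f p y ^+ n.+1).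
Proof.
move=> mW muW h0 fl0 L0 l0 fi f0 fpi _ ->.
set t := (fl * _)^-1; set ka := L / l * ((3 ^+ n.+1)^-1 + fl^-1) + 2 * fl^-1.
have Wfin : (mu W < +oo)%E by rewrite muW ltry.
have hd0 : 0 < h ^+ n.+1 by rewrite exprn_gt0.
have -> : L / l * (((3 * h) ^+ n.+1)^-1 + t) + 2 * t = ka / h ^+ n.+1.
  by rewrite /t /ka exprMn !invfM; ring.
set S := \sum_p _; set Y := \sum_p _.
have ka0 : 0 <= ka.
  rewrite /ka addr_ge0// ?mulr_ge0 ?invr_ge0 ?(ltW fl0)// ?(ltW l0)//.
  by rewrite addr_ge0// invr_ge0 ?exprn_ge0// ltW.
have S0 : 0 <= S by apply: sumr_ge0 => p _; apply: Rintegral_ge0.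
have SY : S ^+ n.+1 <= #|{: I2}|%:R ^+ n.+1 * (2 ^+ n.+1 * (3 ^+ (n.+1 * n) * h ^+ (n.+1 * n)) * Y).
  apply: (le_trans (@pow_sum_le R I2 (ord0, ord0) _ n.+1 _)).
    by move=> p; apply: Rintegral_ge0.
  rewrite ler_wpM2l ?exprn_ge0// /Y mulr_sumr; apply: ler_sum => p _.
  have := power_mean mW Wfin _ (fi p) (fun x _ => f0 p x) (fpi p).
  rewrite muW /= -exprM -[3 ^+ _ * h ^+ (_ * _)]exprMn; apply.
  by rewrite exprn_gt0// mulr_gt0.
have -> : 2 * (n.+1%:R * h * (ka / h ^+ n.+1 * S)) = (2 * n.+1%:R * ka) * (h / h ^+ n.+1 * S).
  by ring.
rewrite exprMn -!mulrA; apply: ler_wpM2l; first by rewrite exprn_ge0// !mulr_ge0.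
rewrite mulrA exprMn; apply: le_trans (ler_wpM2l _ SY) _.
  by rewrite exprn_ge0// divr_ge0 ?exprn_ge0 ?(ltW h0).
have hh : (h / h ^+ n.+1) ^+ n.+1 * h ^+ (n.+1 * n) = 1.
  have e : h / h ^+ n.+1 * h ^+ n = 1.
    by rewrite mulrAC -exprS mulfV// gt_eqF.
  by rewrite mulnC exprM -exprMn e expr1n.
rewrite le_eqVlt; apply/orP; left; apply/eqP.
rewrite (_ : (h / h ^+ n.+1) ^+ n.+1 * _ = ((h / h ^+ n.+1) ^+ n.+1 * h ^+ (n.+1 * n)) *
   (#|{: I2}|%:R ^+ n.+1 * (2 ^+ n.+1 * (3 ^+ (n.+1 * n) * Y)))); last by ring.
by rewrite hh mul1r !mulrA.
Qed.

End slopes.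

(** * The maximum principle *)

Section covering_measure.
Context d (T : measurableType d) (R : realType).
Variable mu : {measure set T -> \bar R}.

Lemma integrable_distX (D : set T) (f : T -> R) (c : R) (q : nat) : measurable D ->
  mu.-integrable D (EFin \o f) -> (\int[mu]_(x in D) (`|f x - c| ^+ q)%:E < +oo)%E ->
  mu.-integrable D (EFin \o (fun x => `|f x - c| ^+ q)).
Proof.
move=> mD fi ffin.
have mf : measurable_fun D f by apply/measurable_EFinP; have [] := integrableP _ _ _ fi.
apply/integrableP; split.
  have := @measurable_distX _ T R D f (fun=> c) 0 q mf (measurable_cst c).
  by apply: eq_measurable_fun => x _; rewrite /= addr0.
apply: le_lt_trans ffin; rewrite le_eqVlt; apply/orP; left; apply/eqP.
by apply: eq_integral => x _ /=; rewrite ger0_norm// exprn_ge0.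
Qed.

Lemma measure_cover (I : finType) (P : pred I) (Q : I -> set T) (K : set T) :
  measurable K -> (forall k, P k -> measurable (Q k)) ->
  (forall x, K x -> exists k, P k /\ Q k x) -> (mu K <= \sum_(k | P k) mu (Q k))%E.
Proof.
move=> mK mQ cov.
have m1 : measurable_fun [set: T] (fun=> 1 : R) by exact: measurable_cst.
have := @cover_sum _ T R mu I P Q K setT (fun=> 1) mK measurableT (@subsetT _ _)
  (fun k Pk => conj (mQ k Pk) (@subsetT _ _)) (fun _ _ => ler01) m1 cov.
rewrite integral_cst// mul1e => h; apply: (le_trans h).
by apply: lee_sum => k Pk; rewrite integral_cst ?mul1e//; exact: mQ.
Qed.

End covering_measure.

Section maximum_principle.
Variables (R : realType) (n : nat).
Local Notation V := 'rV[R]_n.+1.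
Local Notation T := (lebesgue_space R n).
Local Notation mu := (lebesgueRn R n).
Local Notation I2 := ('I_n.+1 * 'I_n.+1)%type.

Definition slope_constant (l L : R) : R :=
  (2 * n.+1%:R * (L / l * ((3 ^+ n.+1)^-1 + (cutoff_floor R n)^-1) +
     2 * (cutoff_floor R n)^-1)) ^+ n.+1 *
  (#|{: I2}|%:R ^+ n.+1 * (2 ^+ n.+1 * 3 ^+ (n.+1 * n))).

Lemma slope_constant_ge0 (l L : R) : 0 < l -> 0 <= L -> 0 <= slope_constant l L.
Proof.
move=> l0 L0; have fl0 := cutoff_floor_gt0 R n.
rewrite mulr_ge0 ?exprn_ge0 ?mulr_ge0 ?exprn_ge0//.
rewrite addr_ge0 ?mulr_ge0 ?divr_ge0 ?invr_ge0 ?(ltW fl0) ?(ltW l0)//.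
by rewrite addr_ge0 ?invr_ge0 ?exprn_ge0 ?(ltW fl0).
Qed.

Section fixed_mesh.
Variables (U K A : set V) (a : V -> 'M[R]_n.+1) (w : V -> R).
Variables (Dw : 'I_n.+1 -> 'I_n.+1 -> V -> R) (l L kap B h0 del : R) (N : nat) (c0 : V).
Variable c : 'I_n.+1 -> 'I_n.+1 -> {ffun 'I_n.+1 -> 'I_N} -> R.
Hypotheses (oU : open U) (cK : compact K) (KU : K `<=` U) (l0 : 0 < l) (L0 : 0 <= L).
Hypothesis wi : mu.-integrable (K : set T) (EFin \o (w : T -> R)).
Hypothesis wD : forall i j, weak_partials U [:: i; j] w (Dw i j).
Hypothesis Dwi : forall i j, mu.-integrable (K : set T) (EFin \o (Dw i j : T -> R)).
Hypothesis ell : {ae mu, forall x : T, U x -> (a x)^T = a x /\ mx_between l L (a x)}.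
Hypothesis ineq : {ae mu, forall x : T, U x ->
  2 * kap * \sum_i a x i i <= \sum_i \sum_j a x i j * Dw i j x}.
Hypotheses (B0 : 0 < B) (N0 : (0 < N)%N) (AB : forall x, A x -> `|x| < B).
Hypothesis AK : forall x y, A x -> `|y - x| <= h0 -> K y.
Hypothesis hh0 : 2 * mesh B N <= h0.
Hypothesis contacts : forall p : V, (forall i, `|p 0 i| <= del) ->
  exists2 x, A x & contact_point K w (mesh B N) kap c0 p x.
Hypothesis fin : forall i j k, @wide_cell R n B N k `<=` K ->
  (\int[mu]_(x in (@wide_cell R n B N k : set T)) (`|Dw i j x - c i j k| ^+ n.+1)%:E < +oo)%E.

Let h := mesh B N.
Let W k : set T := @wide_cell R n B N k.
Let Y k : R := \sum_(p : I2) \int[mu]_(y in W k) (`|Dw p.1 p.2 y - c p.1 p.2 k| ^+ n.+1).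
Let t := (cutoff_floor R n * h ^+ n.+1)^-1.
Let M k : R := (L / l * (((3 * h) ^+ n.+1)^-1 + t) + 2 * t) *
    \sum_(p : I2) \int[mu]_(y in W k) `|Dw p.1 p.2 y - c p.1 p.2 k|.
Let touches k p := exists2 x, A x /\ @cell R n B N k x & contact_point K w h kap c0 p x.

Let h_gt0 : 0 < h. Proof. exact: mesh_gt0. Qed.

(** Only cells meeting the compact set [A] matter, and [A] stays at distance [h0]
    from the complement of [K]. *)
Lemma touched_cell_sub k p : touches k p -> W k `<=` K.
Proof.
move=> [x [Ax kx] _]; exact: (@wide_cell_sub R n A K h0 B N k x AK h_gt0 hh0 Ax kx).
Qed.

Let fl0 : 0 < cutoff_floor R n := cutoff_floor_gt0 R n.

Lemma radius_ge0 k : 0 <= M k.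
Proof.
have t0 : 0 < t by rewrite invr_gt0 mulr_gt0 ?exprn_gt0.
apply: mulr_ge0; last first.
  by apply: sumr_ge0 => p _; apply: Rintegral_ge0 => y _; exact: normr_ge0.
rewrite addr_ge0//; last by rewrite mulr_ge0// ltW.
rewrite mulr_ge0 ?divr_ge0 ?(ltW l0)// addr_ge0 ?(ltW t0)// invr_ge0 exprn_ge0//.
by rewrite mulr_ge0// ltW.
Qed.

Lemma touching_slopes_close k p p' : touches k p -> touches k p' ->
  closed_cube p (n.+1%:R * h * M k) p'.
Proof.
move=> tk [x' [Ax' kx'] ctx']; have WK := touched_cell_sub tk.
have [x [Ax kx] ctx] := tk.
apply: (@contact_slopes_close R n K w B kap (M k) N k c0 p p' x x' cK wi h_gt0 _ kx kx' ctx ctx').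
  exact: radius_ge0.
move=> y ky i j.
apply: (@cell_hessian_bound R n U K a w Dw l L kap B N k x (fun i j => c i j k)
  oU cK KU l0 L0 wi wD Dwi ell ineq h_gt0 WK _ kx ctx.2 y ky i j).
move=> z y' kz y'z; apply: (AK Ax); rewrite -(subrKA z) (le_trans (ler_normD _ _))//.
apply: le_trans hh0; rewrite [leRHS]mulrDl !mul1r lerD//.
exact: cell_dist h_gt0 kx kz.
Qed.

Let Wfin k : (mu (W k) < +oo)%E.
Proof. by rewrite (mu_wide_cell k h_gt0) ltry. Qed.

Let mW k : measurable (W k). Proof. exact: measurable_wide_cell. Qed.

Let mK : measurable (K : set T). Proof. exact: compact_measurable_Rn. Qed.

Let osc_integrable k : W k `<=` K -> forall p : I2,
  mu.-integrable (W k) (EFin \o (fun y : T => `|Dw p.1 p.2 y - c p.1 p.2 k|)) /\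
  mu.-integrable (W k) (EFin \o (fun y : T => `|Dw p.1 p.2 y - c p.1 p.2 k| ^+ n.+1)).
Proof.
move=> WK p; have Dwk := integrableS mK (mW k) WK (Dwi p.1 p.2).
split; last first.
  exact: (@integrable_distX _ T R mu (W k) (Dw p.1 p.2) (c p.1 p.2 k) n.+1 (mW k) Dwk (fin p.1 p.2 WK)).
exact/integrable_normr/integrable_subc.
Qed.

Lemma touched_volume k : W k `<=` K ->
  (2 * (n.+1%:R * h * M k)) ^+ n.+1 <= slope_constant l L * Y k.
Proof.
move=> WK; have Di := osc_integrable WK.
exact: (@cell_slope_volume R n (W k) (fun p y => `|Dw p.1 p.2 y - c p.1 p.2 k|) L l h
  (cutoff_floor R n) (mW k) (mu_wide_cell k h_gt0) h_gt0 fl0 L0 l0 (fun p => (Di p).1)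
  (fun p y => normr_ge0 _) (fun p => (Di p).2) t erefl).
Qed.

(** Every slope in the cube of radius [del] is attained in some cell, and the
    slopes attained in one cell lie in a cube of controlled volume. *)
Lemma slope_volume : 0 <= del ->
  (((2 * del) ^+ n.+1)%:E <= (slope_constant l L)%:E *
    \sum_(p : I2) \sum_(k | `[< @wide_cell R n B N k `<=` K >])
      \int[mu]_(x in (@wide_cell R n B N k : set T))
        (`|Dw p.1 p.2 x - c p.1 p.2 k| ^+ n.+1)%:E)%E.
Proof.
move=> del0.
have /choice[pk pkP] : forall k, exists p, forall q, touches k q ->
    closed_cube p (n.+1%:R * h * M k) q.
  move=> k; have [[p tp]|nt] := pselect (exists p, touches k p).
    by exists p => q; exact: touching_slopes_close.
  by exists 0 => q tq; case: nt; exists q.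
pose P := [pred k | `[< exists p, touches k p >]].
have PK k : P k -> W k `<=` K by move=> /asboolP[p /touched_cell_sub].
pose S : set T := box ((0 : V) - const_mx del, (0 : V) + const_mx del).
have r0 k : 0 <= n.+1%:R * h * M k by apply: mulr_ge0; [rewrite mulr_ge0// ltW|exact: radius_ge0].
have covS p : S p -> exists k, P k /\ closed_cube (pk k) (n.+1%:R * h * M k) p.
  move=> Sp.
  have [|x Ax ctx] := contacts (p := p).
    by move=> i; have := Sp i; rewrite /= !mxE sub0r add0r ler_norml => /andP[/ltW -> ->].
  have [k kx] := cell_cover B0 N0 (AB Ax).
  have tk : touches k p by exists x.
  by exists k; split; [apply/asboolP; exists p|exact: pkP].
have := @measure_cover _ T R mu _ P (fun k => closed_cube (pk k) (n.+1%:R * h * M k)) S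
  (measurable_box _) (fun k _ => @measurable_closed_cube R n _ _) covS.
rewrite /S mu_cube// => h1; apply: (le_trans h1) => {h1}.
apply: (@le_trans _ _ (\sum_(k | P k) (slope_constant l L * Y k)%:E)%E).
  apply: lee_sum => k Pk; apply: (le_trans (mu_closed_cube_le _ (r0 k))).
  by rewrite lee_fin; exact: touched_volume (PK k Pk).
have sc0 := slope_constant_ge0 l0 L0.
rewrite (eq_bigr (fun k => (slope_constant l L)%:E * (Y k)%:E)%E) => [|k _]; last by rewrite EFinM.
rewrite -ge0_sume_distrr; last first.
  by move=> k _; rewrite lee_fin sumr_ge0// => p _; apply: Rintegral_ge0 => y _; rewrite exprn_ge0.
apply: lee_wpmul2l; first by rewrite lee_fin.
rewrite exchange_big /=.
apply: (@le_trans _ _ (\sum_(k | P k) \sum_(p : I2)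
   \int[mu]_(x in W k) (`|Dw p.1 p.2 x - c p.1 p.2 k| ^+ n.+1)%:E)%E).
  apply: lee_sum => k Pk; rewrite -sumEFin; apply: lee_sum => p _.
  have [_ h2] := osc_integrable (PK k Pk) p.
  by rewrite (EFin_Rintegral (mW k) h2).
apply: (@le_sum_pred _ _ P) => [k /PK WK|k]; first exact/asboolP.
by apply: sume_ge0 => p _; apply: integral_ge0 => x _; rewrite lee_fin exprn_ge0.
Qed.

End fixed_mesh.
End maximum_principle.

Section maximum_principle.
Variables (R : realType) (n : nat).
Local Notation V := 'rV[R]_n.+1.
Local Notation T := (lebesgue_space R n).
Local Notation mu := (lebesgueRn R n).
Local Notation I2 := ('I_n.+1 * 'I_n.+1)%type.

Lemma mollified_close (K : set V) (w : V -> R) (h e : R) (x : V) : compact K ->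
  mu.-integrable (K : set T) (EFin \o (w : T -> R)) -> 0 < h -> 0 <= e ->
  (forall y, `|y - x| <= h -> K y /\ `|w y - w x| <= e) ->
  `|mollified K w h x - w x| <= e.
Proof.
move=> cK wi h0 e0 Kh.
have mK : measurable (K : set T) by exact: compact_measurable_Rn.
have Kfin : (mu K < +oo)%E by exact: mu_compact_lty.
have mb : measurable_fun (K : set T) (fun y : T => beval (cutoff n h) (x - (y : V))).
  by apply: measurable_funTS; exact: measurable_beval.
refine (@average_close _ T R mu K w mK wi _ (cutoff_mass n h) (w x) e Kfin mb _ _ _ e0 _).
- by move=> y; rewrite cutoff_ge0 cutoff_le1.
- by apply: cutoff_integral => // y /ltW /Kh[].
- exact: cutoff_mass_gt0.
- by move=> y _ /(cutoff_support h0); rewrite distrC => /ltW /Kh[].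
Qed.

Lemma common_grid (K : set T) (f : I2 -> T -> R) (B e : R) N1 :
  measurable K -> (mu K < +oo)%E -> (forall p, measurable_fun K (f p)) ->
  (forall p, (\int[mu]_(x in K) (`|f p x| ^+ n.+1)%:E < +oo)%E) -> 0 < B -> 0 < e ->
  exists N (c : I2 -> {ffun 'I_n.+1 -> 'I_N} -> R), [/\ (N1 <= N)%N, (0 < N)%N & forall p,
    (\sum_(k | `[< @wide_cell R n B N k `<=` K >])
      \int[mu]_(x in @wide_cell R n B N k) (`|f p x - c p k| ^+ n.+1)%:E <= e%:E)%E].
Proof.
move=> mK Kfin mf ff B0 e0.
have /choice[N0 N0P] := fun p => grid_oscillation mK Kfin (mf p) (ff p) B0 e0.
pose N := (N1 + \max_p N0 p).+1.
have N0N p : (N0 p <= N)%N.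
  by rewrite leqW// (leq_trans (leq_bigmax p))// leq_addl.
have /choice[c cP] := fun p => N0P p N (N0N p) isT.
by exists N, c; split => //; rewrite leqW// leq_addr.
Qed.

(** Otherwise all slopes of size at most [del] are attained by every mollification
    at a fine scale, whereas [slope_volume] bounds the volume of these slopes by
    the oscillation of [Dw] at that scale, which tends to 0. *)
Lemma max_principle (U A : set V) (a : V -> 'M[R]_n.+1) (w : V -> R)
    (Dw : 'I_n.+1 -> 'I_n.+1 -> V -> R) (l L kap tau : R) (c0 x1 : V) :
  open U -> compact A -> A `<=` U -> 0 < l -> 0 <= L ->
  (forall x, A x -> {for x, continuous w}) ->
  (forall i j, weak_partials U [:: i; j] w (Dw i j)) ->
  (forall i j K, compact K -> K `<=` U ->
    (\int[mu]_(x in (K : set T)) (`|Dw i j x| ^+ n.+1)%:E < +oo)%E) ->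
  {ae mu, forall x : T, U x -> (a x)^T = a x /\ mx_between l L (a x)} ->
  {ae mu, forall x : T, U x ->
     2 * kap * \sum_i a x i i <= \sum_i \sum_j a x i j * Dw i j x} ->
  A x1 -> tau < w x1 - kap * sqdist c0 x1 ->
  exists2 x, A x & tau < w x - kap * sqdist c0 x /\ ~ A^° x.
Proof.
move=> oU cA AU l0 L0 wc wD Dfin ell ineq Ax1 tx1; apply: contrapT => noint.
have Aint x : A x -> tau < w x - kap * sqdist c0 x -> A^° x.
  by move=> Ax tx; apply: contrapT => nx; apply: noint; exists x.
have [h0 [K [h00 cK KU AK]]] := compact_thickening cA oU AU.
have [B B0 AB] := compact_norm_lt cA.
have mK : measurable (K : set T) by exact: compact_measurable_Rn.
have Kfin : (mu K < +oo)%E by exact: mu_compact_lty.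
have wi : mu.-integrable (K : set T) (EFin \o (w : T -> R)).
  by have [wU _ _] := wD ord0 ord0; exact: L1_loc_integrable wU cK KU.
have Dwi i j : mu.-integrable (K : set T) (EFin \o (Dw i j : T -> R)).
  by have [_ DU _] := wD i j; exact: L1_loc_integrable DU cK KU.
set g := w x1 - kap * sqdist c0 x1 - tau.
have g0 : 0 < g by rewrite subr_gt0.
have g40 : 0 < g / 4 by rewrite divr_gt0.
have [h1 h10 wh1] := compact_uniform_continuous cA wc g40.
(* A slope of this size changes the function by at most g / 4 on A. *)
pose del := g / 4 / (n.+1%:R * (2 * B)).
have dB0 : 0 < n.+1%:R * (2 * B) by rewrite !mulr_gt0.
have del0 : 0 < del by rewrite divr_gt0.
set sc := slope_constant n l L.
have sc0 : 0 <= sc by exact: slope_constant_ge0.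
(* With the oscillations below e, the slopes fill less than the cube of radius del. *)
pose e := (2 * del) ^+ n.+1 / (sc * #|{: I2}|%:R + 1).
have q0 : 0 < sc * #|{: I2}|%:R + 1 by rewrite ltr_wpDl// mulr_ge0.
have d0 : 0 < (2 * del) ^+ n.+1 by rewrite exprn_gt0// mulr_gt0.
have e0 : 0 < e by rewrite divr_gt0.
have m0 : 0 < Num.min (h0 / 2) h1 by rewrite lt_min h10 divr_gt0.
have [N1 N1P] := mesh_small B0 m0.
have mf (p : I2) : measurable_fun (K : set T) (Dw p.1 p.2 : T -> R).
  by apply/measurable_EFinP; have [] := integrableP _ _ _ (Dwi p.1 p.2).
have [N [c [N1N Npos cP]]] := @common_grid K (fun p => Dw p.1 p.2) B e N1 mK Kfin mf
  (fun p => Dfin p.1 p.2 K cK KU) B0 e0.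
have [_] := N1P N N1N; rewrite le_min => /andP[mh0 mh1].
have mpos := mesh_gt0 B0 Npos.
have contacts (p : V) : (forall i, `|p 0 i| <= del) ->
    exists2 x, A x & contact_point K w (mesh B N) kap c0 p x.
  move=> /norm_rV_leP pd.
  apply: (@contact_exists R n A K w (mesh B N) kap tau B c0 x1 p cA cK wi mpos Ax1 AB tx1 Aint).
    move=> x Ax; apply: (mollified_close cK wi mpos (ltW g40)) => y yx; split.
      apply: (AK x) => //; rewrite (le_trans yx)//; move: mh0 h00; lra.
    by apply: wh1 => //; exact: le_trans yx mh1.
  by rewrite -ler_pdivlMr.
have dist_ge0 (p : I2) k :
  (0 <= \int[mu]_(x in (@wide_cell R n B N k : set T)) (`|Dw p.1 p.2 x - c p k| ^+ n.+1)%:E)%E.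
  by apply: integral_ge0 => x _; rewrite lee_fin exprn_ge0.
have fin i j k : @wide_cell R n B N k `<=` K ->
    (\int[mu]_(x in (@wide_cell R n B N k : set T)) (`|Dw i j x - c (i, j) k| ^+ n.+1)%:E < +oo)%E.
  move=> WK; apply: (@le_lt_trans _ _ e%:E); last exact: ltry.
  apply: le_trans (cP (i, j)); rewrite (bigD1 k) /=; last exact/asboolP.
  by apply: leeDl; apply: sume_ge0 => k' _; exact: (dist_ge0 (i, j) k').
have mh02 : 2 * mesh B N <= h0 by move: mh0; lra.
have := @slope_volume R n U K A a w Dw l L kap B h0 del N c0 (fun i j => c (i, j)) oU cK KU l0 L0
  wi wD Dwi ell ineq B0 Npos AB AK mh02 contacts fin (ltW del0).
apply/negP; rewrite -ltNge.
apply: (@le_lt_trans _ _ (sc%:E * \sum_(p : I2) e%:E)%E).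
  apply: lee_wpmul2l; first by rewrite lee_fin.
  by apply: lee_sum => -[i j] _; exact: cP.
rewrite sumEFin -EFinM lte_fin sumr_const -[X in sc * X]mulr_natl mulrA.
rewrite /e mulrCA -[ltRHS]mulr1 ltr_pM2l//.
by rewrite ltr_pdivrMr// mul1r ltrDl.
Qed.

End maximum_principle.

(** * Weak derivatives *)

Section Lp_inclusion.
Context d (T : measurableType d) (R : realType).
Variable mu : {measure set T -> \bar R}.

Lemma Lfun_power_lty (K : set T) (f : T -> R) (p : \bar R) (q : nat) :
  measurable K -> (mu K < +oo)%E -> f \in Lfun mu p -> (q.+1%:R%:E <= p)%E ->
  (\int[mu]_(x in K) (`|f x| ^+ q.+1)%:E < +oo)%E.
Proof.
move=> mK Kfin fp qp.
have mf : measurable_fun setT f by move: fp; rewrite inE => /andP[]; rewrite inE.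
have mfq : measurable_fun K (fun x => (`|f x| ^+ q.+1)%:E).
  apply/measurable_EFinP/measurable_funTS; apply: measurable_funX.
  exact: measurableT_comp.
case: p fp qp => [r fr|fy _|//].
  rewrite lee_fin => qr.
  have r1 : 1 <= r by apply: le_trans qr; rewrite ler1n.
  have fri := integrableS measurableT mK (@subsetT _ _) (Lfun_integrable r1 fr).
  have gi := integrableD mK (integrable_cst_fin 1 mK Kfin) fri.
  apply: (le_lt_trans _ (integrable_lty mK gi)).
  have [mg _] := integrableP _ _ _ gi.
  apply: ge0_le_integral => //.
  move=> x _ /=; rewrite -EFinD lee_fin.
  have [f1|f1] := leP `|f x| 1.
    have : `|f x| ^+ q.+1 <= 1 by apply: exprn_ile1.
    by move=> /le_trans; apply; rewrite lerDl powR_ge0.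
  by rewrite -powR_mulrn// (le_trans (ler_powR (ltW f1) qr))// lerDr.
have [M fM] : exists M, {ae mu, forall x, `|f x| <= M}.
  have [mu0|mu0] := eqVneq (mu setT) 0%E.
    exists 0; exists setT; split => //; exact: measurableT.
  move: fy; rewrite inE => /andP[_]; rewrite inE /= /finite_norm unlock /Lnorm.
  rewrite lt0e mu0 measure_ge0 /= => /ess_supr_bounded[M fM]; exists M.
  by apply: filterS fM.
apply: (@le_lt_trans _ _ (\int[mu]_(x in K) (`|M| ^+ q.+1)%:E)%E).
  apply: ae_ge0_le_integral => //.
  apply: (filterS _ fM) => x fx _; rewrite lee_fin lerXn2r ?nnegrE//.
  exact: le_trans fx (ler_norm M).
by rewrite integral_cst// lte_mul_pinfty// lee_fin exprn_ge0.
Qed.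

End Lp_inclusion.

Section weak_derivatives.
Variables (R : realType) (n : nat).
Local Notation V := 'rV[R]_n.+1.
Local Notation T := (lebesgue_space R n).
Local Notation mu := (lebesgueRn R n).

(** A function vanishing near a point has vanishing derivatives there. *)
Lemma partials_support (phi : V -> R) s (x : V) :
  partials s phi x != 0 -> closure [set y | phi y != 0] x.
Proof.
apply: contraPP => nx; apply/negP; rewrite negbK; apply/eqP.
suff : \forall z \near x, partials s phi z = 0 by move/nbhs_singleton.
elim: s => /= [|i s IH].
  have : nbhs x (~` closure [set y | phi y != 0]).
    by apply: open_nbhs_nbhs; split => //; apply: closed_openC; exact: closed_closure.
  apply: filterS => z nz; apply/eqP/negPn/negP => pz; apply: nz.
  exact: subset_closure.
have := near_join IH; apply: filterS => z Hz.
rewrite (near_eq_derive (g := cst 0)) ?derive_cst//.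
Qed.

Lemma test_function_bounded (U : set V) (phi : V -> R) : test_function U phi ->
  continuous phi /\ exists C, forall x, `|phi x| <= C.
Proof.
move=> [sphi cphi _].
have phic : continuous phi by move=> x; apply: differentiable_continuous; exact: (sphi [::]).
split=> //.
have : compact (phi @` closure [set x | phi x != 0]).
  by apply: continuous_compact => //; exact: continuous_subspaceT.
move=> /compact_bounded[M [_ h]]; exists (`|M| + 1) => x.
have [->|px] := eqVneq (phi x) 0; first by rewrite normr0 addr_ge0.
apply: (h (`|M| + 1)); first by rewrite ltr_pwDr// ler_norm.
by exists x => //; apply: subset_closure.
Qed.

Lemma test_integral (U : set V) (v phi : V -> R) : open U -> Lp_loc 1%E U v ->
  test_function U phi ->
  let K := closure [set x | phi x != 0] in
  \int[mu]_(x in (U : set T)) (v x * phi x) = \int[mu]_(x in (K : set T)) (phi x * v x) /\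
  mu.-integrable (K : set T) (EFin \o (fun x : T => phi x * v x)).
Proof.
move=> oU vU tphi K; have [_ cK KU] := tphi.
have [phic [C hC]] := test_function_bounded tphi.
have mK : measurable (K : set T) by exact: compact_measurable_Rn.
have mU : measurable (U : set T) by exact: open_measurable_Rn.
split.
  rewrite (@Rintegral_restrict0 _ T R mu U K _ mU mK KU).
    by congr Rintegral; apply/funext => y; rewrite mulrC.
  move=> y _ nKy; have [->|py] := eqVneq (phi y) 0; first exact: mulr0.
  by case: nKy; exact: subset_closure.
have mphi : measurable_fun (K : set T) (phi : T -> R).
  by apply: measurable_funTS; exact: continuous_measurable_Rn.
exact: (@integrable_mul_bounded _ T R mu K phi v C mK mphi (fun x _ => hC x)
  (L1_loc_integrable vU cK KU)).
Qed.

(** The difference of two representatives integrates to 0 against every test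
    function. *)
Lemma weak_partials_unique (U : set V) s (u v v' : V -> R) : open U ->
  weak_partials U s u v -> weak_partials U s u v' ->
  forall K : set V, compact K -> K `<=` U -> {ae mu, forall x : T, K x -> v x = v' x}.
Proof.
move=> oU [_ v1 vP] [_ v'1 v'P] K cK KU.
have d1 : Lp_loc 1%E U (fun x => v x - v' x).
  move=> K' cK' K'U.
  have mK' : measurable (K' : set T) by exact: compact_measurable_Rn.
  have h := integrableB mK' (L1_loc_integrable v1 cK' K'U) (L1_loc_integrable v'1 cK' K'U).
  apply/Lfun1_integrable; rewrite -restrict_EFin.
  exact/(integrable_mkcond _ mK').
have dphi phi : test_function U phi ->
    \int[mu]_(x in (U : set T)) ((v x - v' x) * phi x) = 0.
  move=> tphi; have [_ cK' K'U] := tphi.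
  have [e1 _] := test_integral oU d1 tphi; rewrite e1 {e1}.
  have [e2 i2] := test_integral oU v1 tphi; have [e3 i3] := test_integral oU v'1 tphi.
  have mK' := @compact_measurable_Rn R n _ cK'.
  have -> : (fun x : T => phi x * (v x - v' x)) = (fun x => phi x * v x - phi x * v' x).
    by apply/funext => x; rewrite mulrBr.
  rewrite (RintegralB mK' i2 i3) -e2 -e3.
  apply/eqP; rewrite subr_eq0; apply/eqP.
  have := vP _ tphi; rewrite (v'P _ tphi) => /esym.
  by apply: mulfI; rewrite expf_neq0// oppr_eq0 oner_eq0.
have := weak_zero oU d1 dphi cK KU; apply: filterS => x h Kx.
by apply/eqP; rewrite -subr_eq0; apply/eqP/h.
Qed.

Lemma Lp_loc_sub p (U U' : set V) (f : V -> R) : U' `<=` U -> Lp_loc p U f -> Lp_loc p U' f.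
Proof. by move=> UU fU K cK KU; apply: fU => //; exact: subset_trans UU. Qed.

Lemma weak_partials_sub (U U' : set V) s (u v : V -> R) : open U -> open U' -> U' `<=` U ->
  weak_partials U s u v -> weak_partials U' s u v.
Proof.
move=> oU oU' UU [u1 v1 P]; split; [exact: Lp_loc_sub UU u1|exact: Lp_loc_sub UU v1|].
move=> phi [sphi cphi phiU'].
have tphi : test_function U phi by split => //; exact: subset_trans UU.
have mU : measurable (U : set T) by exact: open_measurable_Rn.
have mU' : measurable (U' : set T) by exact: open_measurable_Rn.
have off (g f : V -> R) : (forall x, g x != 0 -> closure [set y | phi y != 0] x) ->
    \int[mu]_(x in (U' : set T)) (f x * g x) = \int[mu]_(x in (U : set T)) (f x * g x).
  move=> gphi; rewrite (@Rintegral_restrict0 _ T R mu U U' _ mU mU' UU)// => x _ nx.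
  have [->|gx] := eqVneq (g x) 0; first exact: mulr0.
  by case: nx; apply: phiU'; exact: gphi.
rewrite (off (partials s phi)) => [|x]; last exact: partials_support.
rewrite (off phi) => [|x px]; last by apply: subset_closure.
exact: P.
Qed.

(** The equation only provides some representatives of the weak second
    derivatives; they agree almost everywhere with those of [W^{2,p}_loc]. *)
Lemma second_derivatives_power (U : set V) (p : \bar R) (w : V -> R)
    (Dw : 'I_n.+1 -> 'I_n.+1 -> V -> R) : open U -> (n.+1%:R%:E <= p)%E ->
  Wkp_loc 2 p U w -> (forall i j, weak_partials U [:: i; j] w (Dw i j)) ->
  forall i j K, compact K -> K `<=` U ->
    (\int[mu]_(x in (K : set T)) (`|Dw i j x| ^+ n.+1)%:E < +oo)%E.
Proof.
move=> oU np wW wD i j K cK KU.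
have [v wv vp] := wW [:: i; j] isT.
have mK : measurable (K : set T) by exact: compact_measurable_Rn.
have Kfin : (mu K < +oo)%E by exact: mu_compact_lty.
have ae1 := weak_partials_unique oU (wD i j) wv cK KU.
apply: (le_lt_trans _ (@Lfun_power_lty _ T R mu K _ p n mK Kfin (vp K cK KU) np)).
have mX (g : V -> R) : Lp_loc 1%E U g -> measurable_fun (K : set T) (fun x : T => (`|g x| ^+ n.+1)%:E).
  move=> g1; have [/measurable_EFinP mg _] := integrableP _ _ _ (L1_loc_integrable g1 cK KU).
  by apply/measurable_EFinP; apply: measurable_funX; exact: measurableT_comp.
have [_ v1 _] := wv; have [_ d1 _] := wD i j.
rewrite (@ge0_ae_eq_integral _ T R mu K (fun x : T => (`|Dw i j x| ^+ n.+1)%:E)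
  (fun x : T => (`|v x| ^+ n.+1)%:E) mK (mX _ d1) (mX _ v1)).
- rewrite le_eqVlt; apply/orP; left; apply/eqP; apply: eq_integral => x xK.
  by rewrite /patch xK.
- by move=> x _; rewrite lee_fin exprn_ge0.
- by move=> x _; rewrite lee_fin exprn_ge0.
by apply: filterS ae1 => x h Kx; rewrite h.
Qed.

End weak_derivatives.

(** * Quadratic growth *)

Section euclidean_balls.
Variables (R : realType) (n : nat).
Local Notation V := 'rV[R]_n.+1.

Lemma sqdist_ge0 (x y : V) : 0 <= sqdist x y.
Proof. by apply: sumr_ge0 => i _; exact: sqr_ge0. Qed.

Lemma sqdistxx (x : V) : sqdist x x = 0.
Proof. by apply: big1 => i _; rewrite subrr expr0n. Qed.

Lemma norm_sqdist (x y : V) : `|y - x| ^+ 2 <= sqdist x y <= (n.+1%:R * `|y - x|) ^+ 2.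
Proof.
apply/andP; split.
  rewrite -(sqr_sqrtr (sqdist_ge0 x y)) lerXn2r ?nnegrE ?sqrtr_ge0//.
  apply/norm_rV_leP => i; rewrite -(sqrtr_sqr) ler_wsqrtr//.
  rewrite /sqdist (bigD1 i) //= !mxE lerDl.
  by apply: sumr_ge0 => j _; exact: sqr_ge0.
apply: (@le_trans _ _ (\sum_(i < n.+1) `|y - x| ^+ 2)).
  apply: ler_sum => i _; rewrite -real_normK ?num_real// lerXn2r ?nnegrE//.
  by have := coord_norm_le (y - x) i; rewrite !mxE.
rewrite sumr_const card_ord -[leLHS]mulr_natl exprMn ler_wpM2r ?exprn_ge0//.
by rewrite expr2 -natrM ler_nat leq_pmulr.
Qed.

Lemma eballE (x : V) (r : R) : 0 < r -> eball x r = [set y | sqdist x y < r ^+ 2].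
Proof.
move=> r0; apply/seteqP; split => y /=.
  rewrite /eball /= /enorm => h.
  have e : \sum_i (y - x) 0 i ^+ 2 = sqdist x y.
    by apply: eq_bigr => i _; rewrite !mxE.
  move: h; rewrite e => h; rewrite -(sqr_sqrtr (sqdist_ge0 x y)).
  by rewrite ltrXn2r ?nnegrE ?sqrtr_ge0 ?(ltW r0).
rewrite /eball /= /enorm => h.
have -> : \sum_i (y - x) 0 i ^+ 2 = sqdist x y.
  by apply: eq_bigr => i _; rewrite !mxE.
by rewrite -(ger0_norm (ltW r0)) -sqrtr_sqr ltr_sqrt// exprn_gt0.
Qed.

Lemma eball_open (x : V) (r : R) : 0 < r -> open (eball x r).
Proof.
move=> r0; rewrite eballE//.
have : open (sqdist x @^-1` [set t | t < r ^+ 2]).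
  by apply: open_comp; [move=> y _; exact: sqdist_continuous|exact: open_lt].
by [].
Qed.

Lemma norm_eball (x y : V) (r : R) : n.+1%:R * `|y - x| < r -> eball x r y.
Proof.
move=> h; have r0 : 0 < r by apply: le_lt_trans h; exact: mulr_ge0.
rewrite eballE//=; have /andP[_ h2] := norm_sqdist x y; apply: (le_lt_trans h2).
by rewrite ltrXn2r ?nnegrE ?mulr_ge0 ?(ltW r0).
Qed.

End euclidean_balls.

Section nondegeneracy.
Variables (R : realType) (n : nat).
Local Notation V := 'rV[R]_n.+1.
Local Notation T := (lebesgue_space R n).
Local Notation mu := (lebesgueRn R n).

(** [w - kap * sqdist x1] is positive at [x1] and, by the maximum principle on
    the part of a cube where it exceeds half its value at [x1], it is still
    positive somewhere on the boundary of the cube. *)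
Lemma quadratic_growth (Om : set V) (a : V -> 'M[R]_n.+1) (w : V -> R)
    (Dw : 'I_n.+1 -> 'I_n.+1 -> V -> R) (l L kap s : R) (x1 : V) :
  0 < l -> 0 <= L -> 0 < kap -> 0 < s -> open Om ->
  (forall x, Om x -> 0 < w x) -> 
  (forall x, `|x - x1| <= s -> {for x, continuous w}) ->
  (forall x, `|x - x1| <= s -> 0 < w x -> Om x) ->
  (forall i j, weak_partials Om [:: i; j] w (Dw i j)) ->
  (forall i j K, compact K -> K `<=` Om ->
    (\int[mu]_(x in (K : set T)) (`|Dw i j x| ^+ n.+1)%:E < +oo)%E) ->
  {ae mu, forall x : T, Om x -> (a x)^T = a x /\ mx_between l L (a x)} ->
  {ae mu, forall x : T, Om x ->
     2 * kap * \sum_i a x i i <= \sum_i \sum_j a x i j * Dw i j x} ->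
  Om x1 -> exists x, `|x - x1| <= s /\ kap * s ^+ 2 <= w x.
Proof.
move=> l0 L0 kap0 s0 oO Opos wc wO wD Dfin ell ineq Ox1.
pose v (x : V) : R := w x - kap * sqdist x1 x.
have m0 := Opos _ Ox1.
(* Any level strictly between 0 and w x1 keeps the superlevel set inside Om. *)
pose tau := w x1 / 2.
have tau0 : 0 < tau by rewrite divr_gt0.
pose Q : set V := [set x | forall i, (x1 - const_mx s) 0 i <= x 0 i <= (x1 + const_mx s) 0 i].
have QP x : Q x <-> `|x - x1| <= s.
  split=> [Qx|/norm_rV_leP h i].
    apply/norm_rV_leP => i; have := Qx i; rewrite !mxE ler_norml => /andP[? ?].
    by apply/andP; split; lra.
  by have := h i; rewrite !mxE ler_norml => /andP[? ?]; apply/andP; split; lra.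
have cQ : compact Q by exact: closed_box_compact.
pose A : set V := [set x | Q x /\ tau <= v x].
have vc x : Q x -> v y @[y --> x] --> v x.
  move=> /QP /wc wx.
  have c0 : sqdist x1 y @[y --> x] --> sqdist x1 x by exact: sqdist_continuous.
  exact: (cvgB wx (cvgM (cvg_cst kap) c0)).
have cA : compact A.
  apply: (@subclosed_compact _ A Q) => //; last by move=> x [].
  move=> x clx.
  have Qx : Q x.
    have clQ : closed Q by apply: compact_closed => //; exact: norm_hausdorff.
    by apply: clQ; apply: closure_subset clx => y [].
  split=> //; rewrite leNgt; apply/negP => vx.
  have /clx[y [[_ ty] /=]] : nbhs x [set y | v y < tau].
    exact: (cvgr_lt _ (vc x Qx) tau vx).
  by rewrite ltNge ty.
have AO : A `<=` Om.
  move=> x [/QP Qx tx]; apply: wO => //; apply: (lt_le_trans tau0).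
  by apply: (le_trans tx); rewrite lerBlDr lerDl mulr_ge0 ?sqdist_ge0 ?(ltW kap0).
have vx1 : v x1 = w x1 by rewrite /v sqdistxx mulr0 subr0.
have tv1 : tau < v x1 by rewrite vx1 /tau; lra.
have Ax1 : A x1.
  by split; [apply/QP; rewrite subrr normr0 ltW|exact: ltW].
have [x Ax [tx nint]] := @max_principle R n Om A a w Dw l L kap tau x1 x1 oO cA AO l0 L0
  (fun x Ax => wc x ((QP x).1 Ax.1)) wD Dfin ell ineq Ax1 tv1.
have /QP Qx := Ax.1; exists x; split => //.
have xs : s <= `|x - x1|.
  rewrite leNgt; apply/negP => xs; apply: nint.
  have n1 : nbhs x [set y | `|y - x1| < s].
    have cn : `|y - x1| @[y --> x] --> `|x - x1|.
      have cs : y - x1 @[y --> x] --> x - x1 by exact: (cvgB cvg_id (cvg_cst x1)).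
      exact: (cvg_norm cs).
    exact: (cvgr_lt _ cn s xs).
  have n2 : nbhs x [set y | tau < v y] by exact: (cvgr_gt _ (vc x Ax.1) tau tx).
  apply: filterS2 n1 n2 => y ys ty; split; last exact: ltW.
  by apply/QP; exact: ltW.
apply: (@le_trans _ _ (kap * sqdist x1 x)).
  rewrite ler_wpM2l ?(ltW kap0)//; have /andP[h _] := norm_sqdist x1 x.
  by apply: le_trans h; rewrite lerXn2r ?nnegrE ?(ltW s0).
move: tx tau0; rewrite /v; lra.
Qed.

Lemma ae_mono (P Q : T -> Prop) : (forall x, P x -> Q x) ->
  {ae mu, forall x, P x} -> {ae mu, forall x, Q x}.
Proof. by move=> PQ; apply: filterS. Qed.

Lemma trace_le_equation (U : set V) (a : V -> 'M[R]_n.+1)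
    (Dw : 'I_n.+1 -> 'I_n.+1 -> V -> R) (l L kap : R) :
  0 < l -> 0 < kap -> 2 * kap * (n.+1%:R * L) = 1 ->
  {ae mu, forall x : T, U x -> (a x)^T = a x /\ mx_between l L (a x)} ->
  {ae mu, forall x : T, U x -> \sum_i \sum_j a x i j * Dw i j x = 1} ->
  {ae mu, forall x : T, U x ->
    2 * kap * \sum_i a x i i <= \sum_i \sum_j a x i j * Dw i j x}.
Proof.
move=> l0 kap0 kL ell eqn.
apply: filterS2 ell eqn => x ellx eqx Ux; have [sa ab] := ellx Ux.
have aL i : a x i i <= L.
  apply: (le_trans (ler_norm _)).
  apply: (@entry_le R n.+1 (fun i j => a x i j) L) => [j k|xi].
    by rewrite -[in LHS]sa mxE.
  have /andP[h ->] := mx_between_qform ab xi; rewrite andbT (le_trans _ h)//.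
  by rewrite mulr_ge0 ?(ltW l0)// sumr_ge0// => k _; exact: sqr_ge0.
rewrite (eqx Ux) -[leRHS]kL ler_wpM2l ?mulr_ge0 ?(ltW kap0)//.
apply: (@le_trans _ _ (\sum_(i < n.+1) L)); first by rewrite ler_sum.
by rewrite sumr_const card_ord -[leLHS]mulr_natl.
Qed.

End nondegeneracy.

(* The dimension of the space is n.+1. *)
Theorem theorem4p1 (R : realType) (n : nat) (Lambda : R) (hLambda : 0 < Lambda) :
  exists2 C : R, 0 < C &
    forall (lambda : R) (p : \bar R) (a : 'rV[R]_n.+1 -> 'M[R]_n.+1)
      (w : 'rV[R]_n.+1 -> R),
    0 < lambda ->
    (n.+1%:R%:E <= p)%E ->
    (forall i j, measurable_fun (eball 0 1 : set (lebesgue_space R n))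
       (fun x : lebesgue_space R n => a x i j)) ->
    {ae lebesgueRn R n, forall x, eball 0 1 x ->
       (a x)^T = a x /\ mx_between lambda Lambda (a x)} ->
    (forall x, eball 0 1 x -> 0 <= w x) ->
    let Omega := [set x | eball 0 1 x /\ 0 < w x] in
    strong_solution p (eball 0 1) a w (\1_Omega) ->
    forall (x0 : 'rV[R]_n.+1) (r : R),
      0 < r -> eball x0 r `<=` eball 0 1 -> closure Omega x0 ->
      ((C * r ^+ 2)%:E <= ereal_sup [set (w x)%:E | x in eball x0 r])%E.
Proof.
have d0 : 0 < n.+1%:R :> R by rewrite ltr0n.
(* The trace of a is at most n.+1 * Lambda, so that 2 * kap times it is at most 1. *)
pose kap : R := (2 * n.+1%:R * Lambda)^-1.
have kap0 : 0 < kap by rewrite invr_gt0 !mulr_gt0.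
exists (kap / (4 * n.+1%:R) ^+ 2); first by rewrite divr_gt0// exprn_gt0// mulr_gt0.
move=> lambda p a w l0 np _ ell w0 Omega [wc wW [D wD Deq]] x0 r r0 rB clx0.
(* The sup-norm cube of radius s around a point at distance s from x0 fits in the ball. *)
pose s : R := r / (4 * n.+1%:R).
have s0 : 0 < s by rewrite divr_gt0// mulr_gt0.
have oB : open (eball (0 : 'rV[R]_n.+1) 1) by exact: eball_open.
have wcB x : eball 0 1 x -> {for x, continuous w}.
  by move=> Bx; move: wc; rewrite continuous_open_subspace// => /(_ x (mem_set Bx)).
have oO : open Omega.
  rewrite openE => x [Bx wx] /=.
  have n1 : nbhs x (eball 0 1) by exact: open_nbhs_nbhs.
  have n2 : nbhs x [set y | 0 < w y] by exact: (cvgr_gt _ (wcB x Bx) 0 wx).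
  by apply: filterS2 n1 n2 => y.
have OB : Omega `<=` eball 0 1 by move=> x [].
have [x1 [Ox1 x1x0]] : Omega `&` ball x0 s !=set0.
  by apply: clx0; exact: nbhsx_ballx.
have near_x0 x : `|x - x1| <= s -> eball x0 r x.
  move=> xs; apply: norm_eball.
  have : `|x - x0| < s + s.
    rewrite -(subrKA x1) (le_lt_trans (ler_normD _ _))// ler_ltD//.
    by move: x1x0; rewrite mx_norm_ball /ball_ /= distrC.
  rewrite -(ltr_pM2l d0) => /lt_trans; apply.
  have -> : n.+1%:R * (s + s) = r / 2 by rewrite /s; field; rewrite gt_eqF.
  lra.
have ellO : {ae lebesgueRn R n, forall x : lebesgue_space R n, Omega x ->
    (a x)^T = a x /\ mx_between lambda Lambda (a x)}.
  move: ell; apply: ae_mono.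
  by move=> x h /OB.
have ineq : {ae lebesgueRn R n, forall x : lebesgue_space R n, Omega x ->
    2 * kap * \sum_i a x i i <= \sum_i \sum_j a x i j * D i j x}.
  apply: (@trace_le_equation R n Omega a D lambda Lambda kap l0 kap0 _ ellO).
    by rewrite /kap; field; rewrite !gt_eqF.
  move: Deq; apply: ae_mono.
  by move=> x h Ox; rewrite (h (OB _ Ox)) indicE mem_set.
have Dfin i j K (cK : compact K) (KO : K `<=` Omega) :=
  @second_derivatives_power R n (eball 0 1) p w D oB np wW wD i j K cK (subset_trans KO OB).
have wDO i j := weak_partials_sub oB oO OB (wD i j).
have [x [xs wx]] := @quadratic_growth R n Omega a w D lambda Lambda kap s x1 l0 (ltW hLambda)
  kap0 s0 oO (fun x Ox => Ox.2) (fun x xs => wcB x (rB x (near_x0 x xs)))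
  (fun x xs wx => conj (rB x (near_x0 x xs)) wx) wDO Dfin ellO ineq Ox1.
apply: (@le_trans _ _ (w x)%:E); last by apply: ereal_sup_ubound; exists x => //; exact: near_x0.
rewrite lee_fin (le_trans _ wx)// le_eqVlt; apply/orP; left; apply/eqP.
by rewrite /s; field; rewrite gt_eqF.
Qed.
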